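(* The NP-complete problem 3-SAT can be polynomially reduced to the decision problem of whether $\kappa(v)>c$ for a water transport instance. That is, there is a polynomial-time computable map which assigns to every 3-SAT formula $F$ a water transport instance, consisting of a finite connected simple graph $G=(V,E)$, a target vertex $v\in V$ and an initial water profile $\{\eta_0(u)\}_{u\in V}$ with non-negative rational values, together with a rational constant $c$, such that $$F \text{ is satisfiable}\quad\Longleftrightarrow\quad \kappa(v)>c .$$
   Context: Water transport: let $G=(V,E)$ be a connected simple undirected graph and $\{\eta_0(u)\}_{u\in V}\in[0,C]^V$ an initial water profile (for some capacity $C>0$). In round $k\ge 1$ one chooses an edge $\langle x,y\rangle\in E$ and $\mu_k\in[0,\tfrac12]$ and sets $$\eta_k(x)=\eta_{k-1}(x)+\mu_k\,(\eta_{k-1}(y)-\eta_{k-1}(x)),\qquad \eta_k(y)=\eta_{k-1}(y)+\mu_k\,(\eta_{k-1}(x)-\eta_{k-1}(y)),$$ with $\eta_k(w)=\eta_{k-1}(w)$ for all $w\in V\setminus\{x,y\}$. A finite move sequence is a finite list $\big((e_k,\mu_k)\big)_{k=1}^T\in(E\times[0,\tfrac12])^T$, $T\in\{0,1,2,\dots\}$. For a target vertex $v$, $\kappa(v)$ is the supremum of all values $\eta_T(v)$ achievable by finite move sequences (over all $T$). 3-SAT: a literal over a set of Boolean variables is a variable $x$ or its negation $\overline{x}$. A clause is a disjunction of literals; a formula in conjunctive normal form is a conjunction of finitely many clauses; it is satisfiable if some truth assignment makes at least one literal in every clause true. 3-SAT is the problem of deciding satisfiability of formulas in conjunctive normal form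 in which every clause consists of at most 3 literals. *)

(* Defs.v *)
From Corelib Require Import BinNums.
From HB Require Import structures.
From mathcomp Require Import all_boot all_order all_algebra.
From mathcomp Require Import boolp classical_sets reals.

Set Implicit Arguments.
Unset Strict Implicit.
Unset Printing Implicit Defensive.

Import Order.TTheory GRing.Theory Num.Theory.
Local Open Scope ring_scope.

(** * Water transport *)

Section WaterTransport.
Variables (R : realType) (V : eqType).

(* ((x, y), mu) : the edge <x, y> is chosen with mixing parameter mu.  The
   update is symmetric in x and y, so the orientation of the pair is
   immaterial. *)
Definition move : Type := (V * V * R)%type.

Definition apply_move (eta : V -> R) (m : move) : V -> R :=
  let: (x, y, mu) := m in
  fun w => if w == x then eta x + mu * (eta y - eta x)
           else if w == y then eta y + mu * (eta x - eta y)
           else eta w.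

Definition legal_move (adj : rel V) (m : move) : bool :=
  let: (x, y, mu) := m in adj x y && (0 <= mu <= 2^-1).

Definition final_profile (eta0 : V -> R) (s : seq move) : V -> R :=
  foldl apply_move eta0 s.

Definition achievable (adj : rel V) (eta0 : V -> R) (v : V) : set R :=
  [set h | exists2 s : seq move,
             all (legal_move adj) s & h = final_profile eta0 s v]%classic.

Definition kappa (adj : rel V) (eta0 : V -> R) (v : V) : R :=
  sup (achievable adj eta0 v).

End WaterTransport.

(* The graph is given by a list of edges; order, orientation and repetitions
   in the list do not affect the graph, which is [wadj]. *)
Definition edge_rel (n : nat) (E : seq ('I_n * 'I_n)) : rel 'I_n :=
  fun x y => ((x, y) \in E) || ((y, x) \in E).

Record water_instance : Type := WaterInstance {
  nvertices : nat;
  edges : seq ('I_nvertices * 'I_nvertices);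
  profile : {ffun 'I_nvertices -> rat};
  target : 'I_nvertices;
  threshold : rat;
  edges_loopless : forall x, ~~ edge_rel edges x x;
  edges_connected : forall x y, connect (edge_rel edges) x y;
  profile_ge0 : forall u, 0 <= profile u
}.

Definition wadj (I : water_instance) : rel 'I_(nvertices I) := edge_rel (edges I).

Definition instance_kappa (R : realType) (I : water_instance) : R :=
  kappa (@wadj I) (fun u => ratr (profile I u)) (target I).

(** * 3-SAT *)

(* (true, i) is the variable x_i and (false, i) its negation. *)
Definition literal : Type := (bool * nat)%type.
Definition clause : Type := seq literal.
Definition cnf : Type := seq clause.

Definition literal_true (a : nat -> bool) (l : literal) : bool :=
  a l.2 == l.1.

Definition satisfiable (F : cnf) : Prop :=
  exists a : nat -> bool, all (has (literal_true a)) F.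

Definition cnf3 : Type := {F : cnf | all (fun c : clause => (size c <= 3)%N) F}.

(** * Deterministic multi-tape Turing machines *)

Inductive direction := MoveLeft | Stay | MoveRight.

Section TuringMachines.
Variable S : finType. (* input/output alphabet *)

(* The tape alphabet consists of a blank (None), the input/output symbols and
   the auxiliary symbols of the machine. *)
Definition cell (aux : finType) : Type := option (S + aux).

Record turing_machine : Type := TuringMachine {
  aux : finType;
  tapes : nat; (* number of tapes minus one *)
  state : finType;
  start : state;
  halting : pred state;
  transition : state -> {ffun 'I_tapes.+1 -> cell aux} ->
               state * {ffun 'I_tapes.+1 -> cell aux * direction}
}.

(* (l, c, r) : c is the scanned cell, l lists the cells to its left (nearest
   first), r those to its right; all cells beyond l and r are blank. *)
Definition tape (aux : finType) : Type :=
  (seq (cell aux) * cell aux * seq (cell aux))%type.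

Definition scanned aux (t : tape aux) : cell aux := t.1.2.

Definition update_tape aux (t : tape aux) (wd : cell aux * direction) :
    tape aux :=
  let: (l, _, r) := t in
  let: (c, d) := wd in
  match d with
  | MoveLeft => (behead l, head None l, c :: r)
  | Stay => (l, c, r)
  | MoveRight => (c :: l, head None r, behead r)
  end.

Definition tape_of_word aux (w : seq S) : tape aux :=
  let s := [seq Some (inl a) | a <- w] in ([::], head None s, behead s).

(* The maximal word over S starting at the scanned cell. *)
Fixpoint read_word aux (s : seq (cell aux)) : seq S :=
  if s is Some (inl a) :: s' then a :: read_word s' else [::].

Definition word_of_tape aux (t : tape aux) : seq S :=
  let: (_, c, r) := t in read_word (c :: r).

Definition config (M : turing_machine) : Type :=
  (state M * {ffun 'I_(tapes M).+1 -> tape (aux M)})%type.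

Definition init_config (M : turing_machine) (w : seq S) : config M :=
  (start M, [ffun i => tape_of_word (aux M) (if i == ord0 then w else [::])]).

Definition step (M : turing_machine) (c : config M) : config M :=
  let: (q, T) := c in
  if halting q then c else
  let: (q', act) := transition q [ffun i => scanned (T i)] in
  (q', [ffun i => update_tape (T i) (act i)]).

(* Input on the first tape, output on the last one. *)
Definition outputs_within (M : turing_machine) (w : seq S) (t : nat)
    (w' : seq S) : Prop :=
  let c := iter t (@step M) (init_config M w) in
  halting c.1 /\ word_of_tape (c.2 ord_max) = w'.

Definition poly_time_computable (X Y : Type) (encX : X -> seq S)
    (encY : Y -> seq S) (f : X -> Y) : Prop :=
  exists (M : turing_machine) (p : {poly nat}), forall x : X,
    outputs_within M (encX x) p.[size (encX x)] (encY (f x)).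

End TuringMachines.

(** * Encodings over a four-letter alphabet *)

Inductive symbol := Bit of bool | Comma | Semicolon.

Definition symbol_code (s : symbol) : option (option bool) :=
  match s with
  | Bit b => Some (Some b)
  | Comma => Some None
  | Semicolon => None
  end.

Definition symbol_decode (o : option (option bool)) : symbol :=
  match o with
  | Some (Some b) => Bit b
  | Some None => Comma
  | None => Semicolon
  end.

Lemma symbol_codeK : cancel symbol_code symbol_decode.
Proof. by case. Qed.

HB.instance Definition _ := Finite.copy symbol (can_type symbol_codeK).

Fixpoint positive_bits (p : positive) : seq bool :=
  match p with
  | xH => [:: true]
  | xO p' => false :: positive_bits p'
  | xI p' => true :: positive_bits p'
  end.

(* Binary, least significant digit first; 0 is the empty word. *)
Definition nat_bits (n : nat) : seq bool :=
  if bin_of_nat n is Npos p then positive_bits p else [::].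

Definition encode_nat (n : nat) : seq symbol :=
  rcons [seq Bit b | b <- nat_bits n] Comma.

(* Sign bit, then numerator and denominator in lowest terms. *)
Definition encode_rat (q : rat) : seq symbol :=
  Bit (q < 0) :: encode_nat `|numq q|%N ++ encode_nat `|denq q|%N.

Definition encode_list (T : Type) (enc : T -> seq symbol) (s : seq T) :
    seq symbol :=
  rcons (flatten [seq enc x | x <- s]) Semicolon.

Definition encode_literal (l : literal) : seq symbol :=
  Bit l.1 :: encode_nat l.2.

Definition encode_cnf (F : cnf) : seq symbol :=
  encode_list (encode_list encode_literal) F.

Definition encode_cnf3 (F : cnf3) : seq symbol := encode_cnf (sval F).

Definition encode_edge (n : nat) (e : 'I_n * 'I_n) : seq symbol :=
  encode_nat e.1 ++ encode_nat e.2.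

Definition encode_water_instance (I : water_instance) : seq symbol :=
  encode_nat (nvertices I)
  ++ encode_list (@encode_edge (nvertices I)) (edges I)
  ++ encode_list encode_rat [seq profile I u | u <- enum 'I_(nvertices I)]
  ++ encode_nat (target I)
  ++ encode_rat (threshold I).

(* Main.v *)
(* Reduction.  The source S_0, with an overwhelming level, and the other spine
   vertices S_1, ..., S_3M, with a large common level, are joined in a chain of
   layers: every cell of layer l is adjacent to S_l and S_(l+1), and the target
   is S_3M.  A path from source to target takes the whole spine and one cell of
   each layer.  Its choices are a truth value for each position p of the encoded
   formula (M symbols) and, for each clause, one of the literals of the clause.
   The cell standing for the value b of p is the centre of a spider whose two
   far ends are filled cells; they are off the path exactly if b agrees with the
   next occurrence of the variable and with the literal chosen by the clause.

   Satisfiable formulas: averaging first over the M spiders whose centres are on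
   the path and then over the path adds 2M units of water, each divided by the
   size L + 2D + 4 of a spider with its ends, where L is much larger than D.

   Unsatisfiable formulas: let beta be a function on vertex sets such that
   beta A bounds the initial amount of water in A and
   beta (A - y) + beta (A + x) <= 2 beta A for all edges xy leaving A.  As
   mu <= 1/2, a move replaces the amount in A by a convex combination of the
   amounts in A, A - y and A + x, so beta remains a bound for ever.  Functions
   1 - prod_(u in A) d u / (d u + 1) with d 1-Lipschitz have this property, and
   beta combines them with weights of decreasing order of magnitude for the
   source, the spine and the cells.  The two largest terms confine A to sets that
   look like a path, and on these the term of the cells sees at most 2M - 1
   spider ends, each divided by L + D + 3.

   Computability.  Machines are programmed in a small language of stack commands;
   functions of the input word and of unary numbers are closed under bounded
   sums, which suffices for the edge list.  The huge levels are powers of two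
   times small numbers, so their binary digits are mostly runs of zeros. *)

(* The constraints of the network are one-way implications from an occurrence of a variable to the
   next one. They force equality because the occurrences are arranged in a cycle. The successor map
   is then a permutation, so every cell is a centre or an end of at most one spider; this makes
   spiders disjoint and the counts sharp. An unsatisfiable instance may miss the optimum by a single
   spider end, so the two bounds have to be close. They use different denominators: flattening
   spreads water over the whole spider, of size L + 2D + 4, while the potential treats the two ends
   separately, each at distance L + D + 2 from the centre. L = 2M(D + 1) makes this harmless. The
   distances in that potential cannot be those of the graph: for one end of a spider, the other end,
   which may lie on the path, has to be infinitely far away. This breaks the Lipschitz condition
   along one edge of the spider, and the loss is covered by the potential of the other end. The
   threshold equals the upper bound of the unsatisfiable case, and all levels are scaled so that it
   is a natural number. *)
Require Import Defs.
From Corelib Require Import BinNums.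
From HB Require Import structures.
From mathcomp Require Import all_boot all_order all_algebra.
From mathcomp Require Import boolp classical_sets reals.
From mathcomp Require Import zify lra ring.

Set Implicit Arguments.
Unset Strict Implicit.
Unset Printing Implicit Defensive.

Import Order.TTheory GRing.Theory Num.Theory.

(** * Turing machines from stack programs *)

Section Fragments.
Variables (S : finType) (N : nat).

Local Notation letter := (cell S void).
Local Notation tapes := {ffun 'I_N.+1 -> tape S void}.

Definition action : Type := ('I_N.+1 * letter * direction)%type.

Definition perform (a : action) (T : tapes) : tapes :=
  [ffun i => update_tape (T i)
     (if i == a.1.1 then (a.1.2, a.2) else (scanned (T i), Stay))].

Definition read (T : tapes) : {ffun 'I_N.+1 -> letter} :=
  [ffun i => scanned (T i)].

(* The next state [None] leaves the fragment. *)
Record frag := Frag {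
  fstate : finType;
  fentry : fstate;
  ftrans : fstate -> {ffun 'I_N.+1 -> letter} -> option fstate * action }.

Inductive frag_run (F : frag) : fstate F -> tapes -> nat -> tapes -> Prop :=
| RunExit q T a : ftrans q (read T) = (None, a) ->
    frag_run q T 1 (perform a T)
| RunStep q T q' a n T' : ftrans q (read T) = (Some q', a) ->
    frag_run q' (perform a T) n T' -> frag_run q T n.+1 T'.

Definition prim_frag (a : {ffun 'I_N.+1 -> letter} -> action) : frag :=
  Frag tt (fun _ rd => (None, a rd)).

Definition seq_frag (F G : frag) : frag :=
  @Frag (fstate F + fstate G)%type (inl (fentry F))
    (fun q rd => match q with
     | inl q1 => let: (o, a) := ftrans q1 rd in
         (Some (if o is Some q2 then inl q2 else inr (fentry G)), a)
     | inr q1 => let: (o, a) := ftrans q1 rd in (omap inr o, a)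
     end).

(** The popped letter is remembered in the control state, a sigma type over the letters; this is how
    a program can depend on what it reads. *)
Definition pop_frag (loop : bool) (i : 'I_N.+1) (F : S -> frag) : frag :=
  @Frag (option {a : S & fstate (F a)}) None
    (fun q rd => match q with
     | None => match rd i with
       | Some (inl a) => (Some (Some (existT (fun a => fstate (F a) : Type) a (fentry (F a)))), (i, None, MoveRight))
       | _ => (None, (i, None, Stay))
       end
     | Some q1 => let: (o, a) := ftrans (tagged q1) rd in
         (if o is Some q2 then Some (Some (existT (fun a => fstate (F a) : Type) _ q2))
          else if loop then Some None else None, a)
     end).

(** The output is written from left to right, whereas [word_of_tape] reads from the scanned cell on.
    The head walks back to the blank before the first letter and steps right; state [false] is the
    first step, off the blank behind the output. *)
Definition rewind_frag : frag :=
  @Frag bool false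
    (fun q rd =>
       if q then if rd ord_max is Some _ then (Some true, (ord_max, rd ord_max, MoveLeft))
                 else (None, (ord_max, None, MoveRight))
       else (Some true, (ord_max, rd ord_max, MoveLeft))).

Lemma seq_frag_runr (F G : frag) (q : fstate G) T n T' :
  frag_run q T n T' -> frag_run (inr q : fstate (seq_frag F G)) T n T'.
Proof.
elim=> {q T n T'} [q T a E|q T q' a n T' E _ IH].
  by apply: RunExit; rewrite /= E.
by apply: RunStep IH; rewrite /= E.
Qed.

Lemma seq_frag_run (F G : frag) (q : fstate F) T n T1 m T2 :
  frag_run q T n T1 -> frag_run (fentry G) T1 m T2 ->
  frag_run (inl q : fstate (seq_frag F G)) T (n + m) T2.
Proof.
move=> H HG; elim: H HG => {q T n T1} [q T a E|q T q' a n T' E _ IH] HG.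
  apply: (@RunStep (seq_frag F G) _ _ (inr (fentry G)) a); first by rewrite /= E.
  exact: seq_frag_runr.
apply: (@RunStep (seq_frag F G) _ _ (inl q') a); first by rewrite /= E.
exact: IH.
Qed.

Lemma pop_frag_body loop i (F : S -> frag) a (q : fstate (F a)) T n T' :
  frag_run q T n T' ->
  let q1 : fstate (pop_frag loop i F) := Some (existT (fun a => fstate (F a) : Type) _ q) in
  if loop then forall m T2,
      frag_run (fentry (pop_frag loop i F)) T' m T2 -> frag_run q1 T (n + m) T2
  else frag_run q1 T n T'.
Proof.
elim=> {q T n T'} [q T b E|q T q' b n T' E _] /=; case: loop => //=.
- move=> m T2 H; apply: (@RunStep (pop_frag true i F) _ _ None b) H.
  by rewrite /= E.
- by apply: (@RunExit (pop_frag false i F)); rewrite /= E.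
- move=> IH m T2 H.
  apply: (@RunStep (pop_frag true i F) _ _ (Some (existT (fun a => fstate (F a) : Type) _ q')) b).
    by rewrite /= E.
  exact: IH.
- move=> IH.
  apply: (@RunStep (pop_frag false i F) _ _ (Some (existT (fun a => fstate (F a) : Type) _ q')) b) IH.
  by rewrite /= E.
Qed.

Definition frag_machine (F : frag) : turing_machine S :=
  {| aux := void; Defs.tapes := N; state := option (fstate F);
     start := Some (fentry F);
     halting := fun q => ~~ isSome q;
     transition := fun q rd =>
       if q is Some q1 then
         let: (o, a) := ftrans q1 rd in
         (o, [ffun i => if i == a.1.1 then (a.1.2, a.2) else (rd i, Stay)])
       else (q, [ffun i => (rd i, Stay)]) |}.

Lemma frag_machine_run F (q : fstate F) T n T' : frag_run q T n T' ->
  iter n (@step S (frag_machine F)) (Some q, T) = (None, T').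
Proof.
have stepE (q1 : fstate F) T1 o a : ftrans q1 (read T1) = (o, a) ->
    @step S (frag_machine F) (Some q1, T1) = (o, perform a T1).
  move=> E; rewrite /step /= /read in E *.
  rewrite E; congr (_, _); apply/ffunP => i; rewrite !ffunE /=.
  by case: eqP.
elim=> {q T n T'} [q T a E|q T q' a n T' E _ IH]; first exact: stepE.
by rewrite iterSr (stepE _ _ _ _ E).
Qed.

(** [outputs_within] inspects the configuration after exactly [t] steps, so a halted machine has to
    stay where it is. *)
Lemma frag_machine_halted F T n :
  iter n (@step S (frag_machine F)) (None, T) = (None, T).
Proof. by elim: n => //= n ->. Qed.

End Fragments.

(** * Stack programs and their compilation *)

Section Commands.
Variable S : finType.

Inductive cmd :=
| Nop
| Seq of cmd & cmd
| Push of nat & S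
| Emit of S
| Pop of bool & nat & (S -> cmd).

(* Stacks with their tops first, and the reversed output. *)
Definition store : Type := ((nat -> seq S) * seq S)%type.

Definition set_stack (i : nat) (s : seq S) (st : store) : store :=
  ((fun j => if j == i then s else st.1 j), st.2).

(* [Pop false i f] pops a letter [a] and executes [f a]; [Pop true i f] repeats
   this until stack [i] is empty. *)
Inductive exec : cmd -> store -> nat -> store -> Prop :=
| ENop st : exec Nop st 1 st
| ESeq c1 c2 st n1 st1 n2 st2 : exec c1 st n1 st1 -> exec c2 st1 n2 st2 ->
    exec (Seq c1 c2) st (n1 + n2) st2
| EPush i a st : exec (Push i a) st 2 (set_stack i (a :: st.1 i) st)
| EEmit a st : exec (Emit a) st 1 (st.1, a :: st.2)
| EPopEmpty l i f st : st.1 i = [::] -> exec (Pop l i f) st 1 st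
| EPop i f st a s n st' : st.1 i = a :: s ->
    exec (f a) (set_stack i s st) n st' -> exec (Pop false i f) st n.+1 st'
| ELoop i f st a s n st' m st'' : st.1 i = a :: s ->
    exec (f a) (set_stack i s st) n st' -> exec (Pop true i f) st' m st'' ->
    exec (Pop true i f) st (n.+1 + m) st''.

Fixpoint max_stack (c : cmd) : nat :=
  match c with
  | Nop | Emit _ => 0
  | Seq c1 c2 => maxn (max_stack c1) (max_stack c2)
  | Push i _ => i
  | Pop _ i f => maxn i (\max_a max_stack (f a))
  end.

(** No command writes more than one letter per unit of time. This bounds the final rewind and, in
    [computable_bounded], the size of computed numbers. *)
Lemma exec_size c st n st' : exec c st n st' ->
  (forall i, size (st'.1 i) <= size (st.1 i) + n) /\
  size st'.2 <= size st.2 + n.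
Proof.
elim=> {c st n st'} //=.
- by move=> st; split=> [i|]; lia.
- move=> c1 c2 st n1 st1 n2 st2 _ [H1 H1'] _ [H2 H2'].
  by split=> [i|]; [have := H1 i; have := H2 i|]; lia.
- by move=> i a st; split=> [j|]; [case: eqP => [->|_] /=|]; lia.
- by move=> a st; split=> [j|]; lia.
- by move=> _ i f st _; split=> [j|]; lia.
- move=> i f st a s n st' E _ [H H']; split=> [j|]; last by lia.
  by have := H j; case: eqP => [->|_]; rewrite ?E /=; lia.
- move=> i f st a s n st' m st'' E _ [H H'] _ [K K']; split=> [j|]; last by lia.
  by have := H j; have := K j; case: eqP => [->|_]; rewrite ?E /=; lia.
Qed.

Variable N : nat.
Local Notation tapes := {ffun 'I_N.+1 -> tape S void}.

Fixpoint compile (c : cmd) : frag S N :=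
  match c with
  | Nop => prim_frag (fun rd => (ord_max, rd ord_max, Stay))
  | Seq c1 c2 => seq_frag (compile c1) (compile c2)
  | Push i a =>
      seq_frag (prim_frag (fun rd => (inord i, rd (inord i), MoveLeft)))
               (prim_frag (fun rd => (inord i, Some (inl a), Stay)))
  | Emit a => prim_frag (fun rd => (ord_max, Some (inl a), MoveRight))
  | Pop l i f => pop_frag l (inord i) (fun a => compile (f a))
  end.

(** A pop blanks the scanned cell and moves right, a push moves left before it writes; so blanks to
    the left of the top and below the bottom are all that can accumulate. *)
Definition stack_tape (s : seq S) (t : tape S void) : Prop :=
  let: (l, c, r) := t in
  all (fun x => x == None) l /\
  exists k, c :: r = [seq Some (inl a) | a <- s] ++ nseq k None.

Definition represents (st : store) (T : tapes) : Prop :=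
  (forall i : 'I_N.+1, i < N -> stack_tape (st.1 i) (T i)) /\
  T ord_max = ([seq Some (inl a) | a <- st.2], None, [::]).

Lemma update_stay (t : tape S void) : update_tape t (scanned t, Stay) = t.
Proof. by case: t => [[l c] r]. Qed.

Lemma represents_update st (T T' : tapes) (i : 'I_N.+1) s : i < N -> represents st T ->
  (forall j, j != i -> T' j = T j) -> stack_tape s (T' i) ->
  represents (set_stack i s st) T'.
Proof.
move=> iN [Hs Ho] E H; split=> [j jN|] /=.
  by rewrite val_eqE; case: (j =P i) => [->//|/eqP ne]; rewrite E //; apply: Hs.
by rewrite E //; apply: contraTneq iN => <-; rewrite /= ltnn.
Qed.

Lemma represents_pop st T i a s : i < N -> represents st T ->
  st.1 i = a :: s ->
  read T (inord i) = Some (inl a) /\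
  represents (set_stack i s st) (perform (inord i, None, MoveRight) T).
Proof.
move=> iN R E.
have jE : (inord i : 'I_N.+1) = i :> nat by rewrite inordK // ltnW.
move: (inord i : 'I_N.+1) jE => j jE.
have jN : j < N by rewrite jE.
have [/(_ j jN) + _] := R; rewrite !ffunE jE E => H.
split; first by case: (T j) H => [[l c] r] /= [_ [k [-> _]]].
rewrite -jE; apply: (represents_update jN R) => [k kj|].
  by rewrite !ffunE /= (negbTE kj) update_stay.
rewrite ffunE /= eqxx; case: (T j) H => [[l c] r] /= [al [k [_ ->]]].
split=> //; case: s E => [|b s] E /=; last by exists k.
by case: k => [|k]; [exists 1|exists k.+1].
Qed.

Lemma perform_stay (T : tapes) i : perform (i, read T i, Stay) T = T.
Proof.
apply/ffunP => j; rewrite !ffunE /=.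
by case: eqP => [->|_]; rewrite update_stay.
Qed.

Lemma compile_run c st n st' T : max_stack c < N ->
  exec c st n st' -> represents st T ->
  exists2 T', frag_run (fentry (compile c)) T n T' & represents st' T'.
Proof.
move=> + H; elim: H T => {c st n st'}.
- move=> st T _ R; exists T => //.
  by rewrite -{2}(perform_stay T ord_max); apply: RunExit.
- move=> c1 c2 st n1 st1 n2 st2 _ IH1 _ IH2 T /=; rewrite gtn_max => /andP[m1 m2] R.
  have [T1 r1 R1] := IH1 _ m1 R; have [T2 r2 R2] := IH2 _ m2 R1.
  by exists T2 => //; apply: seq_frag_run r1 r2.
- move=> i a st T /= iN R.
  pose j : 'I_N.+1 := inord i.
  have jE : j = i :> nat by rewrite inordK // ltnW.
  have jN : j < N by rewrite jE.
  set T1 := perform (j, read T j, MoveLeft) T.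
  exists (perform (j, Some (inl a), Stay) T1).
    apply: (@RunStep _ _ (compile (Push i a)) (inl tt) _ (inr tt) (j, read T j, MoveLeft) 1) => //.
    exact: RunExit.
  rewrite -jE; apply: (represents_update jN R) => [k kj|].
    by rewrite !ffunE /= !(negbTE kj) !update_stay.
  rewrite !ffunE /= eqxx.
  case: R => /(_ j jN) + _; case: (T j) => [[l c] r] /= [al [k E]].
  split; first by case: l al => //= x l /andP[].
  by exists k; rewrite E jE.
- move=> a st T _ [Hs Ho]; eexists; first exact: RunExit.
  split=> [i iN|]; rewrite !ffunE /=; last by rewrite Ho eqxx.
  have /negbTE-> : i != ord_max by apply: contraTneq iN => ->; rewrite /= ltnn.
  by rewrite update_stay; apply: Hs.
- move=> l i f st E T /=; rewrite gtn_max => /andP[iN _] R; exists T => //.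
  pose j : 'I_N.+1 := inord i.
  have jE : j = i :> nat by rewrite inordK // ltnW.
  have jN : j < N by rewrite jE.
  have rdE : read T j = None.
    have [/(_ j jN) + _] := R; rewrite ffunE jE E.
    by case: (T j) => [[? c] r] /= [_ [[|k] //= [-> _]]].
  rewrite -{2}(perform_stay T j) rdE; apply: RunExit.
  by rewrite /= -/j rdE.
- move=> i f st a s n st' E _ IH T /=; rewrite gtn_max => /andP[iN fN] R.
  have [rdE R1] := represents_pop iN R E.
  have fa : max_stack (f a) < N by apply: leq_ltn_trans fN; apply: leq_bigmax.
  have [T2 r2 R2] := IH _ fa R1; exists T2 => //.
  pose F a := compile (f a).
  apply: (@RunStep _ _ (pop_frag false (inord i) F) None T
    (Some (existT (fun a => fstate (F a) : Type) a (fentry (F a)))) (inord i, None, MoveRight)).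
    by rewrite /= rdE.
  by have := @pop_frag_body _ _ false (inord i) F _ _ _ _ _ r2.
- move=> i f st a s n st' m st'' E _ IH _ IH2 T /= mN R.
  have := mN; rewrite gtn_max => /andP[iN fN].
  have [rdE R1] := represents_pop iN R E.
  have fa : max_stack (f a) < N by apply: leq_ltn_trans fN; apply: leq_bigmax.
  have [T2 r2 R2] := IH _ fa R1; have [T3 r3 R3] := IH2 _ mN R2; exists T3 => //.
  pose F a := compile (f a).
  apply: (@RunStep _ _ (pop_frag true (inord i) F) None T
    (Some (existT (fun a => fstate (F a) : Type) a (fentry (F a)))) (inord i, None, MoveRight)).
    by rewrite /= rdE.
  by have := @pop_frag_body _ _ true (inord i) F _ _ _ _ _ r2; apply.
Qed.

Lemma rewind_run (T : tapes) (o : seq S) :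
  T ord_max = ([seq Some (inl a) | a <- o], None, [::]) ->
  exists2 T', frag_run (fentry (rewind_frag S N)) T (size o + 2) T' &
    word_of_tape (T' ord_max) = rev o.
Proof.
move=> To; pose F := rewind_frag S N.
have H (u v : seq S) (T1 : tapes) : T1 ord_max = ([seq Some (inl a) | a <- behead u],
      head None [seq Some (inl a) | a <- u], [seq Some (inl a) | a <- v] ++ [:: None]) ->
    exists2 T', @frag_run _ _ F true T1 (size u + 1) T' &
      word_of_tape (T' ord_max) = rev u ++ v.
  elim: u v T1 => [|a u IH] v T1 /= E.
    eexists; first by apply: RunExit; rewrite /= ffunE E.
    rewrite ffunE /= eqxx E /=.
    have R : forall v, read_word ([seq Some (inl a) | a <- v] ++ [:: None] : seq (cell S void)) = v.
      by move=> v'; elim: v' => //= ? ? ->.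
    by case: v E => [|b v] _ //=; rewrite R.
  have [|T' r' w'] := IH (a :: v) (perform (ord_max, Some (inl a), MoveLeft) T1).
    rewrite ffunE /= eqxx E /=; congr (_, _, _).
    by case: (u).
  exists T'; last by rewrite w' rev_cons cat_rcons.
  by apply: RunStep r'; rewrite /= ffunE E.
have [|T' r' w'] := H o [::] (perform (ord_max, None, MoveLeft) T).
  rewrite ffunE /= eqxx To /=; congr (_, _, _); by case: (o).
exists T'; last by rewrite w' cats0.
by rewrite addn2 -addn1; apply: RunStep r'; rewrite /= ffunE To.
Qed.

End Commands.

Theorem exec_outputs (S : finType) (c : cmd S) : exists M : turing_machine S,
  forall w n st t, exec c ((fun i => if i == 0 then w else [::]), [::]) n st ->
    n + n + 2 <= t -> outputs_within M w t (rev st.2).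
Proof.
(* Tapes below [N] are the stacks; tape [N], the last one, takes the output. *)
pose N := (max_stack c).+1.
pose F := seq_frag (compile N c) (rewind_frag S N).
exists (frag_machine F) => w n st t E nt.
have R0 : @represents S N ((fun i => if i == 0 then w else [::]), [::])
    (init_config (frag_machine F) w).2.
  split=> [i iN|]; last by rewrite ffunE.
  rewrite ffunE -(val_eqE i ord0) /= /tape_of_word.
  case: ifP => _; last by split=> //; exists 1.
  by split=> //; case: w {E} => [|a w] /=; [exists 1|exists 0; rewrite cats0].
have [T1 r1 R1] := @compile_run S N _ _ _ _ _ (ltnSn _) E R0.
have [T2 r2 R2] := rewind_run R1.2.
have := frag_machine_run (seq_frag_run r1 r2).
have [_ /= sz] := exec_size E.
rewrite /outputs_within; set c0 := init_config _ _ => H.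
have -> : t = t - (n + (size st.2 + 2)) + (n + (size st.2 + 2)) by lia.
rewrite iterD.
have -> : c0 = (Some (inl (fentry (compile N c))), c0.2) by [].
by rewrite H frag_machine_halted.
Qed.

(** * Polynomial-time computable functions *)

Definition word := seq symbol.

(** The summand 2 keeps the base at least 2 on all inputs, so that constants and sums are absorbed
    by a larger exponent. *)
Definition poly_bounded (T : word -> seq nat -> nat) : Prop :=
  exists k, forall w env, T w env <= (size w + sumn env + 2) ^ k.

Lemma leq_exp2r_weak a b k : a <= b -> a ^ k <= b ^ k.
Proof. by case: k => // k; rewrite leq_exp2r. Qed.

Lemma poly_bounded_le T U : (forall w env, T w env <= U w env) ->
  poly_bounded U -> poly_bounded T.
Proof. by move=> le [k H]; exists k => w env; apply: leq_trans (H w env). Qed.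

Lemma poly_bounded_const c : poly_bounded (fun _ _ => c).
Proof.
exists c => w env; apply: (@leq_trans (2 ^ c)); first exact/ltnW/ltn_expl.
by apply: leq_exp2r_weak; rewrite leq_addl.
Qed.

Lemma poly_bounded_add T U : poly_bounded T -> poly_bounded U ->
  poly_bounded (fun w env => T w env + U w env).
Proof.
move=> [k H] [l K]; exists (maxn k l).+1 => w env.
rewrite expnS; set x := size w + _ + 2.
have x2 : 2 <= x by rewrite leq_addl.
apply: (@leq_trans (2 * x ^ maxn k l)); last by rewrite leq_mul2r x2 orbT.
rewrite mul2n -addnn; apply: leq_add.
  by apply: leq_trans (H w env) _; rewrite leq_exp2l // leq_maxl.
by apply: leq_trans (K w env) _; rewrite leq_exp2l // leq_maxr.
Qed.

Lemma poly_bounded_mul T U : poly_bounded T -> poly_bounded U ->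
  poly_bounded (fun w env => T w env * U w env).
Proof.
by move=> [k H] [l K]; exists (k + l) => w env; rewrite expnD leq_mul.
Qed.

Lemma poly_bounded_size : poly_bounded (fun w env => size w + sumn env).
Proof. by exists 1 => w env; rewrite expn1 leq_addr. Qed.

(** In a loop the index joins the environment. If x is the old base and the index is at most x ^ l,
    the new base is at most x + x ^ l, hence at most x ^ (l + 2). *)
Lemma poly_bounded_cons T h : poly_bounded T -> poly_bounded h ->
  exists2 U, poly_bounded U & forall w env i, i <= h w env ->
    T w (i :: env) <= U w env.
Proof.
move=> [k H] [l K]; exists (fun w env => (size w + sumn env + 2) ^ (l.+2 * k)).
  by exists (l.+2 * k).
move=> w env i ih; apply: leq_trans (H _ _) _; rewrite expnM.
apply: leq_exp2r_weak => /=; set x := size w + sumn env + 2.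
have x2 : 2 <= x by rewrite leq_addl.
have := leq_trans ih (K w env); rewrite -/x => {}ih.
have xl : 0 < x ^ l by rewrite expn_gt0; lia.
rewrite !expnS; have -> : size w + (i + sumn env) + 2 = x + i by rewrite /x; lia.
move: (x) (x ^ l) x2 xl ih => {}x y x2 y0 iy.
have H1 : x <= x * y by rewrite leq_pmulr.
have H2 : y <= x * y by rewrite leq_pmull //; lia.
have H3 : 2 * (x * y) <= x * (x * y) by rewrite leq_mul2r x2 orbT.
lia.
Qed.

Definition exec_le (c : cmd symbol) (s : store symbol) (n : nat) (s' : store symbol) :=
  exists2 m, m <= n & exec c s m s'.

Lemma exec_le_weak c s n m s' : n <= m -> exec_le c s n s' -> exec_le c s m s'.
Proof. by move=> nm [k kn H]; exists k => //; apply: leq_trans nm. Qed.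

Lemma exec_le_seq c1 c2 s n1 s1 n2 s2 : exec_le c1 s n1 s1 ->
  exec_le c2 s1 n2 s2 -> exec_le (Seq c1 c2) s (n1 + n2) s2.
Proof.
by move=> [m1 l1 H1] [m2 l2 H2]; exists (m1 + m2); [exact: leq_add|exact: ESeq H1 H2].
Qed.

Lemma exec_le_nop s : exec_le (Nop symbol) s 1 s.
Proof. by exists 1 => //; exact: ENop. Qed.

Lemma exec_le_emit a s : exec_le (Emit a) s 1 (s.1, a :: s.2).
Proof. by exists 1 => //; exact: EEmit. Qed.

Definition mark : symbol := Bit true.

(* The word w on stack 0 and the numbers e 0, e 1, ... in unary above. *)
Definition stacks (w : word) (e : nat -> nat) : nat -> seq symbol :=
  fun i => if i is j.+1 then nseq (e j) mark else w.

Definition upd (e : nat -> nat) (j v : nat) : nat -> nat :=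
  fun i => if i == j then v else e i.

Lemma set_stack_stacks w e j n o :
  set_stack j.+1 (nseq n mark) (stacks w e, o) = (stacks w (upd e j n), o).
Proof.
rewrite /set_stack /=; congr pair; apply/funext => -[|i] //=.
by rewrite eqSS /upd; case: eqP.
Qed.

Lemma updE e j v i : upd e j v i = if i == j then v else e i.
Proof. by []. Qed.

Lemma exec_le_stacks c w e1 e2 e1' e2' o o' n n' :
  exec_le c (stacks w e1, o) n (stacks w e2, o') ->
  e1 =1 e1' -> e2 =1 e2' -> n <= n' ->
  exec_le c (stacks w e1', o) n' (stacks w e2', o').
Proof. by move=> H /funext<- /funext<- le; exact: exec_le_weak le H. Qed.

Ltac upd_eq := let i := fresh "i" in
  move=> i; rewrite ?updE ?eqxx;
  repeat match goal with |- context [?a == ?b] => case: (a =P b) => ?; subst; try lia end;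
  try lia.

Ltac upd_eq_at := rewrite ?updE ?eqxx;
  repeat match goal with |- context [?a == ?b] => case: (a =P b) => ?; subst; try lia end;
  try lia.

Lemma exec_le_push w e j o :
  exec_le (Push j.+1 mark) (stacks w e, o) 2 (stacks w (upd e j (e j).+1), o).
Proof. by exists 2 => //; rewrite -set_stack_stacks; exact: EPush. Qed.

Lemma exec_le_pop w e j o f n s' : 0 < e j ->
  exec_le (f mark) (stacks w (upd e j (e j).-1), o) n s' ->
  exec_le (Pop false j.+1 f) (stacks w e, o) n.+1 s'.
Proof.
move=> e0 [m mn H]; exists m.+1 => //.
apply: (@EPop _ _ _ _ mark (nseq (e j).-1 mark)); last by rewrite set_stack_stacks.
by rewrite /=; case: (e j) e0.
Qed.

Lemma exec_le_pop0 w e j o l f : e j = 0 ->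
  exec_le (Pop l j.+1 f) (stacks w e, o) 1 (stacks w e, o).
Proof. by move=> e0; exists 1 => //; apply: EPopEmpty; rewrite /= e0. Qed.

(** [E i] and [O i] are the invariant: numbers and output after [i] rounds. The counter has been
    popped when the body starts, hence [v - i.+1]. *)
Lemma exec_le_loop w j f t (E : nat -> nat -> nat) (O : nat -> seq symbol) v :
  (forall i, i <= v -> E i j = v - i) ->
  (forall i, i < v -> exec_le (f mark) (stacks w (upd (E i) j (v - i.+1)), O i) t
                       (stacks w (E i.+1), O i.+1)) ->
  exec_le (Pop true j.+1 f) (stacks w (E 0), O 0) (v * t.+1 + 1) (stacks w (E v), O v).
Proof.
elim: v E O => [|v IH] E O Ej H.
  by apply: exec_le_pop0; rewrite Ej.
have [m1 l1 H1] := H 0 isT.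
have [m2 l2 H2] : exec_le (Pop true j.+1 f) (stacks w (E 1), O 1) (v * t.+1 + 1)
    (stacks w (E v.+1), O v.+1).
  apply: (IH (fun i => E i.+1) (fun i => O i.+1)) => i iv; last exact: H.
  by rewrite Ej.
exists (m1.+1 + m2); first by lia.
apply: ELoop H2; last by rewrite subSS subn0 -set_stack_stacks in H1; exact: H1.
by rewrite /= Ej.
Qed.

Definition move_cmd i j : cmd symbol := Pop true i.+1 (fun _ => Push j.+1 mark).

Lemma exec_le_move w e o i j : i != j ->
  exec_le (move_cmd i j) (stacks w e, o) (3 * e i + 1)
    (stacks w (upd (upd e j (e j + e i)) i 0), o).
Proof.
move=> /eqP ij.
apply: (exec_le_stacks (@exec_le_loop w i (fun _ => Push j.+1 mark) 2
  (fun k => upd (upd e j (e j + k)) i (e i - k)) (fun _ => o) (e i) _ _)).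
- by move=> k kv; rewrite updE eqxx.
- by move=> k kv; apply: (exec_le_stacks (exec_le_push _ _ _ _)) => //; upd_eq.
- upd_eq.
- upd_eq.
- lia.
Qed.

Definition clear_cmd i : cmd symbol := Pop true i.+1 (fun _ => Nop symbol).

Lemma exec_le_clear w e o i :
  exec_le (clear_cmd i) (stacks w e, o) (2 * e i + 1) (stacks w (upd e i 0), o).
Proof.
apply: (exec_le_stacks (@exec_le_loop w i (fun _ => Nop symbol) 1
  (fun k => upd e i (e i - k)) (fun _ => o) (e i) _ _)).
- by move=> k kv; rewrite updE eqxx.
- move=> k kv; apply: (exec_le_stacks (e1 := upd e i (e i - k.+1)) (exec_le_nop _)) => //; upd_eq.
- upd_eq.
- upd_eq.
- lia.
Qed.

(* [rho] lists the stacks holding the variables; stacks from [b] on are free and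
   empty, and the value is left on stack [b]. *)
Definition computable (f : word -> seq nat -> nat) : Prop :=
  exists (code : seq nat -> nat -> cmd symbol) T, poly_bounded T /\
  forall w e rho b o, all (fun r => r < b) rho -> (forall j, b <= j -> e j = 0) ->
    let env := [seq e r | r <- rho] in
    exec_le (code rho b) (stacks w e, o) (T w env)
      (stacks w (upd e b (f w env)), o).

Lemma computable_bounded f : computable f -> poly_bounded f.
Proof.
move=> [code [T [bT H]]]; apply: poly_bounded_le bT => w env.
pose e i := nth 0 env i.
have := H w e (iota 0 (size env)) (size env) [::].
have -> : [seq e r | r <- iota 0 (size env)] = env by exact: mkseq_nth.
case=> [||m mT E]; first by apply/allP => r; rewrite mem_iota add0n.
  by move=> j; exact: nth_default.
have [/(_ (size env).+1) + _] := exec_size E.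
rewrite /= updE eqxx !size_nseq {1}/e nth_default //; lia.
Qed.

Lemma map_upd e b v rho : all (fun r => r < b) rho ->
  [seq upd e b v r | r <- rho] = [seq e r | r <- rho].
Proof.
move=> /allP H; apply/eq_in_map => r /H; rewrite updE.
by case: eqP => // ->; rewrite ltnn.
Qed.

Lemma all_ltnS b rho : all (fun r => r < b) rho -> all (fun r => r < b.+1) rho.
Proof. by apply: sub_all => r /ltnW. Qed.

Lemma computable_ext f g : (forall w env, f w env = g w env) ->
  computable g -> computable f.
Proof. by move=> fg; have -> : f = g by apply/funext => w; apply/funext. Qed.

Fixpoint push_const b c : cmd symbol :=
  if c is c'.+1 then Seq (Push b.+1 mark) (push_const b c') else Nop symbol.

Lemma exec_le_push_const w e o b c :
  exec_le (push_const b c) (stacks w e, o) (2 * c + 1)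
    (stacks w (upd e b (e b + c)), o).
Proof.
elim: c e => [|c IH] e /=.
  by apply: (exec_le_stacks (e1 := e) (exec_le_nop _)) => //; upd_eq.
apply: (exec_le_weak (n := 2 + (2 * c + 1))); first by lia.
apply: exec_le_seq (exec_le_push _ _ _ _) _.
by apply: (exec_le_stacks (IH _)) => //; upd_eq.
Qed.

Lemma computable_const c : computable (fun _ _ => c).
Proof.
exists (fun _ b => push_const b c), (fun _ _ => 2 * c + 1); split.
  exact: poly_bounded_const.
move=> w e rho b o _ /(_ b (leqnn b)) eb /=.
by have := exec_le_push_const w e o b c; rewrite eb.
Qed.

Lemma poly_bounded_var j : poly_bounded (fun _ env => nth 0 env j).
Proof.
apply: poly_bounded_le poly_bounded_size => w env.
apply: leq_trans (leq_addl _ _); elim: env j => [|x s IH] [|j] //=; first exact: leq_addr.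
by apply: leq_trans (IH j) _; rewrite leq_addl.
Qed.

(** Reading a stack destroys it; the scratch stack [t] keeps a second copy from which it is
    restored. *)
Definition copy_cmd i j t : cmd symbol :=
  Seq (Pop true i.+1 (fun _ => Seq (Push j.+1 mark) (Push t.+1 mark))) (move_cmd t i).

Lemma exec_le_copy w e o i j t : i != j -> i != t -> j != t -> e t = 0 ->
  exec_le (copy_cmd i j t) (stacks w e, o) (8 * e i + 2)
    (stacks w (upd e j (e j + e i)), o).
Proof.
move=> /eqP ij /eqP it /eqP jt et.
apply: (exec_le_weak (n := (e i * 5 + 1) + (3 * e i + 1))); first by lia.
apply: (exec_le_seq (s1 := (stacks w (upd (upd (upd e j (e j + e i)) t (e i)) i 0), o))).
  apply: (exec_le_stacks (@exec_le_loop w i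
    (fun _ => Seq (Push j.+1 mark) (Push t.+1 mark)) 4
    (fun k => upd (upd (upd e j (e j + k)) t k) i (e i - k)) (fun _ => o) (e i) _ _)).
  - by move=> k kv; rewrite updE eqxx.
  - move=> k kv; rewrite -[4]/(2 + 2).
    apply: exec_le_seq (exec_le_push _ _ _ _) _.
    apply: (exec_le_stacks (exec_le_push _ _ _ _)) => //; upd_eq.
  - upd_eq.
  - upd_eq.
  - lia.
have ti : t != i by apply/eqP => E; apply: it.
apply: (exec_le_stacks (exec_le_move _ _ _ ti)) => //; first by upd_eq.
by rewrite !updE !eqxx; case: eqP => // E; case: it.
Qed.

Lemma computable_var j : computable (fun _ env => nth 0 env j).
Proof.
exists (fun rho b => if j < size rho then copy_cmd (nth 0 rho j) b b.+1 else Nop symbol).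
exists (fun _ env => 8 * nth 0 env j + 2); split.
  exact: poly_bounded_add (poly_bounded_mul (poly_bounded_const 8) (poly_bounded_var j))
    (poly_bounded_const 2).
move=> w e rho b o /allP H eb /=; case: ltnP => jr; last first.
  rewrite nth_default ?size_map //.
  apply: exec_le_weak (_ : exec_le _ _ 1 _) => //.
  apply: (exec_le_stacks (e1 := e) (exec_le_nop _)) => //.
  by have Eb := eb b (leqnn b); upd_eq.
rewrite (nth_map 0) //; have := H _ (mem_nth 0 jr).
move: (nth 0 rho j) => r rb.
have := @exec_le_copy w e o r b b.+1; rewrite (eb b) // eb //; apply=> //; lia.
Qed.

Lemma computable_binop f g h (code : nat -> cmd symbol) T :
  computable f -> computable g -> poly_bounded T ->
  (forall w e b o env, (forall j, b.+1 < j -> e j = 0) ->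
    e b = f w env -> e b.+1 = g w env ->
    exec_le (code b) (stacks w e, o) (T w env)
      (stacks w (upd (upd e b (h w env)) b.+1 0), o)) ->
  computable h.
Proof.
move=> [cf [Tf [bf Hf]]] [cg [Tg [bg Hg]]] bT H.
exists (fun rho b => Seq (cf rho b) (Seq (cg rho b.+1) (code b))).
exists (fun w env => Tf w env + (Tg w env + T w env)); split.
  exact: poly_bounded_add bf (poly_bounded_add bg bT).
move=> w e rho b o rb eb /=.
apply: exec_le_seq (Hf _ _ _ _ _ rb eb) _; set env := [seq e r | r <- rho].
pose e1 := upd e b (f w env).
have := Hg w e1 rho b.+1 o (all_ltnS rb); rewrite /= map_upd // -/env.
move=> Hg1; apply: exec_le_seq (Hg1 _) _ => [j bj|].
  by rewrite /e1 updE; case: eqP => [?|_]; [lia|apply: eb; lia].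
apply: (exec_le_stacks (H _ (upd e1 b.+1 (g w env)) _ _ env _ _ _)) => // [j bj|||].
- by rewrite /e1 !updE; do 2?case: eqP => [?|_]; try lia; apply: eb; lia.
- by rewrite /e1 !updE !eqxx; case: eqP => // ?; lia.
- by rewrite updE eqxx.
- by rewrite /e1; have Eb := eb b.+1 (leqnSn b); upd_eq.
Qed.

Lemma computable_add f g : computable f -> computable g ->
  computable (fun w env => f w env + g w env).
Proof.
move=> cf cg; apply: (computable_binop (code := fun b => move_cmd b.+1 b) cf cg
  (T := fun w env => 3 * g w env + 1)).
  apply: poly_bounded_add (poly_bounded_const 1).
  exact: poly_bounded_mul (poly_bounded_const 3) (computable_bounded cg).
move=> w e b o env _ eb eb1.
apply: (exec_le_stacks (exec_le_move w e o _)) => //; first by lia.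
  by rewrite eb eb1.
by rewrite eb1.
Qed.

Lemma computable_sub f g : computable f -> computable g ->
  computable (fun w env => f w env - g w env).
Proof.
move=> cf cg; apply: (computable_binop
  (code := fun b => Pop true b.+2 (fun _ => Pop false b.+1 (fun _ => Nop symbol)))
  cf cg (T := fun w env => 3 * g w env + 1)).
  apply: poly_bounded_add (poly_bounded_const 1).
  exact: poly_bounded_mul (poly_bounded_const 3) (computable_bounded cg).
move=> w e b o env _ eb eb1.
apply: (exec_le_stacks (@exec_le_loop w b.+1 _ 2
    (fun k => upd (upd e b (e b - k)) b.+1 (e b.+1 - k)) (fun _ => o) (e b.+1) _ _)).
- by move=> k kv; rewrite updE eqxx.
- move=> k kv.
  set e1 := upd (upd (upd e b (e b - k)) b.+1 (e b.+1 - k)) b.+1 (e b.+1 - k.+1).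
  have e1b : e1 b = e b - k by rewrite /e1; upd_eq_at.
  have [z|z] := leqP (e b) k.
    apply: (exec_le_weak (n := 1)) => //.
    have e1z : e1 b = 0 by lia.
    by apply: (exec_le_stacks (exec_le_pop0 _ _ _ _ e1z)) => //; rewrite /e1; upd_eq.
  apply: exec_le_pop; first by rewrite e1b subn_gt0.
  apply: (exec_le_stacks (e1 := upd (upd e b (e b - k.+1)) b.+1 (e b.+1 - k.+1)) (exec_le_nop _)) => //.
  by rewrite e1b /e1; upd_eq.
- upd_eq.
- upd_eq.
- lia.
Qed.

Lemma computable_weak f : computable f -> computable (fun w env => f w (behead env)).
Proof.
move=> [c [T [bT H]]]; exists (fun rho b => c (behead rho) b), (fun w env => T w (behead env)).
split; last first.
  move=> w e rho b o rb eb /=; rewrite behead_map; apply: H => //.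
  by case: rho rb => //= r rho /andP[].
case: bT => k H'; exists k => w env; apply: leq_trans (H' _ _) _.
by apply: leq_exp2r_weak; case: env => //= *; lia.
Qed.

(** The loop counter itself serves as the index: once popped, it holds [v - k.+1] in round [k], so
    the terms are added from the last to the first. *)
Lemma computable_sum h (g : word -> seq nat -> nat -> nat) : computable h ->
  computable (fun w env => g w (behead env) (nth 0 env 0)) ->
  computable (fun w env => \sum_(i < h w env) g w env i).
Proof.
move=> ch cg'; pose g' w env := g w (behead env) (nth 0 env 0).
have cg : computable g' := cg'.
have := computable_bounded cg; have := computable_bounded ch.
move: cg ch => [cg [Tg [bg Hg]]] [ch [Th [bh Hh]]] bh' bg'.
have b3 : poly_bounded (fun w env => Tg w env + (3 * g' w env + 1)).
  apply: poly_bounded_add bg _; apply: poly_bounded_add _ (poly_bounded_const 1).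
  exact: poly_bounded_mul (poly_bounded_const 3) bg'.
have [U bU HU] := poly_bounded_cons b3 bh'.
exists (fun rho b => Seq (ch rho b)
  (Seq (Pop true b.+1 (fun _ => Seq (cg (b :: rho) b.+2) (move_cmd b.+2 b.+1)))
       (move_cmd b.+1 b))).
exists (fun w env => Th w env + ((h w env * (U w env).+1 + 1) + (3 * (h w env * U w env) + 1))).
split.
  apply: poly_bounded_add bh _; apply: poly_bounded_add.
    apply: poly_bounded_add (poly_bounded_const 1); apply: poly_bounded_mul bh' _.
    by have := poly_bounded_add bU (poly_bounded_const 1); apply: poly_bounded_le => *; rewrite addn1.
  apply: poly_bounded_add (poly_bounded_const 1); apply: poly_bounded_mul (poly_bounded_const 3) _.
  exact: poly_bounded_mul bh' bU.
move=> w e rho b o rb eb /=.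
apply: exec_le_seq (Hh _ _ _ _ _ rb eb) _; set env := [seq e r | r <- rho].
set v := h w env; set u := U w env.
have gu i : i < v -> g' w (i :: env) <= u.
  by move=> iv; have := HU w env i (ltnW iv); rewrite -/u; lia.
have gsum k : k <= v -> \sum_(i < k) g w env (v - i.+1) <= k * u.
  move=> kv; rewrite -[k in k * u]card_ord -sum_nat_const; apply: leq_sum => i _.
  by apply: (gu (v - i.+1)); have := ltn_ord i; lia.
pose E k := upd (upd e b (v - k)) b.+1 (\sum_(i < k) g w env (v - i.+1)).
have E2 k j : b.+2 <= j -> E k j = 0.
  by move=> bj; rewrite /E !updE; do 2?case: eqP => [?|_]; try lia; apply: eb; lia.
have Eb1 k : E k b.+1 = \sum_(i < k) g w env (v - i.+1) by rewrite /E updE eqxx.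
have Eb k : E k b = v - k by rewrite /E !updE eqxx; case: eqP => // ?; lia.
have Eo k j : j < b -> E k j = e j.
  by move=> bj; rewrite /E !updE; do 2?case: eqP => [?|_] //; lia.
apply: (exec_le_seq (s1 := (stacks w (E v), o))).
  apply: (exec_le_stacks (@exec_le_loop w b _ u E (fun _ => o) v _ _)) => //.
  - move=> k kv; set e1 := upd (E k) b (v - k.+1).
    have em : [seq e1 r | r <- b :: rho] = (v - k.+1) :: env.
      rewrite /= {1}/e1 updE eqxx; congr cons; apply/eq_in_map => r /(allP rb) r_b.
      by rewrite /e1 updE; case: eqP => [?|_]; [lia|exact: Eo].
    have e1b j : b.+2 <= j -> e1 j = 0.
      by move=> bj; rewrite /e1 updE; case: eqP => [?|_]; [lia|exact: E2].
    have rb1 : all (fun r => r < b.+2) (b :: rho).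
      by rewrite /= ltnW //= !all_ltnS.
    have := Hg w e1 (b :: rho) b.+2 o rb1 e1b; rewrite em => Hg1.
    apply: (exec_le_weak (n := Tg w (v - k.+1 :: env) + (3 * g' w (v - k.+1 :: env) + 1))).
      by apply: (HU w env (v - k.+1)); rewrite leq_subr.
    apply: exec_le_seq Hg1 _.
    apply: (exec_le_stacks (exec_le_move _ _ _ _)) => //; first by rewrite neq_ltn ltnSn orbT.
      have Z := E2 k b.+2 (leqnn _).
      have bb : (b == b.+1) = false by apply/eqP; lia.
      move=> i; rewrite /e1 !updE !eqSS !eqxx Eb1.
      case: (i =P b.+2) => [->|_]; first by rewrite E2.
      case: (i =P b.+1) => [->|i1].
        by rewrite bb gtn_eqF // Eb1 big_ord_recr.
      rewrite /E !updE; case: eqP => //; case: eqP => //.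
    by rewrite !updE eqxx.
  - move=> i; have Z := eb b.+1 (leqnSn b); rewrite /E updE big_ord0 subn0.
    by case: eqP => // ->; rewrite updE; case: eqP => // ?; lia.
apply: (exec_le_stacks (exec_le_move _ _ _ _)) => //; first by rewrite neq_ltn ltnSn orbT.
  have Z := eb b.+1 (leqnSn b).
  move=> i; rewrite !updE !Eb Eb1 subnn add0n.
  case: (i =P b.+1) => [->|i1]; first by case: eqP => ?; [lia|].
  case: (i =P b) => [_|ib].
    rewrite (reindex_inj rev_ord_inj) /=; apply: eq_bigr => j _; congr g.
    by have := ltn_ord j; lia.
  rewrite /E !updE; case: eqP => //; case: eqP => //.
rewrite Eb1; have := gsum v (leqnn v); lia.
Qed.

Lemma store_eq (st st' : store symbol) : st.1 =1 st'.1 -> st.2 = st'.2 -> st = st'.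
Proof. by case: st st' => [f o] [f' o'] /= /funext-> ->. Qed.

Lemma exec_le_transfer i t st : i != t ->
  exec_le (Pop true i (fun c => Push t c)) st (3 * size (st.1 i) + 1)
    (set_stack i [::] (set_stack t (rev (st.1 i) ++ st.1 t) st)).
Proof.
move=> it; have ti : t != i by rewrite eq_sym.
move E : (st.1 i) => s; elim: s st E => [|c s IH] st E.
  exists 1 => //; rewrite (_ : set_stack _ _ _ = st); first exact: EPopEmpty.
  apply: store_eq => // j /=; case: (j =P i) => [->//|_].
  by case: (j =P t) => [->|].
pose st1 := set_stack t (c :: st.1 t) (set_stack i s st).
have [|m ml H] := IH st1; first by rewrite /st1 /= eq_sym (negbTE ti) eqxx.
exists (3 + m); first by move: ml; rewrite /= -/symbol; move: (size s) => n; lia.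
apply: (@ELoop _ i _ st c s 2 st1 m) => //.
  have := EPush t c (set_stack i s st); rewrite (_ : (set_stack i s st).1 t = st.1 t) //.
  by rewrite /= (negbTE ti).
congr (exec _ _ _ _) : H; apply: store_eq => // j /=.
case: (j =P i) => // _; case: (j =P t) => // _.
by rewrite eqxx rev_cons cat_rcons.
Qed.

Lemma exec_le_count i t m st : i != t -> i != m -> t != m ->
  exec_le (Pop true i (fun c => Seq (Push t c) (Push m mark))) st (5 * size (st.1 i) + 1)
    (set_stack i [::] (set_stack t (rev (st.1 i) ++ st.1 t)
       (set_stack m (nseq (size (st.1 i)) mark ++ st.1 m) st))).
Proof.
move=> it im tm; have ti : t != i by rewrite eq_sym.
have mi : m != i by rewrite eq_sym.
have mt : m != t by rewrite eq_sym.
move E : (st.1 i) => s; elim: s st E => [|c s IH] st E.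
  exists 1 => //; rewrite (_ : set_stack _ _ _ = st); first exact: EPopEmpty.
  apply: store_eq => // j /=; case: (j =P i) => [->//|_].
  by case: (j =P t) => [->|_] //; case: (j =P m) => [->|].
pose st0 := set_stack t (c :: st.1 t) (set_stack i s st).
pose st1 := set_stack m (mark :: st.1 m) st0.
have [|k kl H] := IH st1.
  by rewrite /st1 /= (negbTE im) (negbTE it) eqxx.
exists (5 + k); first by move: kl; rewrite /=; move: (size s) => n; lia.
apply: (@ELoop _ i _ st c s (2 + 2) st1 k) => //.
  apply: (ESeq (st1 := st0)).
    have := EPush t c (set_stack i s st).
    by rewrite (_ : (set_stack i s st).1 t = st.1 t) //= (negbTE ti).
  by have := EPush m mark st0; rewrite (_ : st0.1 m = st.1 m) //= (negbTE mt) (negbTE mi).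
congr (exec _ _ _ _) : H; apply: store_eq => // j /=.
case: (j =P i) => // _; case: (j =P t) => _.
  by rewrite (negbTE tm) eqxx rev_cons cat_rcons.
case: (j =P m) => // _; rewrite eqxx.
by elim: (size s) => //= n ->.
Qed.

Lemma exec_le_skip b t v st : b != 0 -> b != t -> t != 0 -> st.1 b = nseq v mark ->
  exec_le (Pop true b (fun _ => Pop false 0 (fun c => Push t c))) st (4 * v + 1)
    (set_stack b [::] (set_stack 0 (drop v (st.1 0))
       (set_stack t (rev (take v (st.1 0)) ++ st.1 t) st))).
Proof.
move=> b0 bt t0; have tb : t != b by rewrite eq_sym.
have zb : 0 != b by rewrite eq_sym.
have zt : 0 != t by rewrite eq_sym.
elim: v st => [|v IH] st E.
  exists 1 => //; rewrite (_ : set_stack _ _ _ = st); first exact: EPopEmpty.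
  apply: store_eq => // j /=; case: (j =P b) => [->//|_].
  case: (j =P 0) => [->|_]; first by rewrite drop0.
  by case: (j =P t) => [->|_] //; rewrite take0.
case E0 : (st.1 0) => [|c u].
  have [|k kl H] := IH (set_stack b (nseq v mark) st); first by rewrite /= eqxx.
  exists (2 + k); first lia.
  apply: (@ELoop _ b _ st mark (nseq v mark) 1 (set_stack b (nseq v mark) st)) => //.
    by apply: EPopEmpty; rewrite /= (negbTE zb).
  congr (exec _ _ _ _) : H; apply: store_eq => // j /=.
  case: (j =P b) => // /eqP jb; rewrite (negbTE zb) E0 /=.
  case: (j =P 0) => // _; case: (j =P t) => // _; by rewrite (negbTE tb).
pose st1 := set_stack t (c :: st.1 t) (set_stack 0 u (set_stack b (nseq v mark) st)).
have [|k kl H] := IH st1; first by rewrite /st1 /= (negbTE bt) (negbTE b0) eqxx.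
exists (4 + k); first lia.
apply: (@ELoop _ b _ st mark (nseq v mark) 3 st1) => //.
  apply: (@EPop _ 0 _ (set_stack b (nseq v mark) st) c u 2); first by rewrite /= (negbTE zb).
  have := EPush t c (set_stack 0 u (set_stack b (nseq v mark) st)).
  by rewrite /= (negbTE t0) (negbTE tb).
congr (exec _ _ _ _) : H; apply: store_eq => // j /=.
case: (j =P b) => // _; rewrite (negbTE zt) /=.
case: (j =P 0) => // _; case: (j =P t) => // _.
by rewrite eqxx rev_cons cat_rcons.
Qed.

Definition symbol_at (w : word) (i : nat) (a : symbol) : bool :=
  (i < size w) && (nth Comma w i == a).

Lemma computable_size : computable (fun w _ => size w).
Proof.
exists (fun _ b => Seq (Pop true 0 (fun c => Push b.+2 c))
  (Pop true b.+2 (fun c => Seq (Push 0 c) (Push b.+1 mark)))).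
exists (fun w env => (3 * size w + 1) + (5 * size w + 1)); split.
  have bw : poly_bounded (fun w _ => size w).
    by apply: poly_bounded_le poly_bounded_size => w env; exact: leq_addr.
  do 2?apply: poly_bounded_add; try exact: poly_bounded_const;
    exact: poly_bounded_mul (poly_bounded_const _) bw.
move=> w e rho b o rb eb /=.
apply: exec_le_seq (exec_le_transfer _ _) _ => //.
match goal with |- exec_le (Pop true ?i _) ?s _ _ => have := @exec_le_count i 0 b.+1 s end.
have bb : (b == b.+1) = false by rewrite ltn_eqF.
have bb' : (b.+1 == b) = false by rewrite gtn_eqF.
rewrite /= !eqSS bb bb' !eqxx !eb // !cats0 size_rev.
move=> /(_ isT isT isT); congr (exec_le _ _ _ _); apply: store_eq => // j /=.
case: j => [|j] /=; first by rewrite revK.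
rewrite !eqSS updE; case: (j =P b.+1) => [->|_]; first by rewrite gtn_eqF ?eb.
by case: (j =P b).
Qed.

(** The letters before the position are moved aside in reverse, the next one is inspected and put
    back, and a second reversal restores the word. On a word that is too short the inspection finds
    an empty stack, in accordance with [symbol_at]. *)
Lemma computable_at f a : computable f -> computable (fun w env => symbol_at w (f w env) a).
Proof.
move=> cf; have bf := computable_bounded cf; move: cf => [c [T [bT H]]].
exists (fun rho b => Seq (c rho b)
  (Seq (Pop true b.+1 (fun _ => Pop false 0 (fun c => Push b.+2 c)))
  (Seq (Pop false 0 (fun c => Seq (Push 0 c) (if c == a then Push b.+1 mark else Nop _)))
       (Pop true b.+2 (fun c => Push 0 c))))).
exists (fun w env => T w env + ((4 * f w env + 1) + (6 + (3 * f w env + 1)))); split.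
  repeat first [exact: poly_bounded_const | exact: bf | exact: bT
    | apply: poly_bounded_add | apply: poly_bounded_mul].
move=> w e rho b o rb eb /=.
apply: exec_le_seq (H _ _ _ _ _ rb eb) _; set env := [seq e r | r <- rho].
set v := f w env.
have bb2 : (b.+1 == b) = false by rewrite gtn_eqF.
have bb1 : (b == b.+1) = false by rewrite ltn_eqF.
have := @exec_le_skip b.+1 b.+2 v (stacks w (upd e b v), o).
rewrite /= eqSS bb1 updE eqxx => /(_ isT isT isT erefl) H1.
apply: exec_le_seq H1 _; rewrite updE bb2 (eb b.+1) // cats0.
pose fin := nseq (symbol_at w v a) mark.
pose st2 : store symbol := ((fun i => if i == b.+1 then fin
  else if i == 0 then drop v w
  else if i == b.+2 then rev (take v w) else stacks w e i), o).
apply: (exec_le_seq (s1 := st2)).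
  rewrite /st2 /fin /symbol_at.
  case: ltnP => vw; last first.
    exists 1 => //; rewrite drop_oversize //.
    match goal with |- exec _ ?s 1 ?s' => rewrite (_ : s' = s) end.
      by apply: EPopEmpty.
    apply: store_eq => // j /=; case: j => [|j] //=; rewrite !eqSS updE.
    by case: (j =P b).
  rewrite (drop_nth Comma vw) /=.
  exists (2 + (if nth Comma w v == a then 2 else 1)).+1; first by case: ifP.
  set st0 := set_stack b.+1 _ _.
  apply: (@EPop _ 0 _ st0 (nth Comma w v) (drop v.+1 w)) => //.
  apply: ESeq (EPush _ _ _) _.
  case: eqP => [_|_] /=.
    match goal with |- exec (Push ?i ?x) ?s 2 ?s' =>
      have := EPush i x s; congr (exec _ _ _ _); apply: store_eq => // j /= end.
    case: j => [|j] //=; rewrite !eqSS !updE; case: (j =P b) => // _.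
    by rewrite eqxx.
  match goal with |- exec _ ?s 1 ?s' => rewrite (_ : s' = s); first exact: ENop end.
  apply: store_eq => // j /=; case: j => [|j] //=; rewrite !eqSS updE.
  by case: (j =P b) => //.
apply: (exec_le_weak (n := 3 * size (st2.1 b.+2) + 1)).
  by rewrite /= gtn_eqF //= eqxx size_rev size_take; case: ltnP; lia.
have := @exec_le_transfer b.+2 0 st2 isT; congr (exec_le _ _ _ _).
apply: store_eq => // j /=.
rewrite !eqSS bb2 !eqxx revK cat_take_drop.
case: j => [|j] //=; rewrite !eqSS updE; case: (j =P b.+1) => [->|_] //; first by rewrite bb2 eb.
by case: (j =P b).
Qed.

(** * Printing in polynomial time *)

Lemma nat_bits0 : nat_bits 0 = [::]. Proof. by []. Qed.

Lemma nat_bits_half n : 0 < n -> nat_bits n = odd n :: nat_bits n./2.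
Proof.
move=> n0; rewrite /nat_bits.
have := bin_of_natK n; case: (bin_of_nat n) => [|p] /= E.
  by rewrite -E in n0.
rewrite -E; case: p E => [p|p|] E /=; rewrite ?NatTrec.doubleE.
- by rewrite /= odd_double /= uphalf_double -[nat_of_pos p]/(nat_of_bin (Npos p)) nat_of_binK.
- by rewrite odd_double /= doubleK -[nat_of_pos p]/(nat_of_bin (Npos p)) nat_of_binK.
- by [].
Qed.

Definition prints (g : word -> seq nat -> word) : Prop :=
  exists (code : seq nat -> nat -> cmd symbol) T, poly_bounded T /\
  forall w e rho b o, all (fun r => r < b) rho -> (forall j, b <= j -> e j = 0) ->
    let env := [seq e r | r <- rho] in
    exec_le (code rho b) (stacks w e, o) (T w env)
      (stacks w e, rev (g w env) ++ o).

Lemma prints_ext f g : (forall w env, f w env = g w env) -> prints g -> prints f.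
Proof. by move=> fg; have -> : f = g by apply/funext => w; apply/funext. Qed.

Lemma prints_nil : prints (fun _ _ => [::]).
Proof.
exists (fun _ _ => Nop _), (fun _ _ => 1); split; first exact: poly_bounded_const.
by move=> *; exact: exec_le_nop.
Qed.

Lemma prints_emit a : prints (fun _ _ => [:: a]).
Proof.
exists (fun _ _ => Emit a), (fun _ _ => 1); split; first exact: poly_bounded_const.
by move=> *; exact: exec_le_emit.
Qed.

Lemma prints_cat f g : prints f -> prints g -> prints (fun w env => f w env ++ g w env).
Proof.
move=> [cf [Tf [bf Hf]]] [cg [Tg [bg Hg]]].
exists (fun rho b => Seq (cf rho b) (cg rho b)), (fun w env => Tf w env + Tg w env).
split; first exact: poly_bounded_add.
move=> w e rho b o rb eb /=; rewrite rev_cat -catA.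
exact: exec_le_seq (Hf _ _ _ _ _ rb eb) (Hg _ _ _ _ _ rb eb).
Qed.

(** Printing needs increasing indices, so here a second stack counts upwards while the bound is
    counted down. *)
Lemma prints_for h (g : word -> seq nat -> nat -> word) : computable h ->
  prints (fun w env => g w (behead env) (nth 0 env 0)) ->
  prints (fun w env => flatten [seq g w env i | i <- iota 0 (h w env)]).
Proof.
move=> ch [cg [Tg [bg Hg]]].
have := computable_bounded ch; move: ch => [ch [Th [bh Hh]]] bh'.
have [U bU HU] := poly_bounded_cons bg bh'.
exists (fun rho b => Seq (ch rho b)
  (Seq (Pop true b.+1 (fun _ => Seq (cg (b.+1 :: rho) b.+2) (Push b.+2 mark)))
       (clear_cmd b.+1))).
exists (fun w env => Th w env + ((h w env * (U w env + 3) + 1) + (2 * h w env + 1))).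
split.
  by repeat first [exact: poly_bounded_const | exact: bh | exact: bh' | exact: bU
    | apply: poly_bounded_add | apply: poly_bounded_mul].
move=> w e rho b o rb eb /=.
apply: exec_le_seq (Hh _ _ _ _ _ rb eb) _; set env := [seq e r | r <- rho].
set v := h w env; set u := U w env.
pose E k := upd (upd e b (v - k)) b.+1 k.
pose O k := rev (flatten [seq g w env i | i <- iota 0 k]) ++ o.
have Z := eb b.+1 (leqnSn b); have Zb := eb b (leqnn b).
have bb : (b == b.+1) = false by rewrite ltn_eqF.
apply: (exec_le_seq (s1 := (stacks w (E v), O v))).
  apply: (exec_le_stacks (@exec_le_loop w b _ (u + 2) E O v _ _)) => //.
  - by move=> k kv; rewrite /E !updE bb eqxx.
  - move=> k kv; set e1 := upd (E k) b (v - k.+1).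
    have em : [seq e1 r | r <- b.+1 :: rho] = k :: env.
      rewrite /= {1}/e1 /E !updE eqxx eq_sym bb; congr cons; apply/eq_in_map => r /(allP rb) r_b.
      by rewrite /e1 /E !updE; do 3?[case: eqP => [?|_]; first lia].
    have e1b j : b.+2 <= j -> e1 j = 0.
      by move=> bj; rewrite /e1 /E !updE; do 3?[case: eqP => [?|_]; first lia]; apply: eb; lia.
    have rb1 : all (fun r => r < b.+2) (b.+1 :: rho).
      by rewrite /= ltnSn /= !all_ltnS.
    have := Hg w e1 (b.+1 :: rho) b.+2 (O k) rb1 e1b; rewrite em /= => Hg1.
    apply: exec_le_seq (exec_le_weak (HU w env k (ltnW kv)) Hg1) _.
    rewrite -[rev _ ++ O k]/(rev (g w env k) ++ O k).
    have -> : rev (g w env k) ++ O k = O k.+1.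
      by rewrite /O -addn1 iotaD map_cat flatten_cat rev_cat catA /= cats0.
    apply: (exec_le_stacks (exec_le_push _ _ _ _)) => //.
    move=> i; rewrite /e1 /E !updE (gtn_eqF (ltnSn b)) eqxx.
    by case: (i == b.+1); case: (i == b).
  - by rewrite /E; upd_eq.
  - lia.
apply: (exec_le_stacks (exec_le_clear _ _ _ _)) => //.
  by rewrite /E; upd_eq.
by rewrite /E updE eqxx.
Qed.

(** A conditional is a pair of loops, run [c] times and [1 - c] times. *)
Lemma prints_if (c : word -> seq nat -> bool) f g : computable c ->
  prints f -> prints g ->
  prints (fun w env => if c w env then f w env else g w env).
Proof.
have weak f' : prints f' -> prints (fun w env => f' w (behead env)).
  move=> [cc [T [bT H]]]; exists (fun rho b => cc (behead rho) b), (fun w env => T w (behead env)).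
  split; last first.
    move=> w e rho b o rb eb /=; rewrite behead_map; apply: H => //.
    by case: rho rb => //= r rho /andP[].
  case: bT => k H'; exists k => w env; apply: leq_trans (H' _ _) _.
  by apply: leq_exp2r_weak; case: env => //= *; lia.
move=> cc pf pg.
have H1 := prints_for (g := fun w env _ => f w env) cc (weak _ pf).
have H2 := prints_for (g := fun w env _ => g w env) (computable_sub (computable_const 1) cc) (weak _ pg).
apply: prints_ext (prints_cat H1 H2) => w env.
by case: (c w env) => /=; rewrite ?cats0.
Qed.

(** * Binary digits of unary numbers *)

Definition split_cmd i t1 t2 : cmd symbol :=
  Pop true i.+1 (fun _ => Seq (Push t1.+1 mark) (Pop false i.+1 (fun _ => Push t2.+1 mark))).

Lemma exec_le_loop_step w e j o f n s' m s'' : 0 < e j ->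
  exec_le (f mark) (stacks w (upd e j (e j).-1), o) n s' ->
  exec_le (Pop true j.+1 f) s' m s'' ->
  exec_le (Pop true j.+1 f) (stacks w e, o) (n.+1 + m) s''.
Proof.
move=> e0 [k kn H] [l lm K]; exists (k.+1 + l); first by lia.
apply: (@ELoop _ _ _ _ mark (nseq (e j).-1 mark)) K; last by rewrite set_stack_stacks.
by rewrite /=; case: (e j) e0.
Qed.

Lemma exec_le_split w e o (i t1 t2 : nat) : i != t1 -> i != t2 -> t1 != t2 ->
  exec_le (split_cmd i t1 t2) (stacks w e, o) (6 * e i + 1)
    (stacks w (upd (upd (upd e t2 (e t2 + (e i)./2)) t1 (e t1 + uphalf (e i))) i 0), o).
Proof.
move=> /eqP it1 /eqP it2 /eqP t12.
have [v] := ubnP (e i); elim: v e => // v IH e ev.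
case E : (e i) => [|[|u]].
- apply: (exec_le_stacks (exec_le_pop0 _ _ _ _ E)) => //; upd_eq.
- apply: (exec_le_weak (n := 3.+1 + 1)) => //.
  apply: (exec_le_loop_step (s' := (stacks w (upd (upd e t1 (e t1).+1) i 0), o))); first by rewrite E.
    rewrite E -[3]/(2 + 1); apply: exec_le_seq (exec_le_push _ _ _ _) _.
    have Z : upd (upd e i 0) t1 (upd e i 0 t1).+1 i = 0 by upd_eq_at.
    apply: (exec_le_stacks (exec_le_pop0 _ _ _ _ Z)) => //; upd_eq.
  have Z : upd (upd e t1 (e t1).+1) i 0 i = 0 by upd_eq_at.
  apply: (exec_le_stacks (exec_le_pop0 _ _ _ _ Z)) => //; upd_eq.
pose e' := upd (upd (upd e t1 (e t1).+1) t2 (e t2).+1) i u.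
have e'i : e' i = u by rewrite /e' updE eqxx.
apply: (exec_le_weak (n := 5.+1 + (6 * u + 1))); first by lia.
apply: (exec_le_loop_step (s' := (stacks w e', o))); first by rewrite E.
  rewrite E -[5]/(2 + 3); apply: exec_le_seq (exec_le_push _ _ _ _) _.
  have Z : upd (upd e i u.+1) t1 (upd e i u.+1 t1).+1 i = u.+1.
    by rewrite !updE eqxx; case: eqP => // E1; case: it1.
  apply: exec_le_pop; first by rewrite /= Z.
  rewrite /= Z; apply: (exec_le_stacks (exec_le_push _ _ _ _)) => //.
  by rewrite /e'; clear -it1 it2 t12; upd_eq.
have := IH e'; rewrite e'i => H; apply: (exec_le_stacks (H _)) => //; first by lia.
by rewrite /e' /=; clear -it1 it2 t12; upd_eq.
Qed.

(** Runs after one mark has been popped, so the stack holds u when the number is u + 1. The parity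
    of u is the difference of its upper and lower halves. A mark on a flag stack is consumed if u is
    odd; if it survives, it triggers the branch for even u. *)
Definition halve_cmd (g : bool -> symbol) b : cmd symbol :=
    Seq (split_cmd b b.+1 b.+2)
   (Seq (Pop true b.+3 (fun _ => Seq (Push b.+1 mark) (Pop false b.+2 (fun _ => Nop _))))
   (Seq (Push b.+4 mark)
   (Seq (Pop false b.+2 (fun _ => Pop false b.+4 (fun _ =>
           Seq (Push b.+1 mark) (Emit (g false)))))
        (Pop false b.+4 (fun _ => Emit (g true)))))).

Lemma exec_le_halve g w e o b u : (forall j, b < j -> e j = 0) -> e b = u ->
  exec_le (halve_cmd g b) (stacks w e, o) (26 * u.+1)
    (stacks w (upd e b u.+1./2), g (~~ odd u) :: o).
Proof.
move=> Z eb.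
have Z1 := Z b.+1 (leqnn _); have Z2 := Z b.+2 (leqnSn _).
have Z3 : e b.+3 = 0 by apply: Z; lia.
have uu := odd_double_half u; have uh := uphalf_half u.
have le1 : 26 * u.+1 >= (6 * u + 1) + ((u./2 * 5 + 1) + (2 + (5 + 2))) by lia.
apply: exec_le_weak le1 _.
apply: (exec_le_seq (s1 := (stacks w (upd (upd (upd e b.+2 u./2) b.+1 (uphalf u)) b 0), o))).
  apply: (exec_le_stacks (exec_le_split w e o _ _ _)); try by rewrite neq_ltn ?ltnS ?leqnSn ?leqnn.
  - by [].
  - by rewrite eb Z1 Z2.
  - by rewrite eb.
apply: (exec_le_seq (s1 := (stacks w (upd (upd e b u./2) b.+1 (odd u)), o))).
  apply: (exec_le_stacks (@exec_le_loop w b.+2 _ 4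
      (fun k => upd (upd (upd e b k) b.+1 (uphalf u - k)) b.+2 (u./2 - k)) (fun _ => o) u./2 _ _)).
  - by move=> k kv; rewrite updE eqxx.
  - move=> k kv; rewrite -[4]/(2 + 2); apply: exec_le_seq (exec_le_push _ _ _ _) _.
    have bb : (b == b.+1) = false by rewrite ltn_eqF.
    have bb2 : (b == b.+2) = false by rewrite ltn_eqF.
    have bb1 : (b.+1 == b) = false by rewrite gtn_eqF.
    have bb12 : (b.+1 == b.+2) = false by rewrite ltn_eqF.
    have bb21 : (b.+2 == b.+1) = false by rewrite gtn_eqF.
    apply: exec_le_pop; rewrite !updE bb1 bb12 ?eqxx; first by lia.
    rewrite ?bb ?bb2 ?bb21 ?eqxx.
    apply: (exec_le_stacks (exec_le_nop (stacks w (upd (upd (upd e b k.+1) b.+1 (uphalf u - k.+1)) b.+2 (u./2 - k.+1)), o))) => //.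
    move=> i; rewrite !updE; case: (i =P b.+2) => [->|_].
      by rewrite bb21 gtn_eqF.
    case: (i =P b.+1) => [|_]; first by lia.
    by case: (i =P b).
  - by rewrite subn0; upd_eq.
  - move=> i; rewrite !updE; case: (i =P b.+2) => [->|_]; first by rewrite !gtn_eqF // subnn.
    case: (i =P b.+1) => [|_]; first by lia.
    by [].
  - by [].
apply: exec_le_seq (exec_le_push _ _ _ _) _.
have -> : upd (upd e b u./2) b.+1 (odd u) b.+3 = 0.
  by rewrite !updE !gtn_eqF //; lia.
have [ou|ou] := boolP (odd u).
  apply: (exec_le_seq (s1 := (stacks w (upd e b u.+1./2), g false :: o))).
    rewrite -[5]/((2 + 1).+2).
    do 2![apply: exec_le_pop; first by rewrite !updE ?eqxx //= ?ou; upd_eq_at].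
    apply: (exec_le_seq (exec_le_push _ _ _ _)).
    apply: (exec_le_stacks (exec_le_emit (g false) (stacks w (upd e b u.+1./2), o))) => //.
    rewrite /= ?updE !eqxx => i; rewrite !updE.
    have bb : (b == b.+1) = false by rewrite ltn_eqF.
    have bb3 : (b == b.+3) = false by apply/eqP; lia.
    have bb1 : (b.+1 == b.+3) = false by apply/eqP; lia.
    rewrite ?bb ?bb3 ?bb1 /= ?uh ?ou; case: (i =P b) => // ib.
    case: (i =P b.+3) => [i3|i3]; first by rewrite i3 Z3 gtn_eqF.
    by case: (i =P b.+1) => [i1|//]; rewrite i1 Z1.
  apply: (exec_le_weak (n := 1)) => //; apply: exec_le_pop0.
  by rewrite updE gtn_eqF //; lia.
have bb1 : (b.+1 == b.+3) = false by apply/eqP; lia.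
apply: (exec_le_seq (s1 := (stacks w (upd (upd e b u.+1./2) b.+3 1), o))).
  apply: (exec_le_weak (n := 1)) => //.
  have K : upd (upd (upd e b u./2) b.+1 false) b.+3 1 b.+1 = 0.
    by rewrite !updE eqxx bb1.
  apply: (exec_le_stacks (exec_le_pop0 _ _ _ _ K)) => // i; rewrite !updE /=.
  case: (i =P b.+3) => // _; case: (i =P b.+1) => [i1|_].
    by rewrite i1 gtn_eqF // Z1.
  by rewrite uh (negbTE ou).
apply: exec_le_pop; first by rewrite updE eqxx.
apply: (exec_le_stacks (exec_le_emit (g true) (stacks w (upd e b u.+1./2), o))) => //.
move=> i; rewrite !updE eqxx; case: (i =P b.+3) => [i3|//].
by rewrite i3 Z3 gtn_eqF //; lia.
Qed.

Definition bits_cmd (g : bool -> symbol) b : cmd symbol :=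
  Pop true b.+1 (fun _ => halve_cmd g b).

(** A round costs a multiple of the current number, which it halves; the geometric series keeps the
    total linear in the unary input. *)
Lemma exec_le_bits g w e o b : (forall j, b < j -> e j = 0) ->
  exec_le (bits_cmd g b) (stacks w e, o) (60 * e b + 1)
    (stacks w (upd e b 0), rev [seq g x | x <- nat_bits (e b)] ++ o).
Proof.
have [v] := ubnP (e b); elim: v e o => // v IH e o ev Z.
have [E|E] := posnP (e b).
  by rewrite E nat_bits0; apply: (exec_le_stacks (exec_le_pop0 _ _ _ _ E)) => //; upd_eq.
rewrite nat_bits_half //= rev_cons cat_rcons.
move E' : (e b) E => [//|u] _; pose e' := upd e b u.+1./2.
have e'b : e' b = u.+1./2 by rewrite /e' updE eqxx.
apply: (exec_le_weak (n := (26 * u.+1).+1 + (60 * u.+1./2 + 1))).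
  by have := odd_double_half u.+1; lia.
apply: (exec_le_loop_step (s' := (stacks w e', g (odd u.+1) :: o))); first by rewrite E'.
  apply: (exec_le_stacks (exec_le_halve g w (e := upd e b u) o _ _)) => //.
  - by move=> j bj; rewrite updE gtn_eqF // Z.
  - by rewrite updE eqxx.
  - by rewrite E'.
  - by rewrite /e'; upd_eq.
have := IH e' (g (odd u.+1) :: o); rewrite e'b => H.
apply: (exec_le_stacks (H _ _)) => //; first by move: ev; rewrite E'; lia.
  by move=> j bj; rewrite /e' updE gtn_eqF // Z.
by rewrite /e'; clear; upd_eq.
Qed.

(** With a constant [g] this prints a run as long as the binary expansion, which is how the
    exponents [mid_exp] and [top_exp] become runs of zeros. *)
Lemma prints_bits (g : bool -> symbol) f : computable f ->
  prints (fun w env => [seq g x | x <- nat_bits (f w env)]).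
Proof.
move=> cf; have bf := computable_bounded cf; move: cf => [c [T [bT H]]].
exists (fun rho b => Seq (c rho b) (bits_cmd g b)).
exists (fun w env => T w env + (60 * f w env + 1)); split.
  by repeat first [exact: poly_bounded_const | exact: bf | exact: bT
    | apply: poly_bounded_add | apply: poly_bounded_mul].
move=> w e rho b o rb eb /=.
apply: exec_le_seq (H _ _ _ _ _ rb eb) _; set env := [seq e r | r <- rho].
have := @exec_le_bits g w (upd e b (f w env)) o b.
rewrite updE eqxx => K; apply: (exec_le_stacks (K _)) => // [j bj|i].
  by rewrite updE gtn_eqF // eb // ltnW.
by rewrite !updE; case: (i =P b) => // ->; rewrite eb.
Qed.

Lemma poly_power_bound k : exists p : {poly nat}, forall n, p.[n]%R = (n + 2) ^ k + (n + 2) ^ k + 2.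
Proof.
exists (('X + 2%:P) ^+ k + ('X + 2%:P) ^+ k + 2%:P)%R => n.
by rewrite !hornerD !horner_exp hornerD hornerX !hornerC natrXE.
Qed.

Theorem prints_poly_time (X Y : Type) (encX : X -> word) (encY : Y -> word)
    (f : X -> Y) g : prints g -> (forall x, encY (f x) = g (encX x) [::]) ->
  poly_time_computable encX encY f.
Proof.
move=> [code [T [[k bT] H]]] fg.
have [M HM] := exec_outputs (code [::] 0); have [p Hp] := poly_power_bound k.
exists M, p => x; set w := encX x.
have [//|n nT E] := H w (fun _ => 0) [::] 0 [::] isT.
have E' : exec (code [::] 0) ((fun i => if i == 0 then w else [::]), [::]) n
    (stacks w (fun=> 0), rev (g w [::])).
  move: E; rewrite cats0; congr (exec _ (_, _) _ _).
  by apply/funext => -[].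
have := HM w n _ p.[size w]%R E'.
rewrite fg revK; apply.
by rewrite Hp; have := leq_trans nT (bT w [::]); rewrite /= addn0; lia.
Qed.

(** * Potentials on vertex sets *)

Local Open Scope ring_scope.

Section SetBounds.
Variables (R : realType) (V : finType) (adj : rel V).

Definition superharmonic_at (beta : {set V} -> R) (A : {set V}) (x y : V) : Prop :=
  beta (A :\ y) + beta (x |: A) <= 2 * beta A.

Lemma apply_move_sum (eta : V -> R) x y mu (A : {set V}) : y \in A -> x \notin A ->
  \sum_(u in A) apply_move eta (x, y, mu) u =
    (1 - 2 * mu) * (\sum_(u in A) eta u)
    + mu * (\sum_(u in A :\ y) eta u + \sum_(u in x |: A) eta u) /\
  \sum_(u in A) apply_move eta (y, x, mu) u =
    (1 - 2 * mu) * (\sum_(u in A) eta u)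
    + mu * (\sum_(u in A :\ y) eta u + \sum_(u in x |: A) eta u).
Proof.
move=> yA xA; have xy : x != y by apply: contraNneq xA => ->.
have E (f : V -> R) : f y = eta y + mu * (eta x - eta y) ->
    (forall u, u != x -> u != y -> f u = eta u) ->
    \sum_(u in A) f u = (1 - 2 * mu) * (\sum_(u in A) eta u)
      + mu * (\sum_(u in A :\ y) eta u + \sum_(u in x |: A) eta u).
  move=> fy fu; rewrite (big_setD1 y) // [\sum_(u in A) eta u](big_setD1 y) //=.
  rewrite [\sum_(u in x |: A) _]big_setU1 //= [\sum_(u in A) eta u](big_setD1 y) //=.
  have -> : \sum_(u in A :\ y) f u = \sum_(u in A :\ y) eta u.
    apply: eq_bigr => u; rewrite !inE => /andP[uy uA]; apply: fu => //.
    by apply: contraNneq xA => <-.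
  by rewrite fy; ring.
split; apply: E; rewrite /= ?eqxx ?(eq_sym y x) ?(negbTE xy) //;
  by move=> u /negbTE-> /negbTE->.
Qed.

Lemma set_bound (beta : {set V} -> R) (eta0 : V -> R) :
  irreflexive adj ->
  (forall A : {set V}, \sum_(u in A) eta0 u <= beta A) ->
  (forall (A : {set V}) x y, adj x y || adj y x -> y \in A -> x \notin A -> superharmonic_at beta A x y) ->
  forall s, all (legal_move adj) s ->
  forall A : {set V}, \sum_(u in A) final_profile eta0 s u <= beta A.
Proof.
move=> irr + sup s; elim: s eta0 => //= [[[x y] mu] s] IH eta0 H0 /andP[/andP[xy /andP[mu0 mu2]] ls].
apply: IH => // A.
have neq : x != y by apply: contraTneq xy => ->; rewrite irr.
have conv A' x' y' : superharmonic_at beta A' x' y' ->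
   (1 - 2 * mu) * (\sum_(u in A') eta0 u)
    + mu * (\sum_(u in A' :\ y') eta0 u + \sum_(u in x' |: A') eta0 u) <= beta A'.
  rewrite /superharmonic_at => S.
  have h1 := H0 A'; have h2 := H0 (A' :\ y'); have h3 := H0 (x' |: A').
  have k1 : (1 - 2 * mu) * (\sum_(u in A') eta0 u) <= (1 - 2 * mu) * beta A'.
    by apply: ler_wpM2l => //; lra.
  have k2 : mu * (\sum_(u in A' :\ y') eta0 u + \sum_(u in x' |: A') eta0 u) <=
            mu * (2 * beta A') by apply: ler_wpM2l => //; lra.
  by apply: le_trans (lerD k1 k2) _; rewrite le_eqVlt; apply/orP; left; apply/eqP; ring.
case: (boolP (x \in A)) => xA; case: (boolP (y \in A)) => yA.
- apply: le_trans (H0 A).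
  rewrite (big_setD1 x) // (big_setD1 y) /=; last by rewrite !inE eq_sym neq.
  rewrite [\sum_(u in A) eta0 u](big_setD1 x) // [\sum_(u in A :\ x) eta0 u](big_setD1 y) /=;
    last by rewrite !inE eq_sym neq.
  rewrite eqxx eq_sym (negbTE neq) eqxx.
  rewrite [X in _ + (_ + X)](eq_bigr eta0); first by lra.
  by move=> u; rewrite !inE => /and3P[/negbTE-> /negbTE-> _].
- have [_ ->] := apply_move_sum eta0 mu xA yA.
  by apply/conv/sup; rewrite ?xy ?orbT.
- have [-> _] := apply_move_sum eta0 mu yA xA.
  by apply/conv/sup; rewrite ?xy.
- apply: le_trans (H0 A); rewrite le_eqVlt; apply/orP; left; apply/eqP.
  apply: eq_bigr => u uA /=.
  have /negbTE-> : u != x by apply: contraNneq xA => <-.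
  by have /negbTE-> : u != y by apply: contraNneq yA => <-.
Qed.

Definition decay (m : nat) : R := m%:R / m.+1%:R.

Definition setprod (r : V -> R) (A : {set V}) : R := \prod_(u in A) r u.

Lemma decay_ge0 m : 0 <= decay m. Proof. by rewrite divr_ge0. Qed.

Lemma decayE m : decay m = 1 - m.+1%:R^-1.
Proof.
rewrite /decay -natr1; set x := m%:R; have x0 : 0 <= x by rewrite ler0n.
by field; rewrite gt_eqF ?ltr_pwDr ?ltr01.
Qed.

Lemma decay_le1 m : decay m <= 1.
Proof. by rewrite decayE lerBlDr lerDl invr_ge0. Qed.

Lemma decay_half m : (0 < m)%N -> 2^-1 <= decay m.
Proof.
move=> m0; rewrite decayE; have : m.+1%:R^-1 <= 2^-1 :> R.
  by rewrite lef_pV2 ?posrE // ler_nat ltnS.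
by move: (m.+1%:R^-1) => z; lra.
Qed.

Lemma decay_le m k : (m <= k)%N -> decay m <= 1 - k.+1%:R^-1.
Proof. by move=> mk; rewrite decayE lerB // lef_pV2 ?posrE // ler_nat ltnS. Qed.

Lemma setprod_ge0 r A : (forall u, 0 <= r u) -> 0 <= setprod r A.
Proof. by move=> r0; apply: prodr_ge0. Qed.

Lemma setprod_le1 r A : (forall u, 0 <= r u <= 1) -> setprod r A <= 1.
Proof. by move=> r01; rewrite /setprod; apply: prodr_ile1. Qed.

Lemma setprodD1 r (A : {set V}) y : y \in A -> setprod r A = r y * setprod r (A :\ y).
Proof. exact: big_setD1. Qed.

Lemma setprodU1 r (A : {set V}) x : x \notin A -> setprod r (x |: A) = r x * setprod r A.
Proof. exact: big_setU1. Qed.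

Lemma setprod_eq0 r (A : {set V}) y : y \in A -> r y = 0 -> setprod r A = 0.
Proof. by move=> yA r0; rewrite (setprodD1 _ yA) r0 mul0r. Qed.

Lemma setprod_le r (A : {set V}) y : (forall u, 0 <= r u <= 1) -> y \in A -> setprod r A <= r y.
Proof.
move=> r01 yA; rewrite (setprodD1 _ yA) ler_piMr //; first by case/andP: (r01 y).
exact: setprod_le1.
Qed.

Lemma setprod_half r (A : {set V}) : (forall u, u \in A -> 2^-1 <= r u) -> 2^-1 ^+ #|V| <= setprod r A.
Proof.
move=> r2; apply: (@le_trans _ _ (2^-1 ^+ #|A|)).
  apply: ler_wiXn2l; rewrite ?invr_ge0 ?invf_le1 ?ler1n //.
  exact: max_card.
rewrite /setprod -prodr_const; apply: ler_prod => u uA.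
by rewrite invr_ge0 ler0n r2.
Qed.

(** The defect when a vertex of distance [b] leaves the set and one of distance [a] enters, per unit
    of the product over the vertices that stay; see [setprod_slack]. *)
Definition slack (a b : nat) : R := 1 + decay a * decay b - 2 * decay b.

(** The factor m / (m + 1) is made for this identity: the sign is that of 1 + a - b, so 1-Lipschitz
    functions give potentials of the right kind, and an exchange of distance a + 1 for distance a is
    exactly neutral. *)
Lemma slackE a b : slack a b = (1 + a%:R - b%:R) / (a.+1%:R * b.+1%:R).
Proof.
rewrite /slack /decay -!natr1; set x := a%:R; set y := b%:R.
have x0 : 0 <= x by rewrite ler0n.
have y0 : 0 <= y by rewrite ler0n.
by field; rewrite !gt_eqF ?ltr_wpDl ?ltr01.
Qed.

Lemma setprod_slack (f : V -> nat) (A : {set V}) x y : y \in A -> x \notin A ->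
  setprod (decay \o f) (A :\ y) + setprod (decay \o f) (x |: A)
   = 2 * setprod (decay \o f) A + setprod (decay \o f) (A :\ y) * slack (f x) (f y).
Proof.
by move=> yA xA; rewrite setprodU1 // (setprodD1 _ yA) /= /slack; ring.
Qed.

Lemma slack_ge0 a b : (b <= a.+1)%N -> 0 <= slack a b.
Proof.
move=> ba; rewrite slackE divr_ge0 ?mulr_ge0 //.
by move: ba; rewrite -(ler_nat R) -natr1; lra.
Qed.

Lemma slack_eq0 a : slack a a.+1 = 0.
Proof. by rewrite slackE -natr1 (_ : 1 + _ - _ = 0) ?mul0r //; ring. Qed.

Lemma slack_ge a b k : (b <= a <= k)%N -> (k.+1%:R^-1) ^+ 2 <= slack a b.
Proof.
move=> /andP[ba ak]; rewrite slackE expr2 -invfM.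
apply: (@le_trans _ _ (1 / (a.+1%:R * b.+1%:R))).
  rewrite div1r lef_pV2 ?posrE ?mulr_gt0 // -!natrM ler_nat leq_mul //.
  exact: leq_trans ba ak.
rewrite ler_pM2r ?invr_gt0 ?mulr_gt0 //.
by move: ba; rewrite -(ler_nat R); lra.
Qed.

End SetBounds.

Local Close Scope ring_scope.

Local Open Scope ring_scope.

(** * The potential of a layered graph *)

Section Layered.
Variables (R : realType) (V : finType) (adj : rel V).
Variables (n dm : nat) (d : V -> nat) (main : pred V) (S : nat -> V).
Hypothesis adj_irr : irreflexive adj.
Hypothesis adj_sym : symmetric adj.
Hypothesis d_lip : forall x y, adj x y -> (d y <= (d x).+1)%N.
Hypothesis d_max : forall u, (d u <= dm)%N.
Hypothesis S_main : forall k, (k <= n)%N -> main (S k).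
Hypothesis S_d : forall k, (k <= n)%N -> d (S k) = k.*2.
Hypothesis S_uniq : forall u, main u -> ~~ odd (d u) -> ((d u)./2 <= n)%N /\ u = S (d u)./2.
Hypothesis d_main : forall u, (d u = 0)%N -> main u.
(** A step from a main vertex towards the source never leads into a spider. *)
Hypothesis main_step : forall x y, main y -> adj x y -> d y = (d x).+1 -> main x.
Variables (G : {set V} -> R) (e B Wt Gs : R) (tau : V -> R).
Hypothesis G_range : forall A, 0 <= G A <= Wt.
Hypothesis Gs_range : 0 <= Gs <= Wt.

Definition spine (u : V) : bool := [exists k : 'I_n.+1, u == S k].

Hypothesis G_super : forall (A : {set V}) x y, adj x y -> y \in A -> x \notin A ->
  ~~ spine x -> ~~ spine y -> superharmonic_at G A x y.
Hypothesis tau_ge0 : forall u, 0 <= tau u.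
Hypothesis tau_total : \sum_u tau u <= Wt.
Hypothesis tau_G : forall A : {set V}, (forall k, (k <= n)%N -> S k \in A) ->
  \sum_(u in A | ~~ spine u) tau u <= G A.

(** Odd distances among main vertices belong to cells: such a set contains at most one cell of each
    layer and nothing from the inside of a spider, like a path. *)
Definition sparse (A : {set V}) : bool :=
  [forall u in A, main u] &&
  [forall u in A, forall v in A, (odd (d u) && (d u == d v)) ==> (u == v)].

Hypothesis G_sparse : forall A : {set V}, (forall k, (k <= n)%N -> S k \in A) ->
  sparse A -> G A <= Gs.

(** Lower bound for a product of factors that are at least one half, hence for the jump of a product
    when its only vanishing factor is removed. *)
Definition q : R := 2^-1 ^+ #|V|.
(** [B] times the jump of [rho] in [step_inside] has to pay for two terms of size [Wt]. [e] times
    the smallest gain of the source term, q / (dm + 1) ^ 2, has to pay for those and for the second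
    differences of [fB], which are at most 4 * n. *)
Hypothesis B_big : 2 * Wt <= B * (q / 4%:R * (q / dm.+1%:R)).
Hypothesis e_big : 4%:R * n.+1%:R * B + 2 * Wt <= e * (q * dm.+1%:R^-1 ^+ 2).
Hypothesis n_gt0 : (0 < n)%N.

Let Wt_ge0 : 0 <= Wt.
Proof. by case/andP: Gs_range => *; lra. Qed.

(** A surrogate for the distance to [S k]: the difference of the distances to the source, raised to
    1 off [S k] so that no other vertex makes [Pk] vanish. *)
Definition gap (k : nat) (u : V) : nat :=
  if u == S k then 0 else maxn 1 ((d u - k.*2) + (k.*2 - d u)).

Definition P (A : {set V}) : R := setprod (@decay R \o d) A.
Definition Pk (k : nat) (A : {set V}) : R := setprod (@decay R \o gap k) A.
Definition near (k : nat) (A : {set V}) : R :=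
  setprod (fun u => if (d u < k.*2)%N then decay R (d u) else 1) A.
Definition far (k : nat) (A : {set V}) : R :=
  setprod (fun u => if (d u < k.*2)%N then 1 else decay R (gap k u)) A.
(** Positive exactly when [S k] is missing although some vertex of the set is nearer to the source
    than [S k]. The factor q / 4 gives 2 * rho <= q / 2, which leaves half of a value q of [Pk] to
    be spent when the source enters. *)
Definition rho (k : nat) (A : {set V}) : R := q / 4%:R * ((1 - near k A) * far k A).

(** With the source in the set, every missing spine vertex lowers this by at least [q]. The sum of 1
    - P is an upper bound in all three cases; it is attained on sets that are not main, where
    nothing more is needed. *)
Definition fB (A : {set V}) : R :=
  if S 0 \in A then \sum_(1 <= k < n.+1) (1 - Pk k A)
  else if [forall u in A, main u] then \sum_(1 <= k < n.+1) ((1 - P A) - rho k A)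
  else \sum_(1 <= k < n.+1) (1 - P A).

Definition spines_in (A : {set V}) : bool := [forall k : 'I_n.+1, S k \in A].

(** Off the path-like sets this term has its maximal value, and there its own inequality is trivial;
    only the moves that lead from a path-like set to another kind of set have to be paid for. *)
Definition ft (A : {set V}) : R :=
  if S 0 \in A then (if spines_in A then G A else Wt)
  else if sparse A then Gs * (1 - P A) else Wt.

(* [B * rho] leaves the slack that absorbs the jumps of [ft] to [Wt]. *)
Definition beta (A : {set V}) : R := e * (1 - P A) + B * fB A + ft A.

Let decay01 (f : V -> nat) u : 0 <= (decay R \o f) u <= 1.
Proof. by rewrite /= decay_ge0 decay_le1. Qed.

Let near01 k u : 0 <= (if (d u < k.*2)%N then decay R (d u) else 1) <= 1.
Proof. by case: ifP => _; rewrite ?decay_ge0 ?decay_le1 ?ler01 ?lexx. Qed.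

Let far01 k u : 0 <= (if (d u < k.*2)%N then 1 else decay R (gap k u)) <= 1.
Proof. by case: ifP => _; rewrite ?decay_ge0 ?decay_le1 ?ler01 ?lexx. Qed.

Let ge0P r (A : {set V}) : (forall u, 0 <= r u <= 1) -> 0 <= setprod r A :> R.
Proof. by move=> r01; apply: setprod_ge0 => u; case/andP: (r01 u). Qed.

Let q_gt0 : 0 < q. Proof. by rewrite exprn_gt0 // invr_gt0. Qed.
Let q_le1 : q <= 1. Proof. by rewrite exprn_ile1 ?invr_ge0 // invf_le1 ?ler1n. Qed.

Lemma P_range A : 0 <= P A <= 1.
Proof. by rewrite ge0P ?setprod_le1. Qed.

Lemma Pk_range k A : 0 <= Pk k A <= 1.
Proof. by rewrite ge0P ?setprod_le1. Qed.

Lemma near_range k A : 0 <= near k A <= 1.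
Proof. by rewrite ge0P ?setprod_le1. Qed.

Lemma far_range k A : 0 <= far k A <= 1.
Proof. by rewrite ge0P ?setprod_le1. Qed.

Lemma rho_range k A : 0 <= rho k A <= q / 4%:R.
Proof.
have /andP[n0 n1] := near_range k A; have /andP[f0 f1] := far_range k A.
have q4 : 0 <= q / 4%:R by rewrite divr_ge0 // ltW.
rewrite mulr_ge0 //=; last by rewrite mulr_ge0 // subr_ge0.
by rewrite ler_piMr // mulr_ile1 // ?subr_ge0 // lerBlDr lerDl.
Qed.

Lemma fB_range A : - n%:R <= fB A <= n%:R.
Proof.
have E (F : nat -> R) : (forall k, -1 <= F k <= 1) ->
    - n%:R <= \sum_(1 <= k < n.+1) F k <= n%:R.
  move=> H; have -> : n%:R = \sum_(1 <= k < n.+1) 1 :> R.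
    by rewrite sumr_const_nat subn1.
  by rewrite -sumrN !ler_sum // => k _; case/andP: (H k).
have Pr := P_range A; rewrite /fB; case: ifP => _; last case: ifP => _; apply: E => k.
- by have := Pk_range k A; lra.
- by have := rho_range k A; have := q_le1; lra.
- lra.
Qed.

Lemma ft_range A : 0 <= ft A <= Wt.
Proof.
have Pr := P_range A; have Wr := Gs_range; have W0 := Wt_ge0.
rewrite /ft; case: ifP => _; case: ifP => _ //; rewrite ?lexx ?andbT //.
apply/andP; split; first by apply: mulr_ge0; lra.
apply: le_trans (_ : Gs <= _); last by lra.
by apply: ler_piMr; lra.
Qed.

Lemma S0_d : d (S 0) = 0%N. Proof. by rewrite S_d. Qed.

Lemma d_eq0 u : (d u = 0)%N -> u = S 0.
Proof.
move=> du; have := S_uniq (d_main du); rewrite du => /(_ isT) [_ ->] //.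
Qed.

Lemma gap0 k : gap k (S k) = 0%N. Proof. by rewrite /gap eqxx. Qed.

Lemma gap_pos k u : u != S k -> (0 < gap k u)%N.
Proof. by rewrite /gap => /negbTE->; rewrite leq_max. Qed.

Lemma gap_lip k x y : (k <= n)%N -> adj x y -> (gap k y <= (gap k x).+1)%N.
Proof.
move=> kn xy; have := d_lip xy; have := xy; rewrite adj_sym => /d_lip yx xy'.
rewrite /gap; case: (y =P S k) => [//|_]; case: (x =P S k) => [E|_]; last first.
  by clear -yx xy'; lia.
by move: yx xy'; rewrite E S_d //; clear; lia.
Qed.

Lemma B_ge0 : 0 <= B.
Proof.
rewrite leNgt; apply/negP => B0.
have q4 : 0 < q / 4%:R * (q / dm.+1%:R) by rewrite !mulr_gt0 ?invr_gt0.
have : B * (q / 4%:R * (q / dm.+1%:R)) < 0 by rewrite pmulr_llt0.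
move/(le_lt_trans B_big); have := Wt_ge0; lra.
Qed.

Lemma e_ge0 : 0 <= e.
Proof.
rewrite leNgt; apply/negP => e0.
have q4 : 0 < q * dm.+1%:R^-1 ^+ 2 by rewrite mulr_gt0 // exprn_gt0 // invr_gt0.
have : e * (q * dm.+1%:R^-1 ^+ 2) < 0 by rewrite pmulr_llt0.
move/(le_lt_trans e_big); have := Wt_ge0.
have : 0 <= 4%:R * n.+1%:R * B by rewrite !mulr_ge0 // B_ge0.
lra.
Qed.

Lemma rho_ge0 k (C : {set V}) : 0 <= rho k C.
Proof. by case/andP: (rho_range k C). Qed.

Section Move.
Variables (A : {set V}) (x y : V).
Let B_ge0 := B_ge0.
Let e_ge0 := e_ge0.
Let rho_ge0 := rho_ge0.
Hypotheses (xy : adj x y) (yA : y \in A) (xA : x \notin A).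

Let neq_xy : x != y. Proof. by apply: contraNneq xA => ->. Qed.

Let in_del u : (u \in A :\ y) = (u != y) && (u \in A).
Proof. by rewrite !inE. Qed.

Let in_add u : (u \in x |: A) = (u == x) || (u \in A).
Proof. by rewrite !inE. Qed.

Let P0 := P (A :\ y).

Lemma P_split : P0 + P (x |: A) = 2 * P A + P0 * slack R (d x) (d y).
Proof. exact: setprod_slack. Qed.

Lemma P_sub : 2 * P A <= P0 + P (x |: A).
Proof.
rewrite P_split lerDl mulr_ge0 ?slack_ge0 ?d_lip //.
by have /andP[] := P_range (A :\ y).
Qed.

Lemma Pk_sub k : (k <= n)%N -> 2 * Pk k A <= Pk k (A :\ y) + Pk k (x |: A).
Proof.
move=> kn; rewrite /Pk setprod_slack // lerDl mulr_ge0 ?slack_ge0 ?gap_lip //.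
by have /andP[] := Pk_range k (A :\ y).
Qed.

Lemma P_half (C : {set V}) : S 0 \notin C -> q <= P C.
Proof.
move=> sC; apply: setprod_half => u uC /=; apply: decay_half.
by rewrite lt0n; apply: contraNneq sC => /d_eq0 <-.
Qed.

Lemma Pk_half k (C : {set V}) : S k \notin C -> q <= Pk k C.
Proof.
move=> sC; apply: setprod_half => u uC /=; apply/decay_half/gap_pos.
by apply: contraNneq sC => <-.
Qed.

Lemma P_S0 (C : {set V}) : S 0 \in C -> P C = 0.
Proof. by move=> sC; rewrite /P (setprod_eq0 sC) //= S0_d /decay mul0r. Qed.

Lemma Pk_S k (C : {set V}) : S k \in C -> Pk k C = 0.
Proof. by move=> sC; rewrite /Pk (setprod_eq0 sC) //= gap0 /decay mul0r. Qed.

Let B_q : 2 * Wt <= B * (q / 2).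
Proof.
apply: le_trans B_big _; apply: ler_wpM2l => //.
have := q_gt0; have := q_le1; set z := q => z1 z0.
have D : dm.+1%:R^-1 <= 1 :> R by rewrite invf_le1 // ler1n.
have D0 : 0 < dm.+1%:R^-1 :> R by rewrite invr_gt0.
have : z / dm.+1%:R <= 1 by rewrite mulr_ile1 // ltW.
move: (z / _) => t t1; nra.
Qed.

(* [e] outweighs the other two potentials. *)
Let from_e_slack : q * dm.+1%:R^-1 ^+ 2 <= P0 + P (x |: A) - 2 * P A ->
  superharmonic_at beta A x y.
Proof.
move=> H; rewrite /superharmonic_at /beta -/P0.
have f0 := fB_range (A :\ y); have f1 := fB_range (x |: A); have f2 := fB_range A.
have t0 := ft_range (A :\ y); have t1 := ft_range (x |: A); have t2 := ft_range A.
have k : B * (fB (A :\ y) + fB (x |: A) - 2 * fB A) <= 4%:R * n.+1%:R * B.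
  rewrite mulrC; apply: ler_wpM2r => //; rewrite -natr1; lra.
have h : e * (q * dm.+1%:R^-1 ^+ 2) <= e * (P0 + P (x |: A) - 2 * P A).
  exact: ler_wpM2l.
have := le_trans e_big h; move: k; move: (4%:R * n.+1%:R * B) => c.
by rewrite !(mulrDr, mulrBr, mulrN); lra.
Qed.

(** [P] vanishes while the source is in the set and jumps to at least [q] when it leaves. *)
Lemma move_off_source : y = S 0 -> superharmonic_at beta A x y.
Proof.
move=> yS; apply: from_e_slack.
have sA : S 0 \in A by rewrite -yS.
rewrite (P_S0 sA) (@P_S0 (x |: A)) ?in_add ?sA ?orbT // mulr0 subr0 addr0.
apply: le_trans (@P_half (A :\ y) _); last by rewrite in_del yS eqxx.
rewrite -[leRHS]mulr1; apply: ler_wpM2l; first exact: ltW.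
by rewrite exprn_ile1 // ?invr_ge0 // invf_le1 ?ler1n.
Qed.

(** The entering vertex is no nearer to the source than the leaving one, so the slack of [P] is
    bounded below and [e] pays for the rest. *)
Lemma flat_move : S 0 \notin A -> (d y <= d x)%N -> superharmonic_at beta A x y.
Proof.
move=> sA dyx; apply: from_e_slack; rewrite P_split addrC addKr.
apply: ler_pM; rewrite ?(ltW q_gt0) ?exprn_ge0 ?invr_ge0 //.
  by apply: P_half; rewrite in_del (negbTE sA) andbF.
by apply: slack_ge; rewrite dyx d_max.
Qed.

(* The two remaining cases leave the first potential unchanged up to its own
   superharmonicity. *)
Let from_rest : B * fB (A :\ y) + B * fB (x |: A) + ft (A :\ y) + ft (x |: A)
    <= 2 * (B * fB A) + 2 * ft A -> superharmonic_at beta A x y.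
Proof.
move=> H; rewrite /superharmonic_at /beta -/P0.
have : e * (2 * P A) <= e * (P0 + P (x |: A)) by apply: ler_wpM2l => //; exact: P_sub.
by rewrite !(mulrDr, mulrBr, mulrN); lra.
Qed.

Let B_sum (F0 F1 F2 : nat -> R) (k0 : nat) c : (1 <= k0 <= n)%N ->
  (forall k, (1 <= k <= n)%N -> F0 k + F1 k <= 2 * F2 k) ->
  F0 k0 + F1 k0 + c <= 2 * F2 k0 ->
  \sum_(1 <= k < n.+1) F0 k + \sum_(1 <= k < n.+1) F1 k + c <=
    2 * \sum_(1 <= k < n.+1) F2 k.
Proof.
move=> k0n H H0; rewrite mulr_sumr -big_split /=.
have k0i : k0 \in index_iota 1 n.+1 by rewrite mem_index_iota.
rewrite (big_rem k0) // [in leRHS](big_rem k0) //=.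
rewrite [leLHS]addrAC; apply: lerD; first exact: H0.
rewrite big_seq [leRHS]big_seq; apply: ler_sum => k /mem_rem; rewrite mem_index_iota; exact: H.
Qed.

Let B_sum0 (F0 F1 F2 : nat -> R) :
  (forall k, (1 <= k <= n)%N -> F0 k + F1 k <= 2 * F2 k) ->
  \sum_(1 <= k < n.+1) F0 k + \sum_(1 <= k < n.+1) F1 k <=
    2 * \sum_(1 <= k < n.+1) F2 k.
Proof.
move=> H; rewrite mulr_sumr -big_split /= big_seq [leRHS]big_seq.
by apply: ler_sum => k; rewrite mem_index_iota; exact: H.
Qed.

Let spine_add : (spines_in A) -> spines_in (x |: A).
Proof. by move/forallP => H; apply/forallP => k; rewrite in_add H orbT. Qed.

(** [P] is 0 on all three sets. Either a spine vertex is missing already, and [ft A] is maximal; or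
    a spine vertex leaves, and its [Pk] jumps from 0 to at least [q]; or the move avoids the spine,
    and [G] is superharmonic. *)
Lemma keep_source : S 0 \in A -> y != S 0 -> superharmonic_at beta A x y.
Proof.
move=> sA ys; apply: from_rest.
have sA0 : S 0 \in A :\ y by rewrite in_del sA eq_sym ys.
have sA1 : S 0 \in x |: A by rewrite in_add sA orbT.
have t0 := ft_range (A :\ y); have t1 := ft_range (x |: A); have t2 := ft_range A.
have Bk k : (1 <= k <= n)%N ->
    (1 - Pk k (A :\ y)) + (1 - Pk k (x |: A)) <= 2 * (1 - Pk k A).
  by move=> /andP[_ kn]; have := Pk_sub kn; lra.
have FB : B * fB (A :\ y) + B * fB (x |: A) <= 2 * (B * fB A).
  rewrite -mulrDr mulrCA; apply: ler_wpM2l => //.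
  by rewrite /fB sA0 sA1 sA; exact: B_sum0.
have [spA|spA] := boolP (spines_in A); last first.
  have : ft A = Wt by rewrite /ft sA (negbTE spA).
  lra.
have [/existsP[[k kn] /= /eqP yk]|spy] := boolP (spine y).
  have k0 : (0 < k)%N by rewrite lt0n; apply: contraNneq ys => E; rewrite yk E.
  have FB' : fB (A :\ y) + fB (x |: A) + q / 2 <= 2 * fB A.
    rewrite /fB sA0 sA1 sA; apply: (B_sum (k0 := k)) => //; first by rewrite k0.
    rewrite (@Pk_S k A) -?yk // (@Pk_S k (x |: A)); last by rewrite -yk in_add yA orbT.
    have := @Pk_half k (A :\ y); rewrite in_del yk eqxx /= => /(_ isT).
    by have := q_gt0; lra.
  have := ler_wpM2l B_ge0 FB'; rewrite !mulrDr mulrCA; have := B_q; lra.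
have [/existsP[k /eqP xk]|spx] := boolP (spine x).
  by move: xA; rewrite xk (forallP spA).
have spA0 : spines_in (A :\ y).
  apply/forallP => k; rewrite in_del (forallP spA) andbT.
  by apply: contraNneq spy => <-; apply/existsP; exists k.
have := G_super xy yA xA spx spy; rewrite /superharmonic_at.
by rewrite /ft sA0 sA1 sA spA spA0 spine_add //; lra.
Qed.

Let far_S k (C : {set V}) : S k \in C -> (k <= n)%N -> far k C = 0.
Proof.
by move=> kC kn; rewrite /far (setprod_eq0 kC) // S_d // ltnn gap0 /decay mul0r.
Qed.

Let far_half k (C : {set V}) : S k \notin C -> q <= far k C.
Proof.
move=> kC; apply: setprod_half => u uC; case: ifP => _.
  by rewrite invf_le1 // ler1n.
by apply/decay_half/gap_pos; apply: contraNneq kC => <-.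
Qed.

Hypothesis sA : S 0 \notin A.
Hypothesis step1 : d y = (d x).+1.

Let P_step : P0 + P (x |: A) = 2 * P A.
Proof. by rewrite P_split step1 slack_eq0 mulr0 addr0. Qed.

Let sA0 : S 0 \notin A :\ y. Proof. by rewrite in_del (negbTE sA) andbF. Qed.

Let fB_le (C : {set V}) : S 0 \notin C -> fB C <= \sum_(1 <= k < n.+1) (1 - P C).
Proof.
move=> sC; rewrite /fB (negbTE sC); case: ifP => // _.
by apply: ler_sum => k _; rewrite lerBlDr lerDl.
Qed.

Let fB_le1 (C : {set V}) : fB C <= \sum_(1 <= k < n.+1) (1 - P C).
Proof.
have [sC|/fB_le//] := boolP (S 0 \in C); rewrite /fB sC.
apply: ler_sum => k _; rewrite P_S0 // subr0 lerBlDr lerDl.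
by case/andP: (Pk_range k C).
Qed.

Let sum_P : \sum_(1 <= k < n.+1) (1 - P (A :\ y)) + \sum_(1 <= k < n.+1) (1 - P (x |: A))
   = 2 * \sum_(1 <= k < n.+1) (1 - P A).
Proof.
rewrite mulr_sumr -big_split; apply: eq_bigr => k _ /=.
by have := P_step; rewrite /P0; lra.
Qed.

(** Both [fB] and [ft] take at [A] the values that bound them everywhere, and the bound for [fB] is
    harmonic along this move. *)
Lemma step_nonmain : ~~ [forall u in A, main u] -> superharmonic_at beta A x y.
Proof.
move=> nm; apply: from_rest.
have ftA : ft A = Wt.
  by rewrite /ft (negbTE sA) /sparse (negbTE nm).
have fBA : fB A = \sum_(1 <= k < n.+1) (1 - P A).
  by rewrite /fB (negbTE sA) (negbTE nm).
have t0 := ft_range (A :\ y); have t1 := ft_range (x |: A).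
have := ler_wpM2l B_ge0 (lerD (fB_le1 (A :\ y)) (fB_le1 (x |: A))).
by rewrite sum_P -fBA !mulrDr mulrCA ftA; lra.
Qed.

Hypothesis mainA : [forall u in A, main u].

Let main_x : main x.
Proof. by apply: main_step (step1) => //; apply: (forall_inP mainA). Qed.

Let mainA0 : [forall u in A :\ y, main u].
Proof.
apply/forall_inP => u; rewrite in_del => /andP[_]; exact: (forall_inP mainA).
Qed.

Let mainA1 : [forall u in x |: A, main u].
Proof.
apply/forall_inP => u; rewrite in_add => /orP[/eqP->//|]; exact: (forall_inP mainA).
Qed.

Let fBA : fB A = \sum_(1 <= k < n.+1) ((1 - P A) - rho k A).
Proof. by rewrite /fB (negbTE sA) mainA. Qed.

Let fBA0 : fB (A :\ y) = \sum_(1 <= k < n.+1) ((1 - P (A :\ y)) - rho k (A :\ y)).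
Proof. by rewrite /fB (negbTE sA0) mainA0. Qed.

Let sparse_del : sparse A -> sparse (A :\ y).
Proof.
case/andP => _ /forall_inP H; apply/andP; split; first exact: mainA0.
apply/forall_inP => u; rewrite in_del => /andP[_ uA].
apply/forall_inP => v; rewrite in_del => /andP[_ vA].
exact: (forall_inP (H u uA)).
Qed.

Let combine c : fB (A :\ y) + fB (x |: A) + c <= 2 * fB A -> 0 <= c ->
  ft (A :\ y) + ft (x |: A) <= 2 * ft A + B * c -> superharmonic_at beta A x y.
Proof.
move=> H c0 ft_le; apply: from_rest.
by have := ler_wpM2l B_ge0 H; rewrite !mulrDr mulrCA; lra.
Qed.

(** The source enters, and [fB] switches from [P] and [rho] to the products [Pk]. This loses nothing
    at the spine vertices in [A] and gains q / 2 at the others, where 2 * rho <= q / 2 and Pk >= q.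
    A missing spine vertex thus pays for [ft]; if none is missing, sparseness bounds [G] by [Gs]. *)
Let step_source : x = S 0 -> superharmonic_at beta A x y.
Proof.
move=> xs.
have sA1 : S 0 \in x |: A by rewrite in_add xs eqxx.
have PA1 : P (x |: A) = 0 by exact: P_S0.
have Pk_ge0 k : 0 <= Pk k (x |: A) by case/andP: (Pk_range k (x |: A)).
have t0 := ft_range (A :\ y); have t1 := ft_range (x |: A); have t2 := ft_range A.
have fB1 : fB (x |: A) = \sum_(1 <= k < n.+1) (1 - Pk k (x |: A)) by rewrite /fB sA1.
have PA := P_step; rewrite PA1 addr0 /P0 in PA.
have Skx k : (0 < k)%N -> (k <= n)%N -> S k != x.
  move=> k0 kn; rewrite xs; apply: contraTneq k0 => /(congr1 d).
  by rewrite S_d // S0_d => /eqP; rewrite double_eq0 => /eqP->.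
have key k : (1 <= k <= n)%N ->
   ((1 - P (A :\ y)) - rho k (A :\ y)) + (1 - Pk k (x |: A)) <= 2 * ((1 - P A) - rho k A).
  move=> /andP[k0 kn]; rewrite PA; have := rho_ge0 k (A :\ y).
  have := rho_range k A; have [kA|kA] := boolP (S k \in A).
    have -> : rho k A = 0 by rewrite /rho far_S // !mulr0.
    by have := Pk_ge0 k; lra.
  have : q <= Pk k (x |: A) by apply: Pk_half; rewrite in_add negb_or Skx.
  lra.
have [sp|sp] := boolP (spines_in (x |: A)).
  apply: (combine (c := 0)); rewrite ?lexx // ?mulr0 ?addr0.
    by rewrite fBA0 fB1 fBA; exact: B_sum0.
  have [spA|spA] := boolP (sparse A); last first.
    have -> : ft A = Wt by rewrite /ft (negbTE sA) (negbTE spA).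
    lra.
  rewrite /ft (negbTE sA0) sA1 (negbTE sA) sparse_del // sp spA PA.
  suff : G (x |: A) <= Gs by lra.
  apply: G_sparse => [k kn|]; first by have /forallP/(_ (inord k)) := sp; rewrite inordK.
  apply/andP; split; first exact: mainA1.
  have ev : odd (d x) = false by rewrite xs S0_d.
  have /andP[_ /forall_inP H] := spA.
  apply/forall_inP => u; rewrite in_add => uA; apply/forall_inP => v; rewrite in_add => vA.
  apply/implyP => /andP[ou /eqP uv].
  have {uA} uA : u \in A by case/orP: uA => // /eqP ux; rewrite ux ev in ou.
  have {vA} vA : v \in A by case/orP: vA => // /eqP vx; rewrite uv vx ev in ou.
  by have /forall_inP/(_ v vA)/implyP := H u uA; rewrite ou uv eqxx; apply.
have [k kA1] : exists k : 'I_n.+1, S k \notin x |: A by apply/existsP; rewrite -negb_forall.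
have k0 : (0 < k)%N by rewrite lt0n; apply: contraNneq kA1 => ->.
have kn : (k <= n)%N by rewrite -ltnS.
apply: (combine (c := q / 2)); last by have := B_q; lra.
  rewrite fBA0 fB1 fBA; apply: (B_sum (k0 := k)) => //; first by rewrite k0.
  have := Pk_half kA1; rewrite PA; have := rho_ge0 k (A :\ y); have := rho_range k A; lra.
by have := q_gt0; lra.
Qed.

(** If both vertices count in [near], the move is neutral by [slack_eq0]; if both count in [far],
    [gap] is 1-Lipschitz. On the border [y] is main and at distance 2k, so it is [S k], and
    [rho k A] is 0. *)
Let rho_step k : (1 <= k <= n)%N -> 2 * rho k A <= rho k (A :\ y) + rho k (x |: A).
Proof.
move=> /andP[_ kn]; have xA' := xA; have yA' := yA.
have q4 : 0 <= q / 4%:R by rewrite divr_ge0 // ltW.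
have n0 := near_range k (A :\ y); have f0 := far_range k (A :\ y).
have sl := slack_eq0 R (d x); rewrite -step1 /slack in sl.
rewrite /rho /near /far !(setprodU1 _ xA) !(setprodD1 _ yA).
rewrite -/(near k (A :\ y)) -/(far k (A :\ y)).
have [dy|dy] := ltnP (d y) k.*2.
  have -> : (d x < k.*2)%N by clear -step1 dy; lia.
  move: (near k _) (far k _) n0 f0 => N F n0 f0; rewrite !mul1r -!mulrDr mulrCA.
  apply: ler_wpM2l => //.
  have -> : decay R (d x) * (decay R (d y) * N) = (2 * decay R (d y) - 1) * N.
    by rewrite mulrA; congr (_ * _); lra.
  by rewrite le_eqVlt; apply/orP; left; apply/eqP; ring.
have [dx|dx] := ltnP (d x) k.*2.
  have dyk : d y = k.*2 by clear -step1 dy dx; lia.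
  have my : main y by exact: (forall_inP mainA).
  have [|_ ySk] := S_uniq my; first by rewrite dyk odd_double.
  rewrite {1}dyk doubleK in ySk.
  have -> : decay R (gap k y) = 0 by rewrite ySk gap0 /decay mul0r.
  rewrite !(mul0r, mulr0) addr0; apply: mulr_ge0 => //; apply: mulr_ge0; lra.
have sg := slack_ge0 R (gap_lip kn xy); rewrite /slack in sg.
move: (near k _) (far k _) n0 f0 => N F n0 f0; rewrite !mul1r -!mulrDr mulrCA.
apply: ler_wpM2l => //.
rewrite mulrCA; apply: ler_wpM2l; first by lra.
move: (decay R (gap k x)) (decay R (gap k y)) sg => rx ry sg.
have : 0 <= F * (1 + rx * ry - 2 * ry) by apply: mulr_ge0; lra.
lra.
Qed.

(** Sparseness is lost only if [x] joins a vertex [v] of the same layer. Then [y], one step further,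
    is the spine vertex behind them, and its removal makes [rho k] positive, since [v] is nearer to
    the source than the missing [S k]. *)
Let step_inside : x != S 0 -> superharmonic_at beta A x y.
Proof.
move=> xs.
have sA1 : S 0 \notin x |: A by rewrite in_add negb_or eq_sym xs.
have fBA1 : fB (x |: A) = \sum_(1 <= k < n.+1) ((1 - P (x |: A)) - rho k (x |: A)).
  by rewrite /fB (negbTE sA1) mainA1.
have t0 := ft_range (A :\ y); have t1 := ft_range (x |: A); have t2 := ft_range A.
have PA := P_step; rewrite /P0 in PA.
have key k : (1 <= k <= n)%N ->
   ((1 - P (A :\ y)) - rho k (A :\ y)) + ((1 - P (x |: A)) - rho k (x |: A))
    <= 2 * ((1 - P A) - rho k A) by move=> /rho_step; lra.
have fB_sum : fB (A :\ y) + fB (x |: A) + 0 <= 2 * fB A.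
  by rewrite addr0 fBA0 fBA1 fBA; exact: B_sum0.
have [spA|spA] := boolP (sparse A); last first.
  apply: (combine fB_sum) => //.
  have -> : ft A = Wt by rewrite /ft (negbTE sA) (negbTE spA).
  lra.
have /andP[_ /forall_inP H] := spA.
have [|nbr] := boolP [exists v in A, odd (d x) && (d v == d x)]; last first.
  have spA1 : sparse (x |: A).
    apply/andP; split; first exact: mainA1.
    move: nbr; rewrite negb_exists_in => /forall_inP nbr.
    apply/forall_inP => u; rewrite in_add => uA; apply/forall_inP => v; rewrite in_add => vA.
    apply/implyP => /andP[ou /eqP uv].
    case/orP: uA => [/eqP ux|uA]; case/orP: vA => [/eqP vx|vA].
    - by rewrite ux vx.
    - by move: (nbr v vA); rewrite -ux ou uv eqxx.
    - by move: (nbr u uA); rewrite -vx -uv ou eqxx.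
    by have /forall_inP/(_ v vA)/implyP := H u uA; rewrite ou uv eqxx; apply.
  apply: (combine fB_sum) => //.
  rewrite /ft (negbTE sA0) (negbTE sA1) (negbTE sA) sparse_del // spA1 spA mulr0 addr0.
  by rewrite -mulrDr mulrCA; apply: ler_wpM2l; [case/andP: Gs_range|lra].
move=> /exists_inP[v vA /andP[ox /eqP dv]].
have my : main y by exact: (forall_inP mainA).
have [|kn yS] := S_uniq my; first by rewrite step1 /= ox.
set k := (d y)./2 in kn yS.
have dyk : d y = k.*2 by rewrite yS S_d.
have k0 : (1 <= k <= n)%N by rewrite kn andbT; clear -dyk step1; lia.
have vA0 : v \in A :\ y.
  rewrite in_del vA andbT; apply/eqP => vy; move: step1; rewrite -dv vy.
  by clear; lia.
have kA0 : S k \notin A :\ y by rewrite in_del -yS eqxx.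
have kA : S k \in A by rewrite -yS.
have rA : rho k A = 0 by rewrite /rho far_S // !mulr0.
have rA0 : q / 4%:R * (q / dm.+1%:R) <= rho k (A :\ y).
  apply: ler_wpM2l; first by rewrite divr_ge0 // ltW.
  rewrite mulrC; apply: ler_pM; rewrite ?invr_ge0 ?(ltW q_gt0) //; last exact: far_half.
  rewrite lerBrDl -lerBrDr.
  apply: le_trans (setprod_le _ vA0) _; first exact: near01.
  have -> : (d v < k.*2)%N by rewrite dv -dyk step1.
  by apply: decay_le; apply: d_max.
apply: (combine (c := q / 4%:R * (q / dm.+1%:R))).
- rewrite fBA0 fBA1 fBA; apply: (B_sum k0 key).
  by rewrite rA; have := rho_ge0 k (x |: A); move: rA0; move: (_ / _ * _) => z; lra.
- by rewrite !mulr_ge0 ?invr_ge0 ?(ltW q_gt0).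
- apply: (@le_trans _ _ (2 * Wt)); first by lra.
  by apply: le_trans B_big _; rewrite lerDr mulr_ge0 //; case/andP: t2.
Qed.

Lemma step_main : superharmonic_at beta A x y.
Proof. by have [/eqP|] := boolP (x == S 0); [exact: step_source|exact: step_inside]. Qed.

End Move.

Lemma beta_super (A : {set V}) x y : adj x y -> y \in A -> x \notin A ->
  superharmonic_at beta A x y.
Proof.
move=> xy yA xA.
have [/eqP yS|ys] := boolP (y == S 0); first exact: move_off_source.
have [sA|sA] := boolP (S 0 \in A); first exact: keep_source.
have [dyx|dxy] := leqP (d y) (d x); first exact: flat_move.
have step1 : d y = (d x).+1 by apply/eqP; rewrite eqn_leq d_lip.
have [mA|mA] := boolP [forall u in A, main u]; first exact: step_main.
exact: step_nonmain.
Qed.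

Variable eta0 : V -> R.
Hypothesis eta0_source : eta0 (S 0) = e.
Hypothesis eta0_spine : forall k, (0 < k <= n)%N -> eta0 (S k) = B.
Hypothesis eta0_other : forall u, ~~ spine u -> eta0 u = tau u.

Lemma S_inj k l : (k <= n)%N -> (l <= n)%N -> S k = S l -> k = l.
Proof. by move=> kn ln /(congr1 d); rewrite !S_d // => /double_inj. Qed.

Lemma spine_sum (A : {set V}) : \sum_(u in A | spine u) eta0 u =
  (S 0 \in A)%:R * e + B * \sum_(1 <= k < n.+1) (S k \in A)%:R.
Proof.
transitivity (\sum_(u in [set S k | k : 'I_n.+1 in [pred k : 'I_n.+1 | S k \in A]]) eta0 u).
  apply: eq_bigl => u; apply/andP/imsetP => [[uA /existsP[k /eqP uk]]|[k kA ->]].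
    by exists k => //; rewrite inE -uk.
  by split => //; apply/existsP; exists k.
rewrite big_imset /=; last first.
  by move=> k l _ _ /(S_inj (ltn_ord k) (ltn_ord l)) /val_inj.
rewrite big_mkcond big_ord_recl /= big_add1 /= big_mkord mulr_sumr; congr (_ + _).
  by rewrite inE; case: ifP; rewrite ?mul1r ?mul0r.
apply: eq_bigr => k _; rewrite inE /=; case: ifP => _; last by rewrite mulr0.
by rewrite mulr1 eta0_spine //= ltn_ord.
Qed.

Lemma tau_sum_le (A : {set V}) : \sum_(u in A | ~~ spine u) eta0 u <= Wt.
Proof.
apply: le_trans tau_total.
rewrite (eq_bigr tau); last by move=> u /andP[_ /eta0_other].
by rewrite [leRHS](bigID (fun u => (u \in A) && ~~ spine u)) /= lerDl sumr_ge0.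
Qed.

Lemma beta_init (A : {set V}) : \sum_(u in A) eta0 u <= beta A.
Proof.
rewrite (bigID spine) /= spine_sum.
have tA := tau_sum_le A; have ftA := ft_range A.
have [sA|sA] := boolP (S 0 \in A).
  rewrite mul1r /beta P_S0 // subr0 mulr1 -!addrA lerD2l.
  apply: lerD; last first.
    rewrite /ft sA; case: ifP => // /forallP sp.
    rewrite (eq_bigr tau); last by move=> u /andP[_ /eta0_other].
    by apply: tau_G => k kn; have := sp (inord k); rewrite inordK.
  apply: ler_wpM2l; rewrite ?B_ge0 ?e_ge0 //; rewrite /fB sA; apply: ler_sum => k _.
  have [kA|kA] := boolP (S k \in A); first by rewrite Pk_S // subr0.
  by rewrite subr_ge0; case/andP: (Pk_range k A).
rewrite mul0r add0r.
have [->|/set0Pn[u uA]] := eqVneq A finset.set0.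
  rewrite big1 ?mulr0; last by move=> k _; rewrite inE.
  rewrite big1 ?addr0; last by move=> k; rewrite inE.
  have P1 r : setprod r finset.set0 = 1 :> R by rewrite /setprod big_set0.
  rewrite /beta /P P1 subrr mulr0 add0r addr_ge0 //; last by case/andP: (ft_range finset.set0).
  rewrite mulr_ge0 ?B_ge0 // /fB inE; case: ifP => _; apply: sumr_ge0 => k _.
    by rewrite /rho /near /P !P1 !subrr mul0r mulr0 subr0.
  by rewrite /P P1 subrr.
(* Without the source, a single vertex already makes 1 - P at least 1 / (dm + 1), so [e] covers all
   the other levels. *)
have PA : P A <= 1 - dm.+1%:R^-1.
  apply: le_trans (setprod_le _ uA) _; first exact: decay01.
  exact: decay_le.
have D1 : dm.+1%:R^-1 <= 1 :> R by rewrite invf_le1 // ler1n.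
have D0 : 0 < dm.+1%:R^-1 :> R by rewrite invr_gt0.
have eP : e * (q * dm.+1%:R^-1 ^+ 2) <= e * (1 - P A).
  apply: ler_wpM2l; rewrite ?B_ge0 ?e_ge0 //; move: PA; set D := dm.+1%:R^-1 in D1 D0 *; move=> PA.
  have : q * D ^+ 2 <= D.
    rewrite expr2 mulrA; apply: ler_piMl; first exact: ltW.
    by rewrite mulr_ile1 // ltW.
  move: (q * _) => z; lra.
have {}eP := le_trans e_big eP.
have spn : B * \sum_(1 <= k < n.+1) (S k \in A)%:R <= B * n%:R.
  apply: ler_wpM2l; rewrite ?B_ge0 ?e_ge0 //; apply: (@le_trans _ _ (\sum_(1 <= k < n.+1) 1)).
    by apply: ler_sum => k _; rewrite lern1; case: (S k \in A).
  by rewrite sumr_const_nat subn1.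
have fBA : - (B * n%:R) <= B * fB A.
  by rewrite -mulrN; apply: ler_wpM2l; rewrite ?B_ge0 ?e_ge0 //; case/andP: (fB_range A).
have Bn : 0 <= B * n%:R by rewrite mulr_ge0 ?B_ge0.
rewrite /beta; move: eP; have -> : 4%:R * n.+1%:R * B = 4%:R * (B * n%:R) + 4%:R * B.
  by rewrite -natr1; ring.
move: (B * n%:R) (e * _) (B * fB A) (B * \sum_(_ <= _ < _) _) spn fBA Bn => *; have := B_ge0; lra.
Qed.

(** Evaluates [beta] at the singleton of the target, which has distance 2n from the source, so that
    1 - P is 1 / (2n + 1). *)
Lemma target_bound s : all (legal_move adj) s ->
  final_profile eta0 s (S n) <= (e + n%:R * B + Gs) / n.*2.+1%:R.
Proof.
move=> ls.
have := @set_bound R V adj beta eta0 adj_irr beta_init _ s ls [set S n].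
rewrite big_set1 => /(_ _)/le_trans-> //.
  by move=> A x y /orP[xy|]; [exact: beta_super|rewrite adj_sym => xy; exact: beta_super].
have PS : P [set S n] = 1 - n.*2.+1%:R^-1.
  by rewrite /P /setprod big_set1 /= S_d // decayE.
have s0 : S 0 \notin [set S n].
  rewrite inE; apply: contraTneq n_gt0 => /(S_inj (leq0n n) (leqnn n)) <-.
  by rewrite ltnn.
have mS : [forall u in [set S n], main u].
  by apply/forall_inP => u; rewrite inE => /eqP->; exact: S_main.
have spS : sparse [set S n].
  rewrite /sparse mS; apply/forall_inP => u; rewrite inE => /eqP->.
  by apply/forall_inP => v; rewrite inE => /eqP->; rewrite !eqxx; case: odd.
rewrite /beta /ft /fB (negbTE s0) mS spS PS.
have -> : 1 - (1 - n.*2.+1%:R^-1) = n.*2.+1%:R^-1 :> R by ring.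
set z := n.*2.+1%:R^-1; rewrite mulrDl mulrDl; apply: lerD => //.
apply: lerD => //; rewrite -mulrA mulrCA; apply: ler_wpM2l; first exact: B_ge0.
apply: (@le_trans _ _ (\sum_(1 <= k < n.+1) z)).
  by apply: ler_sum => k _; rewrite lerBlDr lerDl; case/andP: (rho_range k [set S n]).
by rewrite sumr_const_nat subn1 mulr_natl.
Qed.

End Layered.

Local Close Scope ring_scope.

(** * Flattening *)

Local Open Scope ring_scope.

Section Moves.
Variables (R : realType) (V : finType) (adj : rel V).
Hypothesis adj_irr : irreflexive adj.

Lemma final_profile_cat (eta : V -> R) s t :
  final_profile eta (s ++ t) = final_profile (final_profile eta s) t.
Proof. exact: foldl_cat. Qed.

Lemma final_profile_le (eta : V -> R) c s : (forall u, eta u <= c) ->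
  all (legal_move adj) s -> forall u, final_profile eta s u <= c.
Proof.
elim: s eta => //= [[[x y] mu] s] IH eta H /andP[/andP[_ /andP[m0 m2]] ls].
apply: IH => // u /=; have Hx := H x; have Hy := H y.
by case: ifP => _; [|case: ifP => _ //]; nra.
Qed.

Section Flatten.
Variable U : {set V}.
Hypothesis U_conn : {in U &, forall u v,
  connect [rel x y | [&& x \in U, y \in U & adj x y]] u v}.

Definition energy (f : V -> R) : R := \sum_(u in U) f u ^+ 2.

Lemma average_move (f : V -> R) x y : x \in U -> y \in U -> adj x y ->
  let g := apply_move f (x, y, 2^-1) in
  [/\ forall u, u \notin U -> g u = f u,
      \sum_(u in U) g u = \sum_(u in U) f u &
      energy g = energy f - (f x - f y) ^+ 2 / 2].
Proof.
move=> xU yU xy g; have neq : x != y by apply: contraTneq xy => ->; rewrite adj_irr.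
have gx : g x = (f x + f y) / 2 by rewrite /g /= eqxx; field.
have gy : g y = (f x + f y) / 2 by rewrite /g /= eq_sym (negbTE neq) eqxx; field.
have go u : u != x -> u != y -> g u = f u by rewrite /g /= => /negbTE-> /negbTE->.
have yU' : y \in U :\ x by rewrite !inE eq_sym neq.
have rest (F : R -> R) : \sum_(u in U :\ x :\ y) F (g u) = \sum_(u in U :\ x :\ y) F (f u).
  by apply: eq_bigr => u; rewrite !inE => /and3P[uy ux _]; rewrite go.
split.
- move=> u uU; apply: go; first by apply: contraNneq uU => ->.
  by apply: contraNneq uU => ->.
- rewrite (big_setD1 x) // (big_setD1 y) //= (rest id) [RHS](big_setD1 x) //.
  by rewrite [\sum_(u in U :\ x) f u](big_setD1 y) //= gx gy; field.
- rewrite /energy (big_setD1 x) // (big_setD1 y) //= (rest (fun z => z ^+ 2)).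
  rewrite [\sum_(u in U) _](big_setD1 x) //.
  by rewrite [\sum_(u in U :\ x) f u ^+ 2](big_setD1 y) //= gx gy; field.
Qed.

(** Averaging over an edge whose ends differ by more than [g] lowers the sum of squares by more than
    g ^ 2 / 2, which can happen only finitely often. *)
Lemma nearly_flat (g : R) : 0 < g -> forall f : V -> R, exists s,
  [/\ all (legal_move adj) s,
      forall u, u \notin U -> final_profile f s u = f u,
      \sum_(u in U) final_profile f s u = \sum_(u in U) f u &
      forall x y, x \in U -> y \in U -> adj x y ->
        `|final_profile f s x - final_profile f s y| <= g].
Proof.
move=> g0 f; have D0 : 0 < g ^+ 2 / 2 by rewrite divr_gt0 // exprn_gt0.
have [N EN] : exists N, energy f < N%:R * (g ^+ 2 / 2).
  exists (Num.bound (energy f / (g ^+ 2 / 2))); rewrite -ltr_pdivrMr //.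
  apply: archi_boundP; rewrite divr_ge0 ?(ltW D0) //.
  by apply: sumr_ge0 => u _; exact: sqr_ge0.
elim: N f EN => [|N IH] f EN.
  move: EN; rewrite mul0r ltNge sumr_ge0 // => u _; exact: sqr_ge0.
have [flat|] := boolP [forall x in U, forall y in U, adj x y ==> (`|f x - f y| <= g)].
  exists [::]; split=> // x y xU yU xy.
  by have /forall_inP/(_ _ xU)/forall_inP/(_ _ yU)/implyP := flat; apply.
rewrite negb_forall_in => /exists_inP[x xU]; rewrite negb_forall_in => /exists_inP[y yU].
rewrite negb_imply -ltNge => /andP[xy lt_g].
have [off sum en] := average_move f xU yU xy.
have [|s [ls so ss sf]] := IH (apply_move f (x, y, 2^-1)).
  rewrite en ltrBlDr; apply: lt_le_trans EN _; rewrite -natr1 mulrDl mul1r lerD2l.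
  rewrite ler_pM2r ?invr_gt0 // -[leRHS]real_normK ?num_real //.
  by rewrite lerXn2r ?nnegrE ?(ltW g0) // ltW.
exists ((x, y, 2^-1) :: s); split => //=.
- by rewrite ls xy invr_ge0 ler0n lexx.
- by move=> u uU; rewrite so // off.
- by rewrite ss sum.
Qed.

Lemma path_difference (f : V -> R) g x p :
  path [rel x y | [&& x \in U, y \in U & adj x y]] x p ->
  (forall x y, x \in U -> y \in U -> adj x y -> `|f x - f y| <= g) ->
  `|f x - f (last x p)| <= (size p)%:R * g.
Proof.
move=> + H; elim: p x => [|y p IH] x /=; first by rewrite subrr normr0 mul0r.
move=> /andP[/and3P[xU yU xy] /IH{}IH].
rewrite -(subrK (f y) (f x)) -addrA; apply: le_trans (ler_normD _ _) _.
by rewrite -natr1 mulrDl mul1r [leRHS]addrC; apply: lerD => //; exact: H.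
Qed.

(** Edges are levelled up to eps / (#|V| + 1), and a path without repeated vertices adds up fewer
    than #|V| such errors. *)
Lemma flatten_set (eps : R) (f : V -> R) : 0 < eps -> exists s,
  [/\ all (legal_move adj) s,
      forall u, u \notin U -> final_profile f s u = f u &
      forall u, u \in U ->
        (\sum_(w in U) f w) / #|U|%:R - eps <= final_profile f s u].
Proof.
move=> e0; have g0 : 0 < eps / #|V|.+1%:R by rewrite divr_gt0.
have [s [ls so ss sf]] := nearly_flat g0 f.
exists s; split=> // u uU.
set h := final_profile f s in so ss sf *.
have U0 : 0 < #|U|%:R :> R by rewrite ltr0n card_gt0; apply/set0Pn; exists u.
rewrite lerBlDr ler_pdivrMr // -ss mulr_natr -sumr_const.
apply: ler_sum => w wU.
have /connectP[p /shortenP[p' pp' up' _] ->] := U_conn uU wU.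
have := path_difference pp' sf; rewrite distrC => /ler_normlW.
rewrite lerBlDr addrC => /le_trans-> //; rewrite lerD2l.
rewrite mulrA mulrAC -[leRHS]mul1r; apply: ler_wpM2r; first exact: ltW.
rewrite ler_pdivrMr // mul1r ler_nat.
by have := max_card (mem (u :: p')); rewrite (card_uniqP up') /= => /leqW/ltnW.
Qed.

End Flatten.

Definition connected_set (U : {set V}) : Prop :=
  {in U &, forall u v, connect [rel x y | [&& x \in U, y \in U & adj x y]] u v}.

Lemma flatten_family m (H : nat -> {set V}) (eps : R) (eta : V -> R) : 0 < eps ->
  (forall i, (i < m)%N -> connected_set (H i)) ->
  (forall i j, (i < m)%N -> (j < m)%N -> i != j -> [disjoint H i & H j]) ->
  exists s, [/\ all (legal_move adj) s,
    forall u, (forall i, (i < m)%N -> u \notin H i) -> final_profile eta s u = eta u &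
    forall i u, (i < m)%N -> u \in H i ->
      (\sum_(w in H i) eta w) / #|H i|%:R - eps <= final_profile eta s u].
Proof.
move=> e0; elim: m => [|m IH] conn dis; first by exists [::].
have [i im|i j im jm|s [ls so sf]] := IH.
- by apply: conn; apply: ltnW.
- by apply: dis; apply: ltnW.
have [t [lt to tf]] := flatten_set (conn m (ltnSn m)) (final_profile eta s) e0.
have dm i u : (i < m)%N -> u \in H i -> u \notin H m.
  move=> im ui; have /disjointFr-> // : [disjoint H i & H m].
  by apply: dis => //; [exact: ltnW|rewrite neq_ltn im].
exists (s ++ t); rewrite final_profile_cat all_cat ls lt; split=> // [u uH|i u].
  by rewrite to ?so // => [i im|]; apply: uH => //; exact: ltnW.
rewrite ltnS leq_eqVlt => /orP[/eqP-> um|im ui]; last by rewrite to ?sf ?(dm i).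
have -> : \sum_(w in H m) eta w = \sum_(w in H m) final_profile eta s w.
  apply: eq_bigr => w wm; rewrite so // => j jm.
  by apply: contraTN wm; exact: dm jm.
exact: tf.
Qed.

(** Meant for spiders [H i] with centres [c i] on the path [Pi]: the first stage changes the path at
    the centres only. *)
Lemma two_stage_flattening m (H : nat -> {set V}) (c : nat -> V) (Pi : {set V})
    (v : V) (eta : V -> R) (t : R) :
  (forall i, (i < m)%N -> connected_set (H i)) ->
  (forall i j, (i < m)%N -> (j < m)%N -> i != j -> [disjoint H i & H j]) ->
  (forall i, (i < m)%N -> c i \in Pi /\ H i :&: Pi = [set c i]) ->
  connected_set Pi -> v \in Pi ->
  t < (\sum_(u in Pi | [forall i : 'I_m, u != c i]) eta u
       + \sum_(i < m) (\sum_(w in H i) eta w) / #|H i|%:R) / #|Pi|%:R ->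
  exists2 s, all (legal_move adj) s & t < final_profile eta s v.
Proof.
move=> connH disH cPi connPi vPi; set Q := _ + _ => tQ.
have Pi0 : 0 < #|Pi|%:R :> R by rewrite ltr0n card_gt0; apply/set0Pn; exists v.
(* [m] errors come from the first stage and one from the second; the remaining one makes the
   inequality strict. *)
pose eps := (Q / #|Pi|%:R - t) / (m.+2%:R).
have e0 : 0 < eps by rewrite divr_gt0 // subr_gt0.
have [s [ls so sf]] := flatten_family eta e0 connH disH.
have [s' [ls' _ sf']] := flatten_set connPi (final_profile eta s) e0.
exists (s ++ s'); first by rewrite all_cat ls.
rewrite final_profile_cat; apply: lt_le_trans (sf' v vPi).
have cH i : (i < m)%N -> c i \in H i.
  by move=> /cPi[_ E]; have := set11 (c i); rewrite -E inE => /andP[].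
have c_inj (i j : 'I_m) : c i = c j -> i = j.
  move=> cij; apply/eqP; apply: contraT => ij.
  have /pred0P/(_ (c i)) := disH _ _ (ltn_ord i) (ltn_ord j) ij.
  by rewrite /= {2}cij !cH.
have lower : Q - m%:R * eps <= \sum_(w in Pi) final_profile eta s w.
  rewrite [leRHS](bigID (fun u => [forall i : 'I_m, u != c i])) /= -addrA; apply: lerD.
    apply: ler_sum => u /andP[uPi /forallP uc]; rewrite so // => i im.
    apply/negP => ui; have [_ E] := cPi i im.
    have : u \in H i :&: Pi by rewrite inE ui.
    by rewrite E inE; have := uc (Ordinal im) => /= /negbTE->.
  have -> : \sum_(w in Pi | ~~ [forall i : 'I_m, w != c i]) final_profile eta s w
     = \sum_(i < m) final_profile eta s (c i).
    rewrite -(big_imset (h := fun i : 'I_m => c i) (A := predT) (final_profile eta s)) /=.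
      apply: eq_bigl => w; rewrite negb_forall; apply/andP/imsetP.
        by move=> [_ /existsP[i]]; rewrite negbK => /eqP->; exists i.
      move=> [i _ ->]; split; first by case: (cPi i (ltn_ord i)).
      by apply/existsP; exists i; rewrite negbK.
    by move=> i j _ _; exact: c_inj.
  rewrite mulr_natl -[m in X in - X]card_ord -sumr_const -sumrB.
  by apply: ler_sum => i _; apply: sf; rewrite ?cH.
have Q1 : (Q - m%:R * eps) / #|Pi|%:R <= (\sum_(w in Pi) final_profile eta s w) / #|Pi|%:R.
  by apply: ler_wpM2r => //; rewrite invr_ge0.
have Q2 : Q / #|Pi|%:R - m%:R * eps <= (Q - m%:R * eps) / #|Pi|%:R.
  rewrite mulrBl lerD2l lerN2 ler_piMr //; first by rewrite mulr_ge0 // ltW.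
  by rewrite invf_le1 // ler1n -(ltr0n R).
have Q3 : t < Q / #|Pi|%:R - m%:R * eps - eps.
  have E : Q / #|Pi|%:R - t = m.+2%:R * eps by rewrite /eps [RHS]mulrC divfK ?pnatr_eq0.
  by clearbody eps; move: E e0; rewrite -2!natr1 !mulrDl !mul1r; lra.
lra.
Qed.

Lemma kappa_le (eta : V -> R) v c :
  (forall s, all (legal_move adj) s -> final_profile eta s v <= c) ->
  kappa adj eta v <= c.
Proof.
move=> H; apply: ge_sup; first by exists (eta v); exists [::].
by move=> _ [s ls ->]; exact: H.
Qed.

(** Nonnegative levels never exceed the total amount of water, so the set of achievable values is
    bounded and [sup] is a true supremum. *)
Lemma kappa_gt (eta : V -> R) v c s : (forall u, 0 <= eta u) ->
  all (legal_move adj) s -> c < final_profile eta s v -> c < kappa adj eta v.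
Proof.
move=> eta0 ls cs; apply: lt_le_trans cs _; apply: ub_le_sup; last by exists s.
exists (\sum_u eta u) => _ [t lt ->]; apply: final_profile_le => // u.
by rewrite (bigD1 u) //= lerDl sumr_ge0.
Qed.

End Moves.

Local Close Scope ring_scope.

(** * The network *)

(* Spine vertex i, cell k of position p, and vertex t of spider h. *)
Inductive vkind := Sp of nat | Cl of nat & nat | Ln of nat & nat.

Definition vkind_code (a : vkind) : nat * nat * nat :=
  match a with Sp i => (0, i, 0) | Cl p k => (1, p, k) | Ln h t => (2, h, t) end.

Definition vkind_decode (c : nat * nat * nat) : vkind :=
  match c with (0, i, _) => Sp i | (1, p, k) => Cl p k | (_, h, t) => Ln h t end.

Lemma vkind_codeK : cancel vkind_code vkind_decode. Proof. by case. Qed.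

HB.instance Definition _ := Equality.copy vkind (can_type vkind_codeK).

Section Kinds.
Variables (M D L : nat) (st sg fl : nat -> bool) (ce nx : nat -> nat).

(* The middle t = D of a line of length 2 * D is joined by a leg of length L to
   the centre. *)
Definition spider_size := (2 * D + L).+1.

(* Choices of a path: a truth value of p in layer p, the opposite value in layer
   M + p, and a literal p of the clause ending at ce p in layer 2 * M + ce p, or
   kind 6 if no clause ends there.  The value 3 * M means no layer. *)
Definition layer (p k : nat) : nat :=
  if k < 2 then p else if k < 4 then M + p
  else if k == 4 then (if st p then 2 * M + ce p else 3 * M)
  else if k == 5 then 3 * M else 2 * M + p.

(* [odd h] is the value that the centre stands for; leaf1 forbids
   a p && ~~ a (nx p), and leaf2 the choice of a literal falsified by that value. *)
Definition hub_var (h : nat) : nat := if odd h then h./2 else nx h./2.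
Definition center (h : nat) : vkind := Cl (hub_var h) (odd h).
Definition leaf1 (h : nat) : vkind := Cl h./2 (2 + odd h).
Definition leaf2 (h : nat) : vkind :=
  Cl (hub_var h) (if odd h == sg (hub_var h) then 5 else 4).

Definition valid (a : vkind) : bool :=
  match a with
  | Sp i => i <= 3 * M
  | Cl p k => (p < M) && (k < 7)
  | Ln h t => (h < 2 * M) && (t < spider_size)
  end.

Definition link (a b : vkind) : bool :=
  match a, b with
  | Cl p k, Sp i => (layer p k < 3 * M) && ((i == layer p k) || (i == (layer p k).+1))
  | Cl p k, Ln h t =>
      [|| (a == leaf1 h) && (t == 0), (a == leaf2 h) && (t == 2 * D)
        | (a == center h) && (t == 2 * D + L)]
  | Ln h s, Ln h' t => [&& h == h', 0 < t & s == if t.-1 == 2 * D then D else t.-1]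
  | _, _ => false
  end.

Definition kadj (a b : vkind) : bool := link a b || link b a.

(** The distance assigned to a cell on no layer, where [layer] is 3 * M, and the cap for all
    distances. *)
Definition max_dist := (6 * M).+1.

Definition cell_dist (p k : nat) : nat := (layer p k).*2.+1.

(** Not the graph distance, but 1-Lipschitz: as [D] and [L] are at least [max_dist], each arm of a
    spider has reached the cap where the arms meet, whatever the distances of its three cells
    are. *)
Definition dist (a : vkind) : nat :=
  match a with
  | Sp i => i.*2
  | Cl p k => cell_dist p k
  | Ln h t =>
    if t <= 2 * D then
      minn max_dist
        (minn (cell_dist h./2 (2 + odd h) + 1 + t)
           (cell_dist (hub_var h) (if odd h == sg (hub_var h) then 5 else 4)
             + 1 + (2 * D - t)))
    else minn max_dist (cell_dist (hub_var h) (odd h) + L + 1 - (t - 2 * D))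
  end.

Definition kmain (a : vkind) : bool :=
  match a with Sp i => i <= 3 * M | Cl p k => layer p k < 3 * M | Ln _ _ => false end.

Hypothesis M_gt0 : 0 < M.
Hypothesis ce_lt : forall p, st p -> p < M -> ce p < M.
Hypothesis nx_lt : forall p, p < M -> nx p < M.
Hypothesis nx_inj : forall p q, p < M -> q < M -> nx p = nx q -> p = q.

Lemma layer_le p k : p < M -> layer p k <= 3 * M.
Proof.
move=> pM; rewrite /layer; do 2?[case: ifP => _; first by lia].
case: ifP => _; last by case: ifP; lia.
by case: ifP => sp; [have := ce_lt sp pM; lia|lia].
Qed.

Lemma cell_dist_le p k : p < M -> cell_dist p k <= max_dist.
Proof. by move=> pM; have := layer_le k pM; rewrite /cell_dist /max_dist; lia. Qed.

Lemma hub_var_lt h : h < 2 * M -> hub_var h < M.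
Proof.
move=> hM; have h2 : h./2 < M by lia.
by rewrite /hub_var; case: ifP => // _; exact: nx_lt.
Qed.

Lemma valid_center h : h < 2 * M -> valid (center h).
Proof. by move=> hM; rewrite /= hub_var_lt //; case: odd. Qed.

Lemma valid_leaf1 h : h < 2 * M -> valid (leaf1 h).
Proof. by move=> hM; rewrite /=; case: odd; lia. Qed.

Lemma valid_leaf2 h : h < 2 * M -> valid (leaf2 h).
Proof. by move=> hM; rewrite /= hub_var_lt //; case: ifP. Qed.

Lemma hub_inj h h' : h < 2 * M -> h' < 2 * M -> odd h = odd h' ->
  hub_var h = hub_var h' -> h = h'.
Proof.
move=> hM hM' o E; suff : h./2 = h'./2.
  by move=> H; rewrite -(odd_double_half h) -(odd_double_half h') o H.
move: E; rewrite /hub_var o; case: odd => // /nx_inj-> //; lia.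
Qed.

Lemma center_inj h h' : h < 2 * M -> h' < 2 * M -> center h = center h' -> h = h'.
Proof.
move=> hM hM' [E1 E2]; apply: hub_inj => //.
by move: E2; case: odd; case: odd.
Qed.

Lemma leaf1_inj h h' : leaf1 h = leaf1 h' -> h = h'.
Proof.
move=> [E1 E2]; rewrite -(odd_double_half h) -(odd_double_half h') E1.
by move: E2; case: odd; case: odd.
Qed.

Lemma leaf2_inj h h' : h < 2 * M -> h' < 2 * M -> leaf2 h = leaf2 h' -> h = h'.
Proof.
move=> hM hM' [E1 E2]; apply: hub_inj => //.
by move: E2; rewrite E1; case: odd; case: odd; case: sg.
Qed.

Lemma center_leaf1 h h' : center h <> leaf1 h'.
Proof. by move=> [_]; case: odd; case: odd. Qed.

Lemma center_leaf2 h h' : center h <> leaf2 h'.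
Proof. by move=> [_]; case: odd; case: ifP. Qed.

Lemma leaf1_leaf2 h h' : leaf1 h <> leaf2 h'.
Proof. by move=> [_]; case: odd; case: ifP. Qed.

Hypothesis D_large : max_dist <= D.
Hypothesis L_large : max_dist <= L.

Lemma dist_le a : valid a -> dist a <= max_dist.
Proof.
case: a => [i|p k|h t] /=; first by rewrite /max_dist; lia.
  by case/andP => pM _; exact: cell_dist_le.
by move=> _; case: ifP => _; rewrite geq_minl.
Qed.

Lemma dist_link a b : valid a -> valid b -> link a b ->
  dist a <= (dist b).+1 /\ dist b <= (dist a).+1.
Proof.
case: a b => [i|p k|h s] [j|p' k'|h' t] //=.
  by move=> _ _ /andP[_ /orP[]/eqP->]; rewrite /cell_dist; lia.
- move=> /andP[pM _] /andP[hM tZ].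
  have c1 := cell_dist_le k pM.
  have c2 := cell_dist_le (if odd h' == sg (hub_var h') then 5 else 4) (hub_var_lt hM).
  have c3 : cell_dist h'./2 (2 + odd h') <= max_dist by apply: cell_dist_le; lia.
  case/or3P => /andP[/eqP[Ep Ek] /eqP->].
  + by rewrite leq0n -Ek -Ep; lia.
  + by rewrite leqnn -Ek -Ep; lia.
  + have -> : (2 * D + L <= 2 * D) = false by have : 0 < max_dist by []; lia.
    by rewrite -Ek -Ep; lia.
move=> /andP[hM sZ] /andP[_ tZ] /and3P[/eqP-> t0 /eqP->].
set d1 := cell_dist _ _; set d2 := cell_dist _ _; set d3 := cell_dist _ _.
have : 0 < max_dist by [].
by case: eqP => E; case: ifP; case: ifP; lia.
Qed.

(** A vertex of a spider next to a cell is at least as far from the source as that cell: spiders are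
    no short cuts. *)
Lemma main_adj a b : valid a -> valid b -> kadj a b -> kmain b ->
  dist b = (dist a).+1 -> kmain a.
Proof.
move=> va vb /orP[ab|ba] mb.
  case: a b va vb mb ab => [i|p k|h s] [j|p' k'|h' t] //=.
  by move=> _ _ _ /andP[].
case: b a vb va mb ba => [i|p k|h s] [j|p' k'|h' t] //=.
move=> /andP[pM _] /andP[hM tZ] mp.
have c1 := cell_dist_le k pM.
have c2 := cell_dist_le (if odd h' == sg (hub_var h') then 5 else 4) (hub_var_lt hM).
have c3 : cell_dist h'./2 (2 + odd h') <= max_dist by apply: cell_dist_le; lia.
case/or3P => /andP[/eqP[Ep Ek] /eqP->].
+ by rewrite leq0n -Ek -Ep; lia.
+ by rewrite leqnn -Ek -Ep; lia.
+ have -> : (2 * D + L <= 2 * D) = false by have : 0 < max_dist by []; lia.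
  by rewrite -Ek -Ep; lia.
Qed.

End Kinds.

Local Open Scope ring_scope.

Section Counting.

Lemma sum_le_card m (f : nat -> nat) : (forall i, (i < m)%N -> (f i <= 1)%N) ->
  (\sum_(i < m) f i <= m)%N.
Proof.
move=> H; rewrite -[leqRHS]card_ord -sum1_card; apply: leq_sum => i _; exact: H.
Qed.

Lemma sum_saturated m (f : nat -> nat) : (forall i, (i < m)%N -> (f i <= 1)%N) ->
  (m <= \sum_(i < m) f i)%N -> forall i, (i < m)%N -> f i = 1%N.
Proof.
elim: m => // m IH H; rewrite big_ord_recr => le i.
have {}le : (m < \sum_(i < m) f i + f m)%N := le.
have le1 : (\sum_(i < m) f i <= m)%N by apply: sum_le_card => j /ltnW; exact: H.
have lem : (f m <= 1)%N by exact: H.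
rewrite ltnS leq_eqVlt => /orP[/eqP->|im]; first by clear -le le1 lem; lia.
by apply: IH => // [j /ltnW|]; [exact: H|clear -le lem; lia].
Qed.

Lemma sum_bool_le1 (I : finType) (f : I -> bool) :
  (forall i j, f i -> f j -> i = j) -> (\sum_i f i <= 1)%N.
Proof.
move=> H.
have [i fi|f0] := pickP f; last by rewrite big1 // => i _; rewrite f0.
rewrite (bigD1 i) //= fi big1 // => j ji.
by case fj : (f j) => //; rewrite (H _ _ fj fi) eqxx in ji.
Qed.

Lemma sum_bool_ex (I : finType) (f : I -> bool) : (0 < \sum_i f i)%N -> exists i, f i.
Proof.
move=> H; apply/existsP; apply: contraTT H; rewrite negb_exists => /forallP H.
by rewrite big1 // => i _; rewrite (negbTE (H i)).
Qed.

(** The product is smallest when all values from 2 to [m] occur, and then it telescopes. *)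
Lemma inj_decay (R : realType) (V : finType) (C : {set V}) (f : V -> nat) m :
  {in C &, injective f} -> (0 < m)%N -> (forall u, u \in C -> (2 <= f u <= m)%N) ->
  2 / m.+1%:R <= \prod_(u in C) decay R (f u).
Proof.
move=> inj m0 fm; pose F u : 'I_m.+1 := inord (f u).
have FE u : u \in C -> F u = f u :> nat.
  by move=> /fm /andP[_ um]; rewrite /F inordK.
have -> : \prod_(u in C) decay R (f u) = \prod_(i in [set F u | u in C]) decay R i.
  rewrite big_imset /=; last first.
    by move=> u v uC vC /(congr1 val); rewrite /= !FE //; exact: inj.
  by apply: eq_bigr => u uC; rewrite FE.
have tele k : \prod_(2 <= i < k.+2) decay R i = 2 / k.+2%:R.
  elim: k => [|k IH]; first by rewrite big_geq // divff // pnatr_eq0.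
  rewrite big_nat_recr //= IH /decay mulrA mulfVK // pnatr_eq0 //.
have -> : 2 / m.+1%:R = \prod_(i < m.+1 | (2 <= i)%N) decay R i.
  have := tele m.-1; rewrite prednK // => <-.
  by rewrite big_geq_mkord.
rewrite (bigID (fun i : 'I_m.+1 => i \in [set F u | u in C])) /=.
rewrite [X in X * _](eq_bigl (fun i => i \in [set F u | u in C])).
  apply: ler_piMr; first by apply: prodr_ge0 => i _; exact: decay_ge0.
  by apply: prodr_ile1 => i _; rewrite decay_ge0 decay_le1.
move=> i; rewrite andb_idl // => /imsetP[u uC ->]; rewrite FE //.
by case/andP: (fm u uC).
Qed.

End Counting.

(** * The potential of the cells *)

Section Network.
Variables (M D L : nat) (st sg fl : nat -> bool) (ce nx : nat -> nat).
Hypothesis M_gt0 : (0 < M)%N.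
Hypothesis ce_lt : forall p, st p -> (p < M)%N -> (ce p < M)%N.
Hypothesis nx_lt : forall p, (p < M)%N -> (nx p < M)%N.
Hypothesis nx_inj : forall p q, (p < M)%N -> (q < M)%N -> nx p = nx q -> p = q.
Hypothesis D_large : (max_dist M <= D)%N.
Hypothesis L_large : (max_dist M <= L)%N.

Local Notation layer := (layer M st ce).
Local Notation hub_var := (hub_var nx).
Local Notation center := (center nx).
Local Notation leaf2 := (leaf2 sg nx).
Local Notation valid := (valid M D L).
Local Notation kadj := (kadj M D L st sg ce nx).
Local Notation kmain := (kmain M st ce).
Local Notation kdist := (dist M D L st sg ce nx).

Variables (V : finType) (kind : V -> vkind) (vtx : vkind -> V).
Hypothesis kind_valid : forall u, valid (kind u).
Hypothesis vtxK : forall a, valid a -> kind (vtx a) = a.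
Hypothesis kind_inj : injective kind.

Definition vadj : rel V := fun u v => kadj (kind u) (kind v).

Variable R : realType.
Variable T : R.
Hypothesis T_ge0 : 0 <= T.

Definition leaf (h : nat) (j : bool) : vkind := if j then leaf1 h else leaf2 h.

(* Distance to the j-th leaf inside the hub; [None] stands for infinity. *)
Definition hub_dist (h : nat) (j : bool) (a : vkind) : option nat :=
  match a with
  | Sp _ => None
  | Cl _ _ => if a == center h then Some (D + L + 2)%N
              else if a == leaf h j then Some 0%N else None
  | Ln h' t => if h' == h then Some
      (if (t <= 2 * D)%N then (if j then t.+1 else (2 * D - t).+1) else (D + 1 + (t - 2 * D)))%N
      else None
  end.

Definition hub_decay (h : nat) (j : bool) (a : vkind) : R :=
  if hub_dist h j a is Some m then decay R m else 1.

Definition hub_prod (h : nat) (j : bool) (A : {set V}) : R :=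
  setprod (fun u => hub_decay h j (kind u)) A.

(** The filled cells of kind 6 belong to no spider and have only spine vertices as neighbours, so an
    indicator can replace a product. *)
Definition source_cell (A : {set V}) (e : nat) : bool := ~~ fl e && (vtx (Cl e 6) \in A).

Definition GG (A : {set V}) : R :=
  T * (\sum_(h < 2 * M) \sum_(j : bool) (1 - hub_prod h j A))
  + T * (\sum_(e < M) source_cell A e)%:R.

(** Where a clause ends, the cell of kind 6 is present but empty: it keeps its layer connected for
    every formula, and a path through it collects nothing there. *)
Definition water (a : vkind) : nat :=
  if a is Cl p k then (if (k < 2)%N then 0 else if (k < 6)%N then 1 else ~~ fl p)%N else 0%N.

Lemma hub_decay01 h j a : 0 <= hub_decay h j a <= 1.
Proof.
by rewrite /hub_decay; case: hub_dist => [m|]; rewrite ?decay_ge0 ?decay_le1 ?ler01 ?lexx.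
Qed.

Lemma hub_prod_range h j A : 0 <= hub_prod h j A <= 1.
Proof.
rewrite /hub_prod setprod_ge0; last by move=> u; case/andP: (hub_decay01 h j (kind u)).
by rewrite setprod_le1 // => u; exact: hub_decay01.
Qed.

Lemma leaf_neq_center h h' j : (leaf h j == center h') = false.
Proof.
apply/eqP; case: j => /esym; [exact: center_leaf1|exact: center_leaf2].
Qed.

Lemma valid_leaf h j : (h < 2 * M)%N -> valid (leaf h j).
Proof. by case: j => hM; [exact: valid_leaf1|apply: (valid_leaf2 (M := M))]. Qed.

Lemma leaf_inj h h' j j' : (h < 2 * M)%N -> (h' < 2 * M)%N ->
  leaf h j = leaf h' j' -> h = h' /\ j = j'.
Proof.
case: j j' => [] [] hM hM'.
- by move=> /leaf1_inj.
- by move=> /leaf1_leaf2.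
- by move=> /esym /leaf1_leaf2.
- by move=> H; split=> //; exact: (leaf2_inj M_gt0 nx_inj hM hM' H).
Qed.

Let slack_fac h j a b := 1 + hub_decay h j a * hub_decay h j b - 2 * hub_decay h j b.

Lemma hub_prod_split h j (A : {set V}) x y : y \in A -> x \notin A ->
  hub_prod h j (A :\ y) + hub_prod h j (x |: A) =
  2 * hub_prod h j A + hub_prod h j (A :\ y) * slack_fac h j (kind x) (kind y).
Proof.
by move=> yA xA; rewrite /hub_prod setprodU1 // (setprodD1 _ yA) /slack_fac; ring.
Qed.

Lemma slack_None h j a b : hub_dist h j a = None -> 0 <= slack_fac h j a b.
Proof.
move=> E; rewrite /slack_fac {1}/hub_decay E mul1r.
by have := hub_decay01 h j b; lra.
Qed.

Lemma slack_Some h j a b c d : hub_dist h j a = Some c -> hub_dist h j b = Some d ->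
  (d <= c.+1)%N -> 0 <= slack_fac h j a b.
Proof.
move=> Ea Eb dc; rewrite /slack_fac /hub_decay Ea Eb; exact: slack_ge0.
Qed.

Lemma slack_zero h j a b : hub_dist h j b = Some 0%N -> 0 <= slack_fac h j a b.
Proof.
by move=> E; rewrite /slack_fac [hub_decay h j b]/hub_decay E /decay mul0r !mulr0 addr0 subr0.
Qed.

Lemma hub_dist_leaf h h' j j' : (h < 2 * M)%N -> (h' < 2 * M)%N ->
  hub_dist h j (leaf h' j') = if (h' == h) && (j' == j) then Some 0%N else None.
Proof.
move=> hM hM'; have E : hub_dist h j (leaf h' j') =
  if leaf h' j' == center h then Some (D + L + 2)%N
  else if leaf h' j' == leaf h j then Some 0%N else None by case: j'.
rewrite E leaf_neq_center; case: eqP => [/(leaf_inj hM' hM)[-> ->]|ne].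
  by rewrite !eqxx.
by case: ifP => // /andP[/eqP E1 /eqP E2]; case: ne; rewrite E1 E2.
Qed.

Lemma hub_prod_leaf h j (A : {set V}) : (h < 2 * M)%N -> vtx (leaf h j) \in A ->
  hub_prod h j A = 0.
Proof.
move=> hM lA; rewrite /hub_prod (setprod_eq0 lA) // vtxK ?valid_leaf //.
by rewrite /hub_decay hub_dist_leaf // !eqxx /= /decay mul0r.
Qed.

Lemma hub_dist_center h h' j : (h < 2 * M)%N -> (h' < 2 * M)%N ->
  hub_dist h j (center h') = if h' == h then Some (D + L + 2)%N else None.
Proof.
move=> hM hM'; rewrite /hub_dist /center -/(center h') -/(center h).
rewrite [center h' == leaf h j]eq_sym leaf_neq_center.
case: eqP => [E|ne]; first by rewrite (center_inj M_gt0 nx_inj hM' hM E) eqxx.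
by case: eqP => // E; case: ne; rewrite E.
Qed.

Lemma attachment p k h t : link M D L st sg ce nx (Cl p k) (Ln h t) ->
  (exists j, Cl p k = leaf h j /\ t = (if j then 0 else 2 * D)%N) \/
  (Cl p k = center h /\ t = (2 * D + L)%N).
Proof.
case/or3P => /andP[/eqP-> /eqP->]; last by right.
  by left; exists true.
by left; exists false.
Qed.

Definition spinal (a : vkind) : bool := if a is Sp _ then true else false.

Lemma hub_slack_attach h j a b h' t : (h < 2 * M)%N -> (h' < 2 * M)%N ->
  (exists i, a = leaf h' i /\ t = (if i then 0 else 2 * D)%N) \/
    (a = center h' /\ t = (2 * D + L)%N) -> b = Ln h' t ->
  0 <= slack_fac h j a b /\
  (0 <= slack_fac h j b a \/ (a = leaf h (~~ j) /\ b = Ln h (if j then 2 * D else 0)%N)).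
Proof.
move=> hM hM' at_a ->.
have L0 : (2 * D + L <= 2 * D)%N = false.
  by move: (leq_trans (ltn0Sn _) L_large); clear; lia.
have [E|ne] := eqVneq h' h; last first.
  have Ea : hub_dist h j a = None.
    by case: at_a => [[i [-> _]]|[-> _]]; rewrite ?hub_dist_leaf ?hub_dist_center // (negbTE ne).
  by split; [|left]; apply: slack_None => //=; rewrite (negbTE ne).
rewrite {}E {h' hM'} in at_a *.
have Eb : hub_dist h j (Ln h t) = Some
    (if (t <= 2 * D)%N then (if j then t.+1 else (2 * D - t).+1) else (D + 1 + (t - 2 * D)))%N.
  by rewrite /= eqxx.
case: at_a => [[i [ae te]]|[ae te]].
  have Ea := hub_dist_leaf j i hM hM; rewrite -ae eqxx /= in Ea.
  have tD : (t <= 2 * D)%N by rewrite te; case: (i).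
  rewrite tD in Eb.
  have [ij|ij] := eqVneq i j.
    rewrite ij eqxx in Ea; split.
      apply: slack_Some Ea Eb _; rewrite te ij; case: (j) => //.
      by rewrite subnn.
    by left; exact: slack_zero.
  have {}ij : i = ~~ j by case: (i) (j) ij => [] [].
  rewrite ij (_ : (~~ j == j) = false) in Ea; last by case: (j).
  split; first exact: slack_None.
  by right; rewrite ae te ij; case: (j).
have Ea := hub_dist_center j hM hM; rewrite -ae eqxx in Ea.
rewrite te L0 in Eb; rewrite te; split; [|left].
  by apply: slack_Some Ea Eb _; clear; lia.
by apply: slack_Some Eb Ea _; clear; lia.
Qed.

(** The only harmful move replaces the other leaf, infinitely far from leaf [j], by the end of the
    line next to it, at distance 2D + 1. *)
Lemma hub_slack h j a b : (h < 2 * M)%N -> valid a -> valid b -> kadj a b ->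
  ~~ spinal a -> ~~ spinal b ->
  0 <= slack_fac h j a b \/
  (b = leaf h (~~ j) /\ a = Ln h (if j then 2 * D else 0)%N).
Proof.
move=> hM; case: a b => [//|p k|g s] [//|p' k'|g' t] va vb.
- by case/orP.
- case/orP => //= /attachment H _ _; left.
  by case/andP: vb => gM _; case: (hub_slack_attach j hM gM H erefl).
- case/orP => //= /attachment H _ _.
  by case/andP: va => gM _; case: (hub_slack_attach j hM gM H erefl).
- move=> H _ _; left.
  have [g_h|ne] := eqVneq g h; last by apply: slack_None; rewrite /= (negbTE ne).
  have gg : g = g' by case/orP: H => /and3P[/eqP->].
  rewrite -gg {gg} g_h in va vb H *.
  apply: slack_Some; rewrite /= ?eqxx //.
  case/orP: H => /and3P[_ t0 /eqP->]; move: t0; clear -vb va; case: eqP => E;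
    do ?case: ifP; lia.
Qed.

(* The line of a hub carries at most [1 / (D + 1)] of the product of the other
   potential once the end next to the removed leaf is absent. *)
Lemma hub_compare h j (C : {set V}) : (h < 2 * M)%N ->
  vtx (leaf h (~~ j)) \notin C -> vtx (Ln h (if j then 2 * D else 0)%N) \notin C ->
  hub_prod h j C / (2 * D).+2%:R <= hub_prod h (~~ j) C.
Proof.
move=> hM lC eC; have L0 : (0 < L)%N := leq_trans (ltn0Sn _) L_large.
pose on_line u := if kind u is Ln h' t then (h' == h) && (t <= 2 * D)%N else false.
pose f u := if kind u is Ln h' t then (if ~~ j then t.+1 else (2 * D - t).+1) else 0%N.
pose C' := [set u in C | on_line u].
have wE : 2 / (2 * D).+2%:R <= \prod_(u in C') decay R (f u).
  apply: inj_decay => [u v|//|u]; rewrite !inE /on_line /f.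
    move=> /andP[_ +] /andP[_ +] fuv; case Eu : (kind u) fuv => [//|//|g s] fuv.
    case Ev : (kind v) fuv => [//|//|g' t] fuv /andP[/eqP gh s2] /andP[/eqP gh' t2].
    apply: kind_inj; rewrite Eu Ev gh gh'; congr Ln.
    by move: fuv; clear -s2 t2; case: (~~ j); lia.
  move=> /andP[uC]; case Eu : (kind u) => [//|//|g s] /andP[/eqP gh s2].
  have : s != (if j then 2 * D else 0)%N.
    apply: contraNneq eC => <-; rewrite -gh -Eu.
    suff -> : vtx (kind u) = u by [].
    by apply: kind_inj; rewrite vtxK // kind_valid.
  by move: s2; clear; case: j => /=; lia.
pose w u : R := if on_line u then decay R (f u) else 1.
have fE u : on_line u -> hub_decay h (~~ j) (kind u) = decay R (f u).
  rewrite /on_line /f /hub_decay; case: (kind u) => // g s /andP[/eqP-> s2].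
  by rewrite /= eqxx s2.
(* Off the line the two distances agree, except at leaf [j], where the factor on the left is 0, and
   at the other leaf, which is not in [C]. *)
have dec : setprod (fun u => hub_decay h j (kind u) * w u) C <= hub_prod h (~~ j) C.
  apply: ler_prod => u uC; have /andP[d0 d1] := hub_decay01 h j (kind u).
  rewrite /w; have [ul|ul] := boolP (on_line u).
    rewrite fE // mulr_ge0 ?decay_ge0 //=.
    by apply: ler_piMl => //; exact: decay_ge0.
  rewrite mulr1 d0 /=; move: ul d1; rewrite /on_line.
  case Eu : (kind u) => [i|p k|g s] ul d1; first by rewrite /hub_decay.
    rewrite [leRHS]/hub_decay /=.
    case: eqP => [E|_]; first by rewrite /hub_decay /= E eqxx.
    case: eqP => [E|//].
    case/negP: lC; rewrite -E -Eu.
    suff -> : vtx (kind u) = u by [].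
    by apply: kind_inj; rewrite vtxK // kind_valid.
  rewrite /hub_decay /=; case: eqP ul => //= _; rewrite -ltnNge => s2.
  by rewrite leqNgt s2.
apply: le_trans dec; rewrite /setprod big_split /=; apply: ler_wpM2l.
  by case/andP: (hub_prod_range h j C).
have -> : \prod_(u in C) w u = \prod_(u in C') decay R (f u).
  rewrite (bigID on_line) /= [X in _ * X]big1 ?mulr1; last first.
    by move=> u /andP[_ ul]; rewrite /w (negbTE ul).
  apply: eq_big => u; first by rewrite inE.
  by move=> /andP[_ ul]; rewrite /w ul.
apply: le_trans wE; rewrite -[leLHS]mul1r; apply: ler_wpM2r; last by lra.
by rewrite invr_ge0.
Qed.

(** In the harmful case of [hub_slack] the product for [j] loses 1 / (2D + 2) of itself. The leaving
    leaf is at distance 0 for the other product, which gains its full value, and [hub_compare]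
    weighs the two. *)
Lemma hub_super h (A : {set V}) x y : (h < 2 * M)%N -> vadj x y -> y \in A -> x \notin A ->
  ~~ spinal (kind x) -> ~~ spinal (kind y) ->
  2 * \sum_(j : bool) hub_prod h j A <=
  \sum_(j : bool) hub_prod h j (A :\ y) + \sum_(j : bool) hub_prod h j (x |: A).
Proof.
move=> hM xy yA xA sx sy; rewrite -big_split mulr_sumr /=.
rewrite [leRHS](eq_bigr (fun j => 2 * hub_prod h j A
   + hub_prod h j (A :\ y) * slack_fac h j (kind x) (kind y))); last first.
  by move=> j _; rewrite hub_prod_split.
rewrite big_split /= lerDl.
have ge0 j (C : {set V}) : 0 <= hub_prod h j C by case/andP: (hub_prod_range h j C).
have sl j := hub_slack j hM (kind_valid x) (kind_valid y) xy sx sy.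
have [[j [Ey Ex]]|good] : (exists j, kind y = leaf h (~~ j) /\
     kind x = Ln h (if j then 2 * D else 0)%N) \/
   (forall j, 0 <= slack_fac h j (kind x) (kind y)).
- case: (sl true) => [s1|b]; last by left; exists true.
  case: (sl false) => [s2|b]; last by left; exists false.
  by right; case.
- have vx : vtx (kind x) = x by apply: kind_inj; rewrite vtxK // kind_valid.
  have vy : vtx (kind y) = y by apply: kind_inj; rewrite vtxK // kind_valid.
  have cmp := @hub_compare h j (A :\ y) hM.
  rewrite -Ex -Ey vx vy !inE eqxx (negbTE xA) andbF in cmp.
  have {}cmp := cmp isT isT.
  rewrite (bigD1 j) //= (bigD1 (~~ j)) /=; last by case: (j).
  rewrite big1 ?addr0; last by case: (j) => -[].
  have Dy : hub_dist h j (kind y) = None by rewrite Ey hub_dist_leaf // eqxx; case: (j).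
  have Dy' : hub_dist h (~~ j) (kind y) = Some 0%N by rewrite Ey hub_dist_leaf // !eqxx.
  have Dx : hub_dist h j (kind x) = Some (2 * D).+1.
    by rewrite Ex /= eqxx; case: (j); rewrite ?leqnn // leq0n subn0.
  rewrite /slack_fac /hub_decay Dy Dy' Dx.
  have -> : decay R 0 = 0 by rewrite /decay mul0r.
  rewrite decayE; move: cmp; move: (hub_prod h j _) (hub_prod h (~~ j) _) => P Q cmp.
  move: cmp; move: ((2 * D).+2%:R^-1) => z cmp.
  by rewrite !mulr0 addr0 subr0 !mulr1; lra.
- by apply: sumr_ge0 => j _; rewrite mulr_ge0.
Qed.

Lemma G_superharmonic (A : {set V}) x y : vadj x y -> y \in A -> x \notin A ->
  ~~ spinal (kind x) -> ~~ spinal (kind y) -> superharmonic_at GG A x y.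
Proof.
move=> xy yA xA sx sy; rewrite /superharmonic_at /GG.
have S1 : \sum_(h < 2 * M) \sum_(j : bool) (1 - hub_prod h j (A :\ y)) +
   \sum_(h < 2 * M) \sum_(j : bool) (1 - hub_prod h j (x |: A)) <=
   2 * \sum_(h < 2 * M) \sum_(j : bool) (1 - hub_prod h j A).
  rewrite mulr_sumr -big_split; apply: ler_sum => h _ /=.
  rewrite !sumrB; have := hub_super (ltn_ord h) xy yA xA sx sy; lra.
have no6 u v e : vadj u v -> ~~ spinal (kind u) -> ~~ spinal (kind v) ->
    (e < M)%N -> vtx (Cl e 6) != v.
  move=> uv su sv eM; apply/eqP => E; have : kind v = Cl e 6 by rewrite -E vtxK //= eM.
  move: uv su; rewrite /vadj => + + Ev; rewrite Ev; case: (kind u) => //= h t.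
  case/orP => // /or3P[]/andP[/eqP[_ +] _] _.
  - by case: odd.
  - by case: ifP.
  - by case: odd.
have yx : vadj y x by rewrite /vadj /kadj orbC.
have S2 (C : {set V}) : (forall u, u != x -> u != y -> (u \in C) = (u \in A)) ->
   (\sum_(e < M) source_cell C e = \sum_(e < M) source_cell A e)%N.
  move=> H; apply: eq_bigr => e _; rewrite /source_cell H //.
    by apply: no6 yx _ _ _.
  by apply: no6 xy _ _ _.
rewrite (S2 (A :\ y)); last by move=> u _ uy; rewrite !inE uy.
rewrite (S2 (x |: A)); last by move=> u ux _; rewrite !inE (negbTE ux).
have := ler_wpM2l T_ge0 S1; rewrite mulrDr mulrCA; lra.
Qed.

(** An injection of the [M] positions into themselves is onto, so every cell of kind 0 or 1 is the
    centre of a spider. *)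
Lemma hub_surj p b : (p < M)%N -> exists h, [/\ (h < 2 * M)%N, hub_var h = p & odd h = b].
Proof.
move=> pM; case: b.
  exists p.*2.+1; split; first by clear -pM; lia.
    by rewrite /hub_var /= odd_double /= uphalf_double.
  by rewrite /= odd_double.
pose g (i : 'I_M) : 'I_M := Ordinal (nx_lt (ltn_ord i)).
have g_inj : injective g.
  by move=> i j [] /nx_inj H; apply/val_inj/H.
pose i := invF g_inj (Ordinal pM).
have E : nx i = p by have := f_invF g_inj (Ordinal pM) => /(congr1 val).
exists i.*2; split; first by have := ltn_ord i; clear; lia.
  by rewrite /hub_var odd_double doubleK.
by rewrite odd_double.
Qed.

Lemma leaf_surj p k : (p < M)%N -> (1 < k < 6)%N -> exists h j, (h < 2 * M)%N /\ leaf h j = Cl p k.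
Proof.
move=> pM /andP[k1 k6].
have [|k4] := ltnP k 4.
  move=> k4; exists (p.*2 + (k == 3%N))%N, true; split.
    by case: (k == _); clear -pM; lia.
  rewrite /leaf /leaf1 halfD oddD odd_double /= doubleK.
  have : (k == 2%N) || (k == 3%N) by clear -k1 k4; lia.
  by case/orP => /eqP->; rewrite ?addn0.
have [h [hM hp ho]] := hub_surj (sg p == (k == 5%N)) pM.
exists h, false; split=> //; rewrite /leaf /leaf2 hp ho.
have : (k == 4%N) || (k == 5%N) by clear -k6 k4; lia.
by case/orP => /eqP->; case: (sg p).
Qed.

Lemma vtx_kind u : vtx (kind u) = u.
Proof. by apply: kind_inj; rewrite vtxK // kind_valid. Qed.

Lemma water_le (A : {set V}) : (\sum_(u in A) water (kind u) <=
  \sum_(h < 2 * M) \sum_(j : bool) (vtx (leaf h j) \in A) + \sum_(e < M) source_cell A e)%N.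
Proof.
have mem_sum v : ((v \in A) = \sum_(u in A) (u == v) :> nat)%N.
  have [vA|vA] := boolP (v \in A); last first.
    by rewrite big1 // => u uA; case: eqP => // E; rewrite E (negbTE vA) in uA.
  by rewrite (bigD1 v) //= eqxx big1 // => u /andP[_ /negbTE->].
rewrite (eq_bigr (fun h : 'I_(2 * M) => \sum_(u in A) \sum_(j : bool) (u == vtx (leaf h j))))%N;
  last by move=> h _; rewrite exchange_big; apply: eq_bigr => j _; exact: mem_sum.
rewrite exchange_big /=.
rewrite (eq_bigr (fun e : 'I_M => \sum_(u in A) ~~ fl e && (u == vtx (Cl e 6))))%N; last first.
  move=> e _; rewrite /source_cell; case: (fl e) => /=; last exact: mem_sum.
  by rewrite big1.
rewrite [X in (_ <= _ + X)%N]exchange_big -big_split; apply: leq_sum => u _ /=.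
have := kind_valid u; case Eu : (kind u) => [//|p k|//] /= /andP[pM k7].
case: ifP => // k2; case: ifP => k6.
  have [|h [j [hM lE]]] := leaf_surj (k := k) pM; first by clear -k2 k6; lia.
  apply: leq_trans (leq_addr _ _).
  rewrite (bigD1 (Ordinal hM)) //= (bigD1 j) //= lE -Eu vtx_kind eqxx; clear; lia.
apply: leq_trans (leq_addl _ _).
have k_6 : k = 6%N by clear -k6 k7; lia.
rewrite (bigD1 (Ordinal pM)) //= -k_6 -Eu vtx_kind eqxx andbT; clear; lia.
Qed.

Definition tau (u : V) : R := T * (water (kind u))%:R.

Lemma tau_le_G (A : {set V}) : \sum_(u in A) tau u <= GG A.
Proof.
rewrite -mulr_sumr /GG -mulrDr; apply: ler_wpM2l => //.
rewrite -natr_sum; apply: (@le_trans _ _ ((\sum_(h < 2 * M) \sum_(j : bool) (vtx (leaf h j) \in A)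
   + \sum_(e < M) source_cell A e)%N%:R)).
  by rewrite ler_nat water_le.
rewrite natrD lerD2r natr_sum; apply: ler_sum => h _; rewrite natr_sum; apply: ler_sum => j _.
have [lA|_] := boolP (_ \in A); first by rewrite hub_prod_leaf // subr0.
by rewrite subr_ge0; case/andP: (hub_prod_range h j A).
Qed.

Lemma source_le (A : {set V}) : (\sum_(e < M) source_cell A e <= M)%N.
Proof. by apply: (@sum_le_card M (fun e => source_cell A e)) => e _; exact: leq_b1. Qed.

Lemma GG_range (A : {set V}) : 0 <= GG A <= 5%:R * M%:R * T.
Proof.
have r h j := hub_prod_range h j A.
have S0 : 0 <= \sum_(h < 2 * M) \sum_(j : bool) (1 - hub_prod h j A).
  by apply: sumr_ge0 => h _; apply: sumr_ge0 => j _; have := r h j; lra.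
have S1 : \sum_(h < 2 * M) \sum_(j : bool) (1 - hub_prod h j A) <= 4%:R * M%:R.
  apply: (@le_trans _ _ (\sum_(h < 2 * M) \sum_(j : bool) 1)).
    by apply: ler_sum => h _; apply: ler_sum => j _; have := r h j; lra.
  rewrite !sumr_const card_bool card_ord -mulrnA -[_ *+ _]/((2 * (2 * M))%:R).
  by rewrite mulnA natrM.
have S2 : (\sum_(e < M) source_cell A e)%:R <= M%:R :> R by rewrite ler_nat source_le.
have S3 : 0 <= (\sum_(e < M) source_cell A e)%:R :> R by [].
rewrite /GG -mulrDr mulr_ge0 ?addr_ge0 //= mulrC; apply: ler_wpM2r => //; lra.
Qed.

Lemma tau_total : \sum_u tau u <= 5%:R * M%:R * T.
Proof.
have -> : \sum_u tau u = \sum_(u in [set: V]) tau u by apply: eq_bigl => u; rewrite inE.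
by apply: le_trans (tau_le_G _) _; case/andP: (GG_range [set: V]).
Qed.

(** [fl] marks the ends of clauses and [ce p] is the end of the clause of the literal [p]. The
    implications become equalities where [nx] runs in cycles. *)
Definition csp : Prop := exists a : nat -> bool,
  (forall p, (p < M)%N -> a p -> a (nx p)) /\
  (forall e, (e < M)%N -> fl e -> exists p, [/\ (p < M)%N, st p, ce p = e & a p = sg p]).

(** * Spider ends seen by a path-like set *)

Section Sparse.
Variable A : {set V}.
Hypothesis spA : sparse (fun u => kdist (kind u)) (fun u => kmain (kind u)) A.

Let lf (h : nat) (j : bool) : bool := vtx (leaf h j) \in A.
Let ct (h : nat) : bool := vtx (center h) \in A.

Lemma sparse_main u : u \in A -> kmain (kind u).
Proof. by case/andP: spA => /forall_inP H _; exact: H. Qed.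

Lemma sparse_cells p k p' k' : valid (Cl p k) -> valid (Cl p' k') ->
  vtx (Cl p k) \in A -> vtx (Cl p' k') \in A -> layer p k = layer p' k' -> Cl p k = Cl p' k'.
Proof.
move=> va vb uA vA E; case/andP: spA => _ /forall_inP/(_ _ uA)/forall_inP/(_ _ vA).
rewrite !vtxK //= /cell_dist E eqxx /= odd_double /= => /eqP/(congr1 kind).
by rewrite !vtxK.
Qed.

Lemma leaf2_in h : (h < 2 * M)%N -> lf h false ->
  [/\ st (hub_var h), odd h != sg (hub_var h) & leaf2 h = Cl (hub_var h) 4].
Proof.
move=> hM lA; have := sparse_main lA; rewrite vtxK ?valid_leaf // /leaf /leaf2 /=.
case: eqP => [_|_]; first by rewrite /layer /= ltnn.
by rewrite /layer /=; case: st => //; rewrite ltnn.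
Qed.

Lemma center_unique h h' : (h < 2 * M)%N -> (h' < 2 * M)%N -> ct h -> ct h' ->
  hub_var h = hub_var h' -> h = h'.
Proof.
move=> hM hM' c c' E; apply: (center_inj M_gt0 nx_inj hM hM').
apply: sparse_cells c c' _; try exact: (valid_center (M := M)).
by rewrite /layer E; case: odd; case: odd.
Qed.

Lemma leaf2_unique h h' : (h < 2 * M)%N -> (h' < 2 * M)%N -> lf h false -> lf h' false ->
  ce (hub_var h) = ce (hub_var h') -> h = h'.
Proof.
move=> hM hM' c c' E; have [s1 _ e1] := leaf2_in hM c; have [s2 _ e2] := leaf2_in hM' c'.
apply: (leaf2_inj M_gt0 nx_inj (sg := sg) hM hM').
have v1 := valid_leaf false hM; have v2 := valid_leaf false hM'.
rewrite /lf /leaf e1 e2 in v1 v2 c c' *; apply: sparse_cells => //.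
by rewrite /layer /= s1 s2 E.
Qed.

(** Filled cells of layer M + p in [A]; [clause_count] does the same for layer 2 * M + e.
    [center_count] concerns layer p: is the end [j] of the spider centred there off the set? *)
Let imp_count (p : nat) : nat := (lf p.*2 true + lf p.*2.+1 true)%N.
Let clause_count (e : nat) : nat :=
  ((\sum_(h < 2 * M) (lf h false && (ce (hub_var h) == e))) + source_cell A e)%N.
Let center_count (j : bool) (p : nat) : nat :=
  (\sum_(h < 2 * M) [&& ct h, hub_var h == p & ~~ lf h j])%N.

Lemma imp_count_le p : (p < M)%N -> (imp_count p <= 1)%N.
Proof.
move=> pM; rewrite /imp_count /lf /leaf.
have [c1|] := boolP (_ \in A) => //; have [c2|] := boolP (vtx (leaf1 p.*2.+1) \in A) => //.
have E : Cl p 2 = Cl p 3.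
  apply: sparse_cells; rewrite /= ?pM //.
    by move: c1; rewrite /= /leaf1 odd_double doubleK.
  by move: c2; rewrite /leaf1 /= odd_double /= uphalf_double.
by [].
Qed.

Lemma clause_count_le e : (e < M)%N -> (clause_count e <= 1)%N.
Proof.
move=> eM; rewrite /clause_count /source_cell.
have [/andP[fe XA]|_] := boolP (_ && _); last first.
  rewrite addn0; apply: (sum_bool_le1 (f := fun h : 'I_(2 * M) => lf h false && (ce (hub_var h) == e))).
  move=> h h' /andP[l /eqP c] /andP[l' /eqP c']; apply/val_inj.
  exact: (leaf2_unique (ltn_ord h) (ltn_ord h') l l' (etrans c (esym c'))).
rewrite big1 // => h _; apply/eqP; rewrite eqb0; apply/negP => /andP[l /eqP c].
have [s1 _ e1] := leaf2_in (ltn_ord h) l.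
have v1 := valid_leaf false (ltn_ord h).
rewrite /lf /leaf e1 in v1 l.
have : Cl (hub_var h) 4 = Cl e 6.
  by apply: sparse_cells => //=; rewrite ?eM // /layer /= s1 c.
by [].
Qed.

Lemma center_count_le j p : (center_count j p <= 1)%N.
Proof.
apply: (sum_bool_le1 (f := fun h : 'I_(2 * M) => [&& ct h, hub_var h == p & ~~ lf h j])).
move=> h h' /and3P[c /eqP e _] /and3P[c' /eqP e' _]; apply/val_inj.
exact: (center_unique (ltn_ord h) (ltn_ord h') c c' (etrans e (esym e'))).
Qed.

Lemma sum_pairs (F : nat -> nat) m :
  (\sum_(h < 2 * m) F h = \sum_(p < m) (F p.*2 + F p.*2.+1))%N.
Proof.
rewrite mul2n; elim: m => [|m IH]; first by rewrite !big_ord0.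
by rewrite doubleS !big_ord_recr /= IH addnA.
Qed.

Lemma sum_indicator (b : bool) (x : nat) : (b -> (x < M)%N) ->
  (\sum_(e < M) (b && (x == e)) = b)%N.
Proof.
case: b => /= [xM|_]; last by rewrite big1.
rewrite (bigD1 (Ordinal (xM isT))) //= eqxx big1 // => i ne.
by case: eqP => // E; case/eqP: ne; apply/val_inj.
Qed.

(** [N1] counts filled cells inside [A], which are seen in full; [N2] counts ends outside [A], seen
    only through a centre in [A]. *)
Let N1 := (\sum_(h < 2 * M) \sum_(j : bool) lf h j + \sum_(e < M) source_cell A e)%N.
Let N2 := (\sum_(h < 2 * M) \sum_(j : bool) (~~ lf h j && ct h))%N.

Lemma N1E : N1 = (\sum_(p < M) imp_count p + \sum_(e < M) clause_count e)%N.
Proof.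
rewrite /N1 -(sum_pairs (fun h => lf h true)) [in RHS]big_split /= addnA; congr addn.
rewrite [X in (_ + X)%N]exchange_big /= -big_split; apply: eq_bigr => h _ /=.
rewrite big_bool /=; congr addn; apply/esym/sum_indicator => l.
by apply: ce_lt; [case: (leaf2_in (ltn_ord h) l)|exact: hub_var_lt].
Qed.

Lemma N2E : N2 = (\sum_(p < M) center_count true p + \sum_(p < M) center_count false p)%N.
Proof.
have E j : (\sum_(p < M) center_count j p = \sum_(h < 2 * M) (~~ lf h j && ct h))%N.
  rewrite exchange_big; apply: eq_bigr => h _ /=.
  rewrite -(@sum_indicator (~~ lf h j && ct h) (hub_var h)).
    apply: eq_bigr => p _; congr nat_of_bool.
    by case: (ct h); case: (lf h j); case: eqP.
  by move=> _; exact: hub_var_lt.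
rewrite !E /N2 -big_split; apply: eq_bigr => h _ /=.
by rewrite big_bool.
Qed.

(** Each layer contributes at most one to the counts. If both totals are maximal, every layer is
    used and no spider centred in [A] has an end in [A]; the centres then form an assignment without
    conflicts. *)
Lemma sparse_counts : [/\ (N1 <= 2 * M)%N, (N2 <= 2 * M)%N &
  (2 * M <= N1)%N -> (2 * M <= N2)%N -> csp].
Proof.
have i1 := sum_le_card imp_count_le.
have c1 := sum_le_card clause_count_le.
have n1 j := @sum_le_card M (center_count j) (fun p _ => center_count_le j p).
rewrite N1E N2E; split.
- by move: i1 c1; clear; lia.
- by move: (n1 true) (n1 false); clear; lia.
move=> h1 h2.
have imps : (M <= \sum_(p < M) imp_count p)%N by move: h1 i1 c1; clear; lia.
have clauses : (M <= \sum_(e < M) clause_count e)%N by move: h1 i1 c1; clear; lia.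
have ctr j : (M <= \sum_(p < M) center_count j p)%N.
  by move: h2 (n1 true) (n1 false); clear; case: j; lia.
have imp1 := sum_saturated imp_count_le imps.
have clause1 := sum_saturated clause_count_le clauses.
have ctr1 j := sum_saturated (fun p _ => center_count_le j p) (ctr j).
have chosen p : (p < M)%N -> exists h, [/\ (h < 2 * M)%N, hub_var h = p,
    odd h = (vtx (Cl p 1) \in A) & forall j, ~~ lf h j].
  move=> pM.
  have ex j : exists h : 'I_(2 * M), [&& ct h, hub_var h == p & ~~ lf h j].
    apply: (sum_bool_ex (f := fun h : 'I_(2 * M) => [&& ct h, hub_var h == p & ~~ lf h j])).
    by have := ctr1 j p pM; rewrite /center_count => ->.
  have [h /and3P[c /eqP e l]] := ex true; have [h' /and3P[c' /eqP e' l']] := ex false.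
  have hh : h = h' :> nat := center_unique (ltn_ord h) (ltn_ord h') c c' (etrans e (esym e')).
  exists h; split=> //; last by case=> //; rewrite hh.
  move: c; rewrite /ct /center e; case: (odd h) => [->//|c].
  apply/esym/negP => c1'.
  have : Cl p 0 = Cl p 1 by apply: sparse_cells => //=; rewrite pM.
  by [].
exists (fun p => vtx (Cl p 1) \in A); split.
- move=> p pM ap; have [h [hM hp ho hl]] := chosen p pM.
  have [h' [hM' hp' ho' hl']] := chosen (nx p) (nx_lt pM).
  (* If p were true and nx p false, spiders 2p + 1 and 2p would both be centred in [A]. Their first
     ends are the two filled cells of layer M + p, one of which is in [A]. *)
  apply: contraT => anp; rewrite ap in ho; rewrite (negbTE anp) in ho'.
  have Eh : h = p.*2.+1.
    by move: hp; rewrite /hub_var ho => <-; rewrite -[LHS]odd_double_half ho.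
  have Eh' : h' = p.*2.
    move: hp'; rewrite /hub_var ho' => /nx_inj E.
    by rewrite -[LHS]odd_double_half ho' E //; clear -hM'; lia.
  have := imp1 p pM; rewrite /imp_count -Eh -Eh'.
  by rewrite (negbTE (hl true)) (negbTE (hl' true)).
(* The cell chosen for the clause is an end of the spider standing for the value that falsifies the
   literal, so that spider is not centred in [A]. *)
- move=> e eM fe; have := clause1 e eM; rewrite /clause_count /source_cell fe /= addn0 => E.
  have [|h /andP[l /eqP c]] := sum_bool_ex
    (f := fun h : 'I_(2 * M) => lf h false && (ce (hub_var h) == e)); first by rewrite E.
  have qM := hub_var_lt M_gt0 nx_lt (ltn_ord h).
  have [sq oq _] := leaf2_in (ltn_ord h) l.
  exists (hub_var h); split=> //.
  have [h' [hM' hp' ho' hl']] := chosen _ qM.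
  apply/eqP; apply: contraT => aq.
  have ohh : odd h' = odd h.
    by move: oq aq; rewrite -ho'; case: (odd h); case: (odd h'); case: (sg _).
  have hh := hub_inj M_gt0 nx_inj hM' (ltn_ord h) ohh hp'.
  by have := hl' false; rewrite hh l.
Qed.

(** An end in [A] counts T; an end outside is at distance D + L + 2 from the centre and counts T /
    (D + L + 3). Since this is at most T, falling short in [N1] is no better than falling short in
    [N2]. *)
Lemma G_sparse_le : csp \/
  GG A <= T * (2 * M)%:R + T / (D + L + 3)%:R * (2 * M).-1%:R.
Proof.
have [n1 n2 n12] := sparse_counts.
have W0 : 0 < (D + L + 3)%:R^-1 :> R by rewrite invr_gt0 ltr0n addnS.
have W1 : (D + L + 3)%:R^-1 <= 1 :> R by rewrite invf_le1 ?ler1n ?ltr0n addnS.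
set z := (D + L + 3)%:R^-1 in W0 W1 *.
have prodE h j : (h < 2 * M)%N ->
    1 - hub_prod h j A <= (lf h j)%:R + z * (~~ lf h j && ct h)%:R.
  move=> hM; have r := hub_prod_range h j A.
  have [l|l] /= := boolP (lf h j); first by rewrite mulr0 addr0; lra.
  rewrite add0r.
  have other u : u \in A -> u != vtx (center h) -> hub_decay h j (kind u) = 1.
    move=> uA uc; have := sparse_main uA; rewrite /hub_decay.
    case Eu : (kind u) => [//|p k|//] _ /=.
    case: eqP => [E|_]; first by case/eqP: uc; apply: kind_inj; rewrite vtxK ?Eu ?E // (valid_center (M := M)).
    case: eqP => [E|//]; case/negP: l; rewrite /lf -E -Eu vtx_kind //.
  have [c|c] := boolP (ct h).
    rewrite mulr1 /hub_prod (setprodD1 _ c) /setprod big1 ?mulr1; last first.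
      by move=> u; rewrite !inE => /andP[uc uA]; exact: other.
    rewrite /hub_decay vtxK ?(valid_center (M := M)) // hub_dist_center // eqxx decayE.
    by rewrite /z -addnS; lra.
  rewrite mulr0 /hub_prod /setprod big1 ?subrr // => u uA; apply: other => //.
  by apply: contraNneq c => E; rewrite /ct -E.
have Gle : GG A <= T * (N1%:R + z * N2%:R).
  rewrite /GG -mulrDr; apply: ler_wpM2l => //.
  rewrite /N1 /N2 natrD addrAC; apply: lerD => //.
  rewrite !natr_sum mulr_sumr -big_split; apply: ler_sum => h _ /=.
  by rewrite !natr_sum mulr_sumr -big_split; apply: ler_sum => j _; exact: prodE.
have [N1M|N1M] := ltnP N1 (2 * M); last have [N2M|N2M] := ltnP N2 (2 * M); last first.
- by left; exact: n12.
- right; apply: le_trans Gle _; rewrite -mulrA -mulrDr; apply: ler_wpM2l => //.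
  apply: lerD; first by rewrite ler_nat.
  by apply: ler_wpM2l; [exact: ltW|rewrite ler_nat -ltnS prednK // muln_gt0].
- right; apply: le_trans Gle _; rewrite -mulrA -mulrDr; apply: ler_wpM2l => //.
  have a1 : N1%:R <= (2 * M)%:R - 1 :> R.
    by rewrite lerBrDr natr1 ler_nat.
  have a2 : z * N2%:R <= z * (2 * M).-1%:R + z.
    rewrite -[X in _ <= _ + X]mulr1 -mulrDr natr1 prednK ?muln_gt0 //.
    by apply: ler_wpM2l; [exact: ltW|rewrite ler_nat].
  lra.
Qed.

End Sparse.

End Network.

Local Close Scope ring_scope.

Local Open Scope ring_scope.

(** * Upper and lower bounds for the network *)

Section Bounds.
Variables (M D L : nat) (st sg fl : nat -> bool) (ce nx : nat -> nat).
Hypothesis M_gt0 : (0 < M)%N.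
Hypothesis ce_lt : forall p, st p -> (p < M)%N -> (ce p < M)%N.
Hypothesis nx_lt : forall p, (p < M)%N -> (nx p < M)%N.
Hypothesis nx_inj : forall p q, (p < M)%N -> (q < M)%N -> nx p = nx q -> p = q.
Hypothesis D_large : (max_dist M <= D)%N.
Hypothesis L_large : (max_dist M <= L)%N.

Local Notation layer := (layer M st ce).
Local Notation hub_var := (hub_var nx).
Local Notation center := (center nx).
Local Notation leaf := (leaf sg nx).
Local Notation valid := (valid M D L).
Local Notation kadj := (kadj M D L st sg ce nx).
Local Notation kmain := (kmain M st ce).
Local Notation kdist := (dist M D L st sg ce nx).
Local Notation csp := (csp M st sg fl ce nx).

Variables (V : finType) (kind : V -> vkind) (vtx : vkind -> V).
Hypothesis kind_valid : forall u, valid (kind u).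
Hypothesis vtxK : forall a, valid a -> kind (vtx a) = a.
Hypothesis kind_inj : injective kind.

Local Notation vadj := (vadj M D L st sg ce nx kind).

Let vtx_kind := vtx_kind kind_valid vtxK kind_inj.

Lemma kadj_irr : irreflexive kadj.
Proof.
case=> [i|p k|h t] //; rewrite /kadj /= orbb eqxx /=; apply/negP => /andP[t0 /eqP].
by case: eqP => [E|_] tE; move: t0; [lia|rewrite tE; lia].
Qed.

Lemma vadj_irr : irreflexive vadj.
Proof. by move=> u; exact: kadj_irr. Qed.

Lemma kadj_sym : symmetric kadj.
Proof. by move=> a b; rewrite /kadj orbC. Qed.

Lemma vadj_sym : symmetric vadj.
Proof. by move=> u v; exact: kadj_sym. Qed.

Variable R : realType.
Variables (T B e : R).
Hypothesis T_ge0 : 0 <= T.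

Definition init (a : vkind) : R :=
  match a with
  | Sp 0 => e
  | Sp _ => B
  | _ => T * (water fl a)%:R
  end.

Local Notation n := (3 * M)%N.
Local Notation dm := (max_dist M).
Local Notation Wt := (5%:R * M%:R * T).

Lemma spinal_spine u : spinal (kind u) = spine n (fun k => vtx (Sp k)) u.
Proof.
apply/idP/existsP => [|[k /eqP->]].
  have := kind_valid u; case Eu : (kind u) => [i|//|//] /= i_n _.
  by exists (inord i); rewrite inordK // -Eu vtx_kind.
by rewrite vtxK //= -ltnS.
Qed.

Lemma network_upper :
  2 * Wt <= B * (q R V / 4%:R * (q R V / dm.+1%:R)) ->
  4%:R * n.+1%:R * B + 2 * Wt <= e * (q R V * dm.+1%:R^-1 ^+ 2) ->
  ~ csp -> forall s, all (legal_move vadj) s ->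
  final_profile (init \o kind) s (vtx (Sp n)) <=
    (e + n%:R * B + (T * (2 * M)%:R + T / (D + L + 3)%:R * (2 * M).-1%:R)) / n.*2.+1%:R.
Proof.
move=> B_big e_big ncsp s ls.
have valid_Sp k : (k <= n)%N -> valid (Sp k) by [].
have W1 : 1 <= (D + L + 3)%:R :> R by rewrite ler1n addnS.
have W0 : 0 <= (D + L + 3)%:R^-1 :> R by rewrite invr_ge0.
have W2 : (D + L + 3)%:R^-1 <= 1 :> R by rewrite invf_le1 // (lt_le_trans _ W1).
have Mp : (2 * M).-1%:R <= 2 * M%:R :> R by rewrite -natrM ler_nat leq_pred.
apply: (@target_bound R V vadj n dm (fun u => kdist (kind u)) (fun u => kmain (kind u))
  (fun k => vtx (Sp k)) vadj_irr vadj_sym _ _ _ _ _ _ _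
  (GG M D L sg fl nx kind vtx T) e B Wt _ (tau fl kind T)) => //.
- move=> x y /orP[xy|yx].
    by have [] := dist_link M_gt0 ce_lt nx_lt D_large L_large (kind_valid x) (kind_valid y) xy.
  by have [] := dist_link M_gt0 ce_lt nx_lt D_large L_large (kind_valid y) (kind_valid x) yx.
- by move=> u; exact: dist_le.
- by move=> k kn; rewrite vtxK.
- by move=> k kn; rewrite vtxK.
- move=> u; have := kind_valid u; case Eu : (kind u) => [i|p k|//] /= i_n _.
    by rewrite doubleK -Eu vtx_kind.
  by rewrite /cell_dist /= odd_double.
- move=> u; have := kind_valid u; case: (kind u) => [//|p k|h t] //= /andP[_ tZ].
  have m0 : (0 < dm)%N by [].
  by case: ifP => _; move: tZ m0; rewrite /spider_size /cell_dist; clear; lia.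
- move=> x y my xy; exact: (main_adj M_gt0 ce_lt nx_lt D_large L_large (kind_valid x) (kind_valid y) xy my).
- by move=> A; exact: GG_range.
- apply/andP; split; first by rewrite addr_ge0 // ?mulr_ge0.
  rewrite -mulrA -mulrDr mulrC; apply: ler_wpM2r => //; rewrite natrM.
  have : (D + L + 3)%:R^-1 * (2 * M).-1%:R <= (2 * M).-1%:R :> R by apply: ler_piMl.
  have : 0 <= M%:R :> R by [].
  lra.
- move=> A x y xy yA xA; rewrite -!spinal_spine => sx sy.
  exact: (G_superharmonic fl M_gt0 nx_inj L_large kind_valid vtxK kind_inj T_ge0 xy yA xA sx sy).
- by move=> u; rewrite mulr_ge0.
- exact: (tau_total sg fl M_gt0 nx_lt nx_inj kind_valid vtxK kind_inj T_ge0).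
- move=> A _; apply: le_trans (tau_le_G sg fl M_gt0 nx_lt nx_inj kind_valid vtxK kind_inj T_ge0 A).
  rewrite [leRHS](bigID (spine n (fun k => vtx (Sp k)))) /= lerDr sumr_ge0 // => u _.
  by rewrite mulr_ge0.
- move=> A _ spA.
  by case: (G_sparse_le fl M_gt0 ce_lt nx_lt nx_inj kind_valid vtxK kind_inj T_ge0 spA) => [/ncsp|].
- by rewrite muln_gt0.
- by rewrite /= vtxK.
- by move=> [//|k] /= kn; rewrite vtxK.
- by move=> u; rewrite -spinal_spine /= /tau; case: (kind u).
Qed.

Lemma connected_from (U : {set V}) r :
  (forall u, u \in U -> connect [rel x y | [&& x \in U, y \in U & vadj x y]] r u) ->
  connected_set vadj U.
Proof.
move=> H u v uU vU; apply: connect_trans (H v vU); rewrite sym_connect_sym ?H //.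
by move=> x y /=; rewrite vadj_sym andbA [(x \in U) && _]andbC -andbA.
Qed.

Definition spider (h : nat) : {set V} :=
  [set u | [|| kind u == center h, kind u == leaf h true, kind u == leaf h false
     | if kind u is Ln g _ then g == h else false]].

Lemma spider_connected h : (h < 2 * M)%N -> connected_set vadj (spider h).
Proof.
move=> hM; pose E := [rel x y | [&& x \in spider h, y \in spider h & vadj x y]].
have vL t : (t < spider_size D L)%N -> valid (Ln h t) by rewrite /= hM.
have inL t : (t < spider_size D L)%N -> vtx (Ln h t) \in spider h.
  by move=> tZ; rewrite inE vtxK ?vL // eqxx !orbT.
have inl j : vtx (leaf h j) \in spider h.
  by rewrite inE vtxK ?valid_leaf //; case: j; rewrite eqxx ?orbT.
have inc : vtx (center h) \in spider h.
  by rewrite inE vtxK ?(valid_center (M := M)) // eqxx.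
have stepE a b : valid a -> valid b -> vtx a \in spider h -> vtx b \in spider h ->
    link M D L st sg ce nx a b || link M D L st sg ce nx b a -> connect E (vtx a) (vtx b).
  by move=> va vb aU bU ab; apply: connect1; rewrite /= aU bU /vadj !vtxK.
apply: (@connected_from _ (vtx (Ln h 0))) => u uH.
have line t : (t <= 2 * D)%N -> connect E (vtx (Ln h 0)) (vtx (Ln h t)).
  elim: t => [|t IH] tD; first exact: connect0.
  apply: connect_trans (IH (ltnW tD)) _.
  have tZ : (t.+1 < spider_size D L)%N by rewrite /spider_size; move: tD; clear; lia.
  apply: stepE; rewrite ?vL ?inL ?(ltnW tZ) //= eqxx /=.
  by rewrite (ltn_eqF tD) eqxx.
have leg g : (g < L)%N -> connect E (vtx (Ln h 0)) (vtx (Ln h (2 * D + g.+1))).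
  elim: g => [|g IH] gL.
    have DD : (D <= 2 * D)%N by clear; lia.
    apply: connect_trans (line D DD) _.
    have Z1 : (D < spider_size D L)%N by rewrite /spider_size; clear; lia.
    have Z2 : (2 * D + 1 < spider_size D L)%N by rewrite /spider_size; move: gL; clear; lia.
    apply: stepE; rewrite ?vL ?inL //= eqxx /= addn1 /= eqxx.
    by rewrite eqxx.
  apply: connect_trans (IH (ltnW gL)) _.
  have Z1 : (2 * D + g.+2 < spider_size D L)%N by rewrite /spider_size; move: gL; clear; lia.
  have Z2 : (2 * D + g.+1 < spider_size D L)%N by move: Z1; clear; lia.
  apply: stepE; rewrite ?vL ?inL //= eqxx /= [(2 * D + g.+2)%N]addnS /=.
  have -> : (2 * D + g.+1 == 2 * D)%N = false by clear; lia.
  by rewrite eqxx.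
have all_line t : (t < spider_size D L)%N -> connect E (vtx (Ln h 0)) (vtx (Ln h t)).
  move=> tZ; have [|tD] := leqP t (2 * D); first exact: line.
  have tE : (2 * D + (t - (2 * D).+1).+1 = t)%N by move: tD; clear; lia.
  by rewrite -tE; apply: leg; move: tZ tD; rewrite /spider_size; clear; lia.
have Z0 : (0 < spider_size D L)%N by [].
have ZD : (2 * D < spider_size D L)%N by rewrite /spider_size ltnS leq_addr.
have ZL : (2 * D + L < spider_size D L)%N by [].
move: uH; rewrite inE => /or4P[/eqP Eu|/eqP Eu|/eqP Eu|]; last first.
- have := kind_valid u; case Eu : (kind u) => [//|//|g t] /= /andP[_ tZ] /eqP gh.
  by rewrite -[u]vtx_kind Eu gh; exact: all_line.
- rewrite -[u]vtx_kind Eu; apply: connect_trans (all_line _ ZD) _.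
  apply: stepE; rewrite ?vL ?inL ?valid_leaf //.
  by apply/orP; right; rewrite /leaf /= -/(leaf2 sg nx h) eqxx eqxx /= orbT.
- rewrite -[u]vtx_kind Eu; apply: stepE; rewrite ?vL ?inL ?valid_leaf //.
  by apply/orP; right; rewrite /leaf /= -/(leaf1 h) eqxx.
- rewrite -[u]vtx_kind Eu; apply: connect_trans (all_line _ ZL) _.
  apply: stepE; rewrite ?vL ?inL ?(valid_center (M := M)) //.
  by apply/orP; right; rewrite /center /= -/(center h) !eqxx !orbT.
Qed.

Section Ladder.
Variable pick : nat -> vkind.
Hypothesis pick_cell : forall l, (l < n)%N -> exists p k,
  [/\ pick l = Cl p k, valid (Cl p k) & layer p k = l].

Definition ladder : {set V} :=
  [set u | spinal (kind u) || [exists l : 'I_n, kind u == pick l]].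

Lemma ladder_Sp i : (i <= n)%N -> vtx (Sp i) \in ladder.
Proof. by move=> i_n; rewrite inE vtxK. Qed.

Lemma ladder_pick l : (l < n)%N -> vtx (pick l) \in ladder.
Proof.
move=> ln; have [p [k [E va _]]] := pick_cell ln.
rewrite inE E vtxK // -E; apply/orP; right.
by apply/existsP; exists (Ordinal ln).
Qed.

Lemma ladder_connected : connected_set vadj ladder.
Proof.
pose E := [rel x y | [&& x \in ladder, y \in ladder & vadj x y]].
have up l : (l < n)%N -> connect E (vtx (Sp l)) (vtx (pick l)).
  move=> ln; apply: connect1; rewrite /= ladder_Sp ?ladder_pick ?(ltnW ln) //.
  have [p [k [-> va lE]]] := pick_cell ln.
  have vS : valid (Sp l) := ltnW ln.
  by rewrite /vadj !vtxK // /kadj /= lE ln eqxx.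
have up' l : (l < n)%N -> connect E (vtx (pick l)) (vtx (Sp l.+1)).
  move=> ln; apply: connect1; rewrite /= ladder_Sp ?ladder_pick //.
  have [p [k [-> va lE]]] := pick_cell ln.
  by rewrite /vadj !vtxK // /kadj /= lE ln eqxx orbT.
have sp i : (i <= n)%N -> connect E (vtx (Sp 0)) (vtx (Sp i)).
  elim: i => [|i IH] i_n; first exact: connect0.
  by apply: connect_trans (IH (ltnW i_n)) _; apply: connect_trans (up i i_n) (up' i i_n).
apply: (@connected_from _ (vtx (Sp 0))) => u; rewrite inE => /orP[|/existsP[l /eqP Eu]].
  have := kind_valid u; case Eu : (kind u) => [i|//|//] i_n _.
  by rewrite -[u]vtx_kind Eu; exact: sp.
rewrite -[u]vtx_kind Eu; apply: connect_trans (sp l (ltnW (ltn_ord l))) _.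
exact: up.
Qed.

Lemma ladder_card : (#|ladder| <= n.*2.+1)%N.
Proof.
pose g (x : 'I_n.+1 + 'I_n) := match x with inl i => vtx (Sp i) | inr l => vtx (pick l) end.
have sub : ladder \subset [set g x | x in predT].
  apply/fintype.subsetP => u; rewrite inE => /orP[|/existsP[l /eqP Eu]]; last first.
    by apply/imsetP; exists (inr l) => //; rewrite /= -Eu vtx_kind.
  have := kind_valid u; case Eu : (kind u) => [i|//|//] /= i_n _.
  apply/imsetP; exists (inl (inord i)) => //=.
  by rewrite inordK // -Eu vtx_kind.
apply: leq_trans (subset_leq_card sub) _; apply: leq_trans (leq_imset_card _ _) _.
by rewrite card_sum !card_ord addSn addnn.
Qed.

End Ladder.

Lemma graph_connected u v : connect vadj u v.
Proof.
(* Any cell of each layer will do here; kinds 0, 2 and 6 are available whatever the formula. *)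
pose pick l := if (l < M)%N then Cl l 0 else if (l < 2 * M)%N then Cl (l - M) 2 else Cl (l - 2 * M) 6.
have pickP l : (l < n)%N -> exists p k, [/\ pick l = Cl p k, valid (Cl p k) & layer p k = l].
  move=> ln; rewrite /pick /layer; case: ltnP => lM; first by exists l, 0%N; rewrite /= lM.
  case: ltnP => l2; [exists (l - M)%N, 2%N|exists (l - 2 * M)%N, 6%N]; split=> //=;
    by move: ln lM l2; clear; lia.
have sub (U : {set V}) : subrel (connect [rel x y | [&& x \in U, y \in U & vadj x y]]) (connect vadj).
  by apply: connect_sub => x y /and3P[_ _]; exact: connect1.
pose r := vtx (Sp 0).
have spine_r i : (i <= n)%N -> connect vadj r (vtx (Sp i)).
  move=> i_n; apply: (sub (ladder pick)).
  by apply: (ladder_connected pickP); exact: ladder_Sp.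
have cell_r p k : valid (Cl p k) -> (layer p k < n)%N -> connect vadj r (vtx (Cl p k)).
  move=> va ln; apply: connect_trans (spine_r _ (ltnW ln)) _; apply: connect1.
  have vS : valid (Sp (layer p k)) := ltnW ln.
  by rewrite /vadj !vtxK // /kadj /= ln eqxx.
have spider_r h w : (h < 2 * M)%N -> w \in spider h -> connect vadj r w.
  move=> hM wH; have vc : valid (center h) by apply: (valid_center (M := M)).
  have ch : vtx (center h) \in spider h by rewrite inE vtxK // eqxx.
  apply: connect_trans (sub (spider h) _ _ (spider_connected hM ch wH)).
  apply: cell_r => //; have := hub_var_lt M_gt0 nx_lt hM; rewrite /layer.
  by case: (odd h) => /=; clear; lia.
have all_r w : connect vadj r w.
  rewrite -[w]vtx_kind; have := kind_valid w; case Ew : (kind w) => [i|p k|h t] /= va.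
  - exact: spine_r.
  - have [ln|ln] := ltnP (layer p k) n; first exact: cell_r.
    (* A cell on no layer is of kind 4 or 5, hence an end of a spider; it is reached through the
       centre, which always lies on a layer. *)
    have k46 : (1 < k < 6)%N.
      case/andP: va => pM k7; move: ln; rewrite /layer.
      case: ifP => k2; first by move: pM; clear; lia.
      case: ifP => k4; first by move: pM; clear; lia.
      by case: eqP => k_4; [|case: eqP => k_5]; move: k2 k4 pM k7; try move: k_4; try move: k_5; clear; lia.
    case/andP: va => pM k7.
    have [h [j [hM lE]]] := leaf_surj sg nx_lt nx_inj pM k46.
    apply: (spider_r h) => //; rewrite -lE inE vtxK ?valid_leaf //.
    by case: j {lE}; rewrite eqxx ?orbT.
  - case/andP: va => hM tZ; apply: (spider_r h) => //.
    by rewrite inE vtxK /= ?hM ?tZ // eqxx.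
apply: connect_trans (all_r v); rewrite sym_connect_sym ?all_r //.
exact: vadj_sym.
Qed.

Lemma sum_inj_le (I : finType) (g : I -> V) (P : pred V) (f : V -> R) :
  injective g -> (forall x, P (g x)) -> (forall u, 0 <= f u) ->
  \sum_x f (g x) <= \sum_(u | P u) f u.
Proof.
move=> gi gP f0; rewrite -(big_imset (h := g) (A := predT) f) /=; last first.
  by move=> x y _ _; exact: gi.
rewrite [leRHS](bigID (fun u => u \in [set g x | x in predT])) /=.
rewrite [X in _ <= X + _](eq_bigl (fun u => u \in [set g x | x in predT])).
  by rewrite lerDl sumr_ge0.
by move=> u; rewrite andb_idl // => /imsetP[x _ ->].
Qed.

Hypothesis B_ge0 : 0 <= B.
Hypothesis e_ge0 : 0 <= e.

Lemma init_ge0 a : 0 <= init a.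
Proof. by case: a => [[|i]|p k|h t] //=; rewrite mulr_ge0. Qed.

Lemma init_leaf h j : init (leaf h j) = T.
Proof.
case: j; rewrite /init /leaf /=; first by case: odd; rewrite /= mulr1.
by case: (_ == sg _); rewrite /= mulr1.
Qed.

Lemma spider_card h : (#|spider h| <= L + 2 * D + 4)%N.
Proof.
pose g (x : option (option (option 'I_(spider_size D L)))) := match x with
  | None => vtx (center h) | Some None => vtx (leaf h true)
  | Some (Some None) => vtx (leaf h false) | Some (Some (Some t)) => vtx (Ln h t) end.
have sub : spider h \subset [set g x | x in predT].
  apply/fintype.subsetP => u; rewrite inE => H; apply/imsetP.
  case/or4P: H => [/eqP Eu|/eqP Eu|/eqP Eu|].
  - by exists None => //=; rewrite -Eu vtx_kind.
  - by exists (Some None) => //; rewrite /g -Eu vtx_kind.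
  - by exists (Some (Some None)) => //; rewrite /g -Eu vtx_kind.
  have := kind_valid u; case Eu : (kind u) => [//|//|g' t] /= /andP[_ tZ] /eqP gh.
  by exists (Some (Some (Some (Ordinal tZ)))) => //=; rewrite -gh -Eu vtx_kind.
apply: leq_trans (subset_leq_card sub) _; apply: leq_trans (leq_imset_card _ _) _.
by rewrite !card_option card_ord /spider_size; clear; lia.
Qed.

Lemma spider_sum h : (h < 2 * M)%N -> 2 * T <= \sum_(u in spider h) (init \o kind) u.
Proof.
move=> hM; have v j : valid (leaf h j) by apply: valid_leaf.
have := @sum_inj_le bool (fun j => vtx (leaf h j)) (fun u => u \in spider h)
  (init \o kind).
rewrite (eq_bigr (fun=> T)); last by move=> j _; rewrite /comp vtxK // init_leaf.
rewrite big_bool => H; have -> : 2 * T = T + T by ring.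
apply: H => [j j' /(congr1 kind)|j|u]; last exact: init_ge0.
  by rewrite !vtxK // => /(leaf_inj M_gt0 nx_inj hM hM)[].
by rewrite inE vtxK //; case: j; rewrite eqxx ?orbT.
Qed.

Lemma spider_disjoint h h' : (h < 2 * M)%N -> (h' < 2 * M)%N -> h != h' ->
  [disjoint spider h & spider h'].
Proof.
move=> hM hM' ne; apply/pred0P => u /=; apply/negP; rewrite !inE => /andP[].
have cl g g' j : center g = leaf g' j -> False.
  by move=> E; have := leaf_neq_center sg nx g' g j; rewrite E eqxx.
case/or4P => [/eqP->|/eqP->|/eqP->|].
- case/or4P => [/eqP E|/eqP E|/eqP E|//]; try exact: cl E.
  by rewrite (center_inj M_gt0 nx_inj hM hM' E) eqxx in ne.
- case/or4P => [/eqP E|/eqP E|/eqP E|//]; try by apply: cl (esym E).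
    by have [E' _] := leaf_inj M_gt0 nx_inj hM hM' E; rewrite E' eqxx in ne.
  by have [_] := leaf_inj M_gt0 nx_inj hM hM' E.
- case/or4P => [/eqP E|/eqP E|/eqP E|//]; try by apply: cl (esym E).
    by have [_] := leaf_inj M_gt0 nx_inj hM hM' E.
  by have [E' _] := leaf_inj M_gt0 nx_inj hM hM' E; rewrite E' eqxx in ne.
- case: (kind u) => [//|//|g t] /eqP->.
  by case/or4P => [/eqP|/eqP|/eqP|/eqP E] //; rewrite E eqxx in ne.
Qed.

(** The 2M cells of the last two blocks of layers contribute T each, and each of the M spiders
    passes the average of its two ends on to the path. Both need the ends of these spiders to be off
    the path, which is what [csp] provides. *)
Lemma network_lower c : csp ->
  c < (e + n%:R * B + T * (2 * M)%:R + M%:R * (2 * T / (L + 2 * D + 4)%:R)) / n.*2.+1%:R ->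
  exists2 s, all (legal_move vadj) s & c < final_profile (init \o kind) s (vtx (Sp n)).
Proof.
move=> [a [a_nx a_fl]] c_lt.
have /choice[ch chP] : forall p, exists h, (p < M)%N -> [/\ (h < 2 * M)%N, hub_var h = p & odd h = a p].
  move=> p; have [pM|pM] := ltnP p M; last by exists 0%N.
  by have [h H] := hub_surj nx_lt nx_inj (a p) pM; exists h.
have /choice[pe peP] : forall x, exists p, (x < M)%N -> fl x -> [/\ (p < M)%N, st p, ce p = x & a p = sg p].
  move=> x; have [/andP[xM fx]|H] := boolP ((x < M)%N && fl x).
    by have [p Hp] := a_fl x xM fx; exists p.
  by exists 0%N => xM fx; rewrite xM fx in H.
pose pick l := if (l < M)%N then Cl l (a l)
  else if (l < 2 * M)%N then Cl (l - M) (2 + ~~ a (l - M)%N)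
  else if fl (l - 2 * M)%N then Cl (pe (l - 2 * M)%N) 4 else Cl (l - 2 * M) 6.
have pickP l : (l < n)%N -> exists p k, [/\ pick l = Cl p k, valid (Cl p k) & layer p k = l].
  move=> ln; rewrite /pick; case: ltnP => lM.
    by exists l, (a l); rewrite /= lM /layer; case: (a l).
  case: ltnP => l2.
    exists (l - M)%N, (2 + ~~ a (l - M))%N; rewrite /layer /=.
    by split => //; case: (a _) => /=; move: lM l2; clear; lia.
  have lM' : (l - 2 * M < M)%N by move: ln l2; clear; lia.
  case: ifP => fx; last first.
    by exists (l - 2 * M)%N, 6%N; rewrite /layer /= lM'; split=> //; move: l2; clear; lia.
  have [pM sp cp _] := peP _ lM' fx.
  exists (pe (l - 2 * M)%N), 4%N; rewrite /layer /= pM sp cp; split=> //.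
  by move: l2; clear; lia.
have centerE p : (p < M)%N -> center (ch p) = Cl p (a p).
  by move=> pM; have [_ hp ho] := chP p pM; rewrite /center hp ho.
have in_ladder b : valid b -> ~~ spinal b -> vtx b \in ladder pick -> exists l : 'I_n, b = pick l.
  by move=> vb sb; rewrite inE vtxK // (negbTE sb) => /existsP[l /eqP->]; exists l.
apply: (two_stage_flattening (m := M) (H := fun p => spider (ch p))
   (c := fun p => vtx (Cl p (a p))) (Pi := ladder pick) vadj_irr).
- by move=> p pM; have [hM _ _] := chP p pM; exact: spider_connected.
- move=> p p' pM pM' ne; have [hM hp _] := chP p pM; have [hM' hp' _] := chP p' pM'.
  by apply: spider_disjoint => //; apply: contraNneq ne => E; rewrite -hp -hp' E.
- move=> p pM; have [hM hp ho] := chP p pM.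
  have pn : (p < n)%N by move: pM; clear; lia.
  have cL : vtx (Cl p (a p)) \in ladder pick.
    by have := ladder_pick pickP pn; rewrite /pick pM.
  split=> //; apply/setP => u; rewrite finset.in_setI finset.in_set1; apply/andP/eqP => [[uH uL]|->]; last first.
    split=> //; rewrite -(centerE p pM) inE vtxK ?eqxx //.
    by apply: (valid_center (M := M)).
  have := uH; rewrite inE => /or4P[/eqP Eu|/eqP Eu|/eqP Eu|]; last first.
  + case Eu : (kind u) => [//|//|g t] _; move: uL; rewrite inE Eu /= => /existsP[l /eqP E].
    by have [p' [k' [E' _ _]]] := pickP l (ltn_ord l); rewrite E' in E.
  + have vl : valid (leaf (ch p) false) by apply: valid_leaf.
    have [||l] := in_ladder (leaf (ch p) false) vl; first by [].
      by rewrite -Eu vtx_kind.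
    rewrite /leaf /leaf2 hp ho /pick; case: ltnP => lM.
      by case=> _; case: ifP => _; case: (a l).
    case: ltnP => l2; first by case=> _; case: ifP => _; case: (a _).
    have lM' : (l - 2 * M < M)%N by move: (ltn_ord l) l2; clear; lia.
    case fx : (fl (l - 2 * M)%N); last by case=> _; case: (a p == sg p).
    have [_ _ _ ap] := peP _ lM' fx.
    by case=> Ep; rewrite Ep ap eqxx.
  + have vl : valid (leaf (ch p) true) by apply: valid_leaf.
    have [||l] := in_ladder (leaf (ch p) true) vl; first by [].
      by rewrite -Eu vtx_kind.
    rewrite /leaf /leaf1 ho /pick; case: ltnP => lM.
      by case=> _; case: (a p); case: (a l).
    case: ltnP => l2; last by case: ifP => _ [_]; case: (a p).
    (* If p is true, the end is kind 3 of layer M + p and the path takes kind 2. If p = nx q is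
       false, the end is kind 2 of layer M + q; the implication makes q false as well, so the path
       takes kind 3. *)
    case=> E1; rewrite -E1.
    move: hp; rewrite /hub_var ho; case ap : (a p) => hp; first by rewrite hp ap.
    have h2 : ((ch p)./2 < M)%N by move: hM; clear; lia.
    case a2 : (a (ch p)./2) => //.
    by have := a_nx _ h2 a2; rewrite hp ap.
  + by rewrite -[u]vtx_kind Eu centerE.
- exact: ladder_connected.
- exact: ladder_Sp.
have K0 : 0 < n.*2.+1%:R :> R by [].
have card_le : #|ladder pick|%:R <= n.*2.+1%:R :> R by rewrite ler_nat ladder_card.
have card0 : 0 < #|ladder pick|%:R :> R.
  by rewrite ltr0n card_gt0; apply/set0Pn; exists (vtx (Sp 0)); exact: ladder_Sp.
have W0 : 0 < (L + 2 * D + 4)%:R :> R by rewrite ltr0n addnS.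
have S1 : e + n%:R * B + T * (2 * M)%:R <=
   \sum_(u in ladder pick | [forall i : 'I_M, u != vtx (Cl i (a i))]) (init \o kind) u.
  pose g (x : 'I_n.+1 + 'I_(2 * M)) := match x with
    | inl i => vtx (Sp i) | inr l => vtx (pick (M + l)%N) end.
  have ln (l : 'I_(2 * M)) : (M + l < n)%N by move: (ltn_ord l); clear; lia.
  have pv (l : 'I_(2 * M)) : valid (pick (M + l)%N).
    by have [p [k [-> vp _]]] := pickP _ (ln l).
  have iv (i : 'I_n.+1) : valid (Sp i) by rewrite /= -ltnS.
  have := @sum_inj_le _ g (fun u => (u \in ladder pick) && [forall i : 'I_M, u != vtx (Cl i (a i))])
    (init \o kind).
  rewrite big_sumType /= => H; apply: le_trans (H _ _ _).
  - apply: lerD.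
      rewrite big_ord_recl /= vtxK // (eq_bigr (fun _ => B)); last first.
        by move=> i _; rewrite vtxK //; exact: (iv (lift ord0 i)).
      by rewrite sumr_const card_ord mulr_natl.
    rewrite (eq_bigr (fun _ => T)).
      by rewrite sumr_const card_ord mulr_natr.
    move=> l _; rewrite vtxK // /pick ltnNge leq_addr /=.
    case: ltnP => l2; first by case: (a _); rewrite /= mulr1.
    by case: ifP => fx /=; rewrite ?fx mulr1.
  - move=> [i|l] [i'|l'] /(congr1 kind); rewrite /g !vtxK //.
    + by move=> [] /val_inj->.
    + by have [p [k [-> _ _]]] := pickP _ (ln l').
    + by have [p [k [-> _ _]]] := pickP _ (ln l).
    + have [p [k [E1 _ Y1]]] := pickP _ (ln l); have [p' [k' [E2 _ Y2]]] := pickP _ (ln l').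
      rewrite E1 E2 => -[Ep Ek]; congr inr; apply/val_inj/eqP.
      by rewrite -(eqn_add2l M) -Y1 -Y2 Ep Ek.
  - move=> [i|l] /=.
      rewrite (ladder_Sp _ (iv i)) /=; apply/forallP => j; apply/eqP => /(congr1 kind).
      have vj : valid (Cl j (a j)) by rewrite /= ltn_ord; case: (a j).
      by rewrite !vtxK.
    rewrite ladder_pick //=; apply/forallP => j; apply/eqP => /(congr1 kind).
    have vj : valid (Cl j (a j)) by rewrite /= ltn_ord; case: (a j).
    rewrite !vtxK //; have [p [k [E1 _ Y1]]] := pickP _ (ln l); rewrite E1 => -[Ep Ek].
    move: Y1; rewrite Ep Ek /layer; have jM := ltn_ord j.
    by case: (a j) => /= jE; move: jM; rewrite jE ltnNge leq_addr.
  - by move=> u; exact: init_ge0.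
have S2 : M%:R * (2 * T / (L + 2 * D + 4)%:R) <=
   \sum_(i < M) (\sum_(w in spider (ch i)) (init \o kind) w) / #|spider (ch i)|%:R.
  rewrite mulr_natl -[X in _ *+ X]card_ord -sumr_const; apply: ler_sum => i _.
  have [hM _ _] := chP i (ltn_ord i).
  have s0 : (0 < #|spider (ch i)|)%N.
    apply/card_gt0P; exists (vtx (center (ch i))); rewrite inE vtxK ?eqxx //.
    by apply: (valid_center (M := M)).
  apply: (@le_trans _ _ ((\sum_(w in spider (ch i)) (init \o kind) w) / (L + 2 * D + 4)%:R)).
    by apply: ler_wpM2r; [rewrite invr_ge0 ltW|exact: spider_sum].
  apply: ler_wpM2l; first by apply: sumr_ge0 => u _; exact: init_ge0.
  by rewrite lef_pV2 ?posrE ?W0 ?ltr0n // ler_nat spider_card.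
apply: lt_le_trans c_lt _.
apply: (@le_trans _ _ ((e + n%:R * B + T * (2 * M)%:R + M%:R * (2 * T / (L + 2 * D + 4)%:R))
   / #|ladder pick|%:R)).
  apply: ler_wpM2l; first by rewrite !addr_ge0 ?mulr_ge0 ?invr_ge0 // ltW.
  by rewrite lef_pV2 ?posrE.
apply: ler_wpM2r; first by rewrite invr_ge0 ltW.
exact: lerD.
Qed.

End Bounds.

Local Close Scope ring_scope.

(** * The water transport instance *)

Section Instance.
Variables (M : nat) (st sg fl : nat -> bool) (ce nx : nat -> nat).
Hypothesis M_gt0 : 0 < M.
Hypothesis ce_lt : forall p, st p -> p < M -> ce p < M.
Hypothesis nx_lt : forall p, p < M -> nx p < M.
Hypothesis nx_inj : forall p q, p < M -> q < M -> nx p = nx q -> p = q.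

(** [Dlen] exceeds [max_dist M], which is 6 * M + 1; [Llen] is what [leaf_gain] asks for. *)
Definition Dlen := 7 * M.
Definition Llen := 2 * M * Dlen.+1.
Definition Zlen := spider_size Dlen Llen.
Definition order_pred := 3 * M + (7 * M + 2 * M * Zlen).
Local Notation nv := order_pred.+1.
Local Notation layer := (layer M st ce).
Local Notation center := (center nx).
Local Notation leaf2 := (leaf2 sg nx).
Local Notation valid := (valid M Dlen Llen).
Local Notation link := (link M Dlen Llen st sg ce nx).

Definition code (a : vkind) : nat :=
  match a with
  | Sp i => i
  | Cl p k => (3 * M).+1 + (7 * p + k)
  | Ln h t => (3 * M).+1 + (7 * M + (h * Zlen + t))
  end.

Definition decode (x : nat) : vkind :=
  if x <= 3 * M then Sp x
  else let y := x - (3 * M).+1 in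
    if y < 7 * M then Cl (y %/ 7) (y %% 7)
    else let z := y - 7 * M in Ln (z %/ Zlen) (z %% Zlen).

Lemma decode_valid x : x < nv -> valid (decode x).
Proof.
rewrite /decode /order_pred => xn; case: (leqP x (3 * M)) => x1 //=.
case: (ltnP _ (7 * M)) => x2 /=; first by rewrite ltn_pmod // andbT ltn_divLR // [M * 7]mulnC.
rewrite ltn_pmod // andbT ltn_divLR //.
by move: xn x1 x2; move: (2 * M * Zlen) => m; clear; lia.
Qed.

Lemma codeK a : valid a -> decode (code a) = a.
Proof.
case: a => [i|p k|h t] /=; rewrite /decode.
- by move=> ->.
- move=> /andP[pM k7]; rewrite leqNgt ltnS leq_addr /= addKn.
  have -> : 7 * p + k < 7 * M by move: pM k7; clear; lia.
  by rewrite [7 * p]mulnC divnMDl // divn_small // addn0 modnMDl modn_small.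
- move=> /andP[hM tZ]; rewrite leqNgt ltnS leq_addr /= addKn ltnNge leq_addr /= addKn.
  by rewrite divnMDl // divn_small // addn0 modnMDl modn_small.
Qed.

Lemma code_lt a : valid a -> code a < nv.
Proof.
rewrite /order_pred; case: a => [i|p k|h t] /=.
- by move: (2 * M * Zlen) => m; clear; lia.
- by move: (2 * M * Zlen) => m; clear; lia.
- move=> /andP[hM tZ]; have : h.+1 * Zlen <= 2 * M * Zlen by rewrite leq_mul2r hM orbT.
  rewrite mulSn -/Zlen in tZ *; move: tZ; rewrite -/Zlen.
  by move: (2 * M * Zlen) (h * Zlen) => m m'; clear; lia.
Qed.

Lemma decodeK x : x < nv -> code (decode x) = x.
Proof.
rewrite /decode => xn; case: (leqP x (3 * M)) => x1 //=.
case: (ltnP _ (7 * M)) => x2 /=.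
  by rewrite [7 * (_ %/ _)]mulnC -divn_eq subnKC.
by rewrite -divn_eq subnKC // subnKC.
Qed.

Definition kind (u : 'I_nv) : vkind := decode u.
Definition vtx (a : vkind) : 'I_nv := inord (code a).

Lemma kind_valid u : valid (kind u). Proof. exact: decode_valid. Qed.

Lemma vtxK a : valid a -> kind (vtx a) = a.
Proof. by move=> va; rewrite /kind /vtx inordK ?code_lt ?codeK. Qed.

Lemma kind_inj : injective kind.
Proof.
by move=> u v E; apply/val_inj; rewrite /= -(decodeK (ltn_ord u)) -(decodeK (ltn_ord v)) -/(kind u) E.
Qed.

Definition cell_edges (p k : nat) : seq (vkind * vkind) :=
  if layer p k < 3 * M then [:: (Cl p k, Sp (layer p k)); (Cl p k, Sp (layer p k).+1)] else [::].

Definition line_edge (h t : nat) : vkind * vkind :=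
  (Ln h (if t == 2 * Dlen then Dlen else t), Ln h t.+1).

Definition hub_edges (h : nat) : seq (vkind * vkind) :=
  flatten [seq [:: line_edge h t] | t <- iota 0 (2 * Dlen + Llen)] ++
  [:: (leaf1 h, Ln h 0); (leaf2 h, Ln h (2 * Dlen)); (center h, Ln h (2 * Dlen + Llen))].

Definition edge_list : seq (vkind * vkind) :=
  flatten [seq flatten [seq cell_edges p k | k <- iota 0 7] | p <- iota 0 M] ++
  flatten [seq hub_edges h | h <- iota 0 (2 * M)].

Lemma mem_edge_list a b : (a, b) \in edge_list <-> [/\ valid a, valid b & link a b].
Proof.
rewrite mem_cat; split.
  case/orP => /flatten_mapP[p]; rewrite mem_iota add0n => /andP[_ pM].
    move=> /flatten_mapP[k]; rewrite mem_iota add0n => k7; rewrite /cell_edges.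
    case: ifP => // lM; rewrite !inE => /orP[]/eqP[-> ->]; split=> //=;
      rewrite ?pM ?(ltnW lM) // lM eqxx ?orbT //.
  rewrite mem_cat => /orP[/flatten_mapP[t]|].
    rewrite mem_iota add0n => tZ; rewrite inE => /eqP[-> ->]; split=> //=.
    - rewrite pM /spider_size; case: eqP => _; move: tZ; clear; lia.
    - by rewrite pM /spider_size.
    - by rewrite eqxx /=.
  have v1 := valid_leaf1 Dlen Llen M_gt0 pM.
  have v2 : valid (leaf2 p) by apply: (valid_leaf2 (M := M)).
  have v3 : valid (center p) by apply: (valid_center (M := M)).
  have t0 : valid (Ln p 0) by rewrite /= pM.
  have t1 : valid (Ln p (2 * Dlen)) by rewrite /= pM /spider_size ltnS leq_addr.
  have t2 : valid (Ln p (2 * Dlen + Llen)) by rewrite /= pM /spider_size ltnSn.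
  rewrite !inE => /or3P[]/eqP[-> ->]; split=> //=.
  - by rewrite -/(leaf1 p) !eqxx.
  - by rewrite -/(leaf2 p) !eqxx orbT.
  - by rewrite -/(center p) !eqxx !orbT.
set S1 := flatten _; set S2 := flatten [seq hub_edges h | h <- _].
case: a b => [i|p k|h t] [j|p' k'|h' t'] [] //=; rewrite {}/S1 {}/S2.
- move=> /andP[pM k7] jM /andP[lM jE]; apply/orP; left.
  apply/flatten_mapP; exists p; first by rewrite mem_iota.
  apply/flatten_mapP; exists k; first by rewrite mem_iota.
  by rewrite /cell_edges lM !inE; case/orP: jE => /eqP->; rewrite eqxx ?orbT.
- move=> _ /andP[hM tZ] H; apply/orP; right.
  apply/flatten_mapP; exists h'; first by rewrite mem_iota.
  rewrite mem_cat !inE; apply/orP; right.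
  by case/or3P: H => /andP[/eqP-> /eqP->]; rewrite eqxx ?orbT.
- move=> /andP[hM tZ] /andP[hM' tZ'] /and3P[/eqP hh t0 /eqP tE]; apply/orP; right.
  apply/flatten_mapP; exists h'; first by rewrite mem_iota.
  rewrite mem_cat; apply/orP; left; apply/flatten_mapP; exists t'.-1.
    by rewrite mem_iota add0n /=; move: tZ' t0; rewrite /spider_size; clear; lia.
  by rewrite inE /line_edge hh tE prednK.
Qed.

Definition graph_edges : seq ('I_nv * 'I_nv) := [seq (vtx ab.1, vtx ab.2) | ab <- edge_list].

Lemma graph_adj : edge_rel graph_edges = vadj M Dlen Llen st sg ce nx kind.
Proof.
have E x y : ((x, y) \in graph_edges) = link (kind x) (kind y).
  apply/mapP/idP => [[[a b] /mem_edge_list[va vb ab] [-> ->]]|ab].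
    by rewrite /= !vtxK.
  exists (kind x, kind y); first by apply/mem_edge_list; split=> //; exact: kind_valid.
  by rewrite /= !(vtx_kind kind_valid vtxK kind_inj).
by apply/funext => x; apply/funext => y; rewrite /edge_rel !E.
Qed.

Lemma D_large : max_dist M <= Dlen.
Proof. by rewrite /max_dist /Dlen; move: M_gt0; clear; lia. Qed.

Lemma L_large : max_dist M <= Llen.
Proof.
rewrite /Llen; apply: leq_trans D_large _; apply: leq_trans (leqnSn _) _.
by apply: leq_pmull; rewrite muln_gt0.
Qed.

Lemma graph_loopless x : ~~ edge_rel graph_edges x x.
Proof. by rewrite graph_adj (vadj_irr _ _ _ _ M_gt0 D_large L_large). Qed.

Lemma graph_connect x y : connect (edge_rel graph_edges) x y.
Proof.
rewrite graph_adj.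
exact: (graph_connected st sg ce M_gt0 nx_lt nx_inj kind_valid vtxK kind_inj).
Qed.

(** [W1] is the denominator of an end outside the path in the upper bound, and [K] the number of
    vertices of a path. The unit K * W1 of water turns the upper bound into the natural number
    [threshold_nat]. *)
Definition W1 := Llen + Dlen + 3.
Definition K := (3 * M).*2.+1.
Definition unit_water := K * W1.
Definition excess := 2 * M * W1 + (2 * M).-1.
(** The size of the lower term keeps the binary digits of the terms of the threshold apart; the
    multiples of the number of vertices supply the powers of 1 / q required of the levels. *)
Definition mid_exp := size (nat_bits excess) + 4 * nv.
Definition top_exp := mid_exp + (size (nat_bits (3 * M)) + 10 * nv).
Definition threshold_nat := 2 ^ top_exp + 3 * M * 2 ^ mid_exp + excess.

Definition level (a : vkind) : nat :=
  match a with
  | Sp 0 => K * 2 ^ top_exp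
  | Sp _ => K * 2 ^ mid_exp
  | _ => unit_water * water fl a
  end.

Lemma profile_ge0_nat (u : 'I_nv) :
  (0 <= [ffun u : 'I_nv => (level (kind u))%:R : rat] u)%R.
Proof. by rewrite ffunE. Qed.

Definition reduction_instance : water_instance :=
  @WaterInstance nv graph_edges [ffun u : 'I_nv => (level (kind u))%:R%R] (vtx (Sp (3 * M)))
    (threshold_nat%:R)%R graph_loopless graph_connect profile_ge0_nat.

Lemma lt_exp_size_bits m : m < 2 ^ size (nat_bits m).
Proof.
have [k] := ubnP m; elim: k m => // k IH m mk.
have [->//|m0] := posnP m; rewrite nat_bits_half //= expnS.
have := IH m./2 _; have := odd_double_half m; rewrite mul2n.
have hm : m./2 < k by rewrite -ltnS; apply: leq_trans mk; rewrite ltnS; move: m0; clear; lia.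
by move=> E /(_ hm); case: odd E => /= E; move: (2 ^ _) => y; move: E; clear; lia.
Qed.

(** The hypothesis [B_big] with denominators cleared, where q is the inverse of 2 ^ nv; [top_large]
    does the same for [e_big]. *)
Lemma mid_large : 2 * (5 * M * unit_water) * (4 * (max_dist M).+1 * (2 ^ nv * 2 ^ nv))
  <= K * 2 ^ mid_exp.
Proof.
rewrite /unit_water /mid_exp expnD.
have ex : 2 * M * W1 <= 2 ^ size (nat_bits excess).
  by apply: leq_trans (ltnW (lt_exp_size_bits _)); rewrite /excess leq_addr.
have dn : (max_dist M).+1 <= nv.
  by rewrite /max_dist /order_pred; move: M_gt0 (2 * M * Zlen) => M0 m; move: M0; clear; lia.
have n5 : 5 <= nv.
  by rewrite /order_pred; move: M_gt0 (2 * M * Zlen) => M0 m; move: M0; clear; lia.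
have nE : nv <= 2 ^ nv by exact/ltnW/ltn_expl.
have E32 : 20 <= 2 ^ nv by apply: (@leq_trans (2 ^ 5)) => //; rewrite leq_exp2l.
have d2 : (max_dist M).+1 <= 2 ^ nv by exact: leq_trans nE.
have -> : 2 ^ (4 * nv) = 2 ^ nv * 2 ^ nv * (2 ^ nv * 2 ^ nv) by rewrite -!expnD; congr expn; lia.
move: (2 ^ nv) (2 ^ size _) (max_dist M).+1 ex d2 E32 => y x d ex dy y20.
have -> : 2 * (5 * M * (K * W1)) * (4 * d * (y * y)) = K * ((2 * M * W1) * (20 * d * (y * y))) by ring.
rewrite leq_mul2l; apply/orP; right; apply: leq_mul => //.
by rewrite mulnA mulnA; do 2?apply: leq_mul => //; exact: leq_mul.
Qed.

Lemma top_large :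
  (4 * (3 * M).+1 * (K * 2 ^ mid_exp) + 2 * (5 * M * unit_water)) *
     (2 ^ nv * ((max_dist M).+1 * (max_dist M).+1)) <= K * 2 ^ top_exp.
Proof.
have small : 2 * (5 * M * unit_water) <= K * 2 ^ mid_exp.
  apply: leq_trans mid_large; apply: leq_pmulr.
  by rewrite !muln_gt0 !expn_gt0.
have dn : (max_dist M).+1 <= nv.
  by rewrite /max_dist /order_pred; move: M_gt0 (2 * M * Zlen) => M0 m; move: M0; clear; lia.
have nn : (3 * M).+1 <= nv.
  by rewrite /order_pred; move: (2 * M * Zlen) => m; clear; lia.
have nE : nv <= 2 ^ nv by exact/ltnW/ltn_expl.
have d2 : (max_dist M).+1 <= 2 ^ nv by exact: leq_trans nE.
have n2 : (3 * M).+1 <= 2 ^ nv by exact: leq_trans nE.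
have y1 : 2 <= 2 ^ nv by rewrite -{1}(expn1 2) leq_exp2l.
have m0 : 0 < (3 * M).+1 by [].
rewrite /top_exp expnD [K * (_ * _)]mulnA; move: (K * 2 ^ mid_exp) small => B small.
have tE : 2 ^ nv * (2 ^ nv * 2 ^ nv) * (2 ^ nv * (2 ^ nv * 2 ^ nv) * 2 ^ nv) <=
    2 ^ (size (nat_bits (3 * M)) + 10 * nv).
  by rewrite -!expnD leq_exp2l //; lia.
apply: (@leq_trans (B * (2 ^ nv * (2 ^ nv * 2 ^ nv) * (2 ^ nv * (2 ^ nv * 2 ^ nv) * 2 ^ nv))));
  last by rewrite leq_mul2l tE orbT.
move: (2 ^ nv) (max_dist M).+1 (3 * M).+1 small d2 n2 y1 m0 => y d m small dy my y2 m0.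
apply: (@leq_trans (B * (5 * m) * (y * (d * d)))).
  apply: leq_mul => //.
  have -> : B * (5 * m) = 4 * m * B + B * m by ring.
  by rewrite leq_add2l (leq_trans small) // leq_pmulr.
rewrite -!mulnA leq_mul2l; apply/orP; right.
have y8 : 5 <= y * (y * y) by apply: (@leq_trans (2 * (2 * 2))) => //; rewrite !leq_mul.
apply: (@leq_trans ((y * (y * y)) * (y * (y * (y * y))))); last by rewrite !mulnA leqnn.
apply: leq_mul => //; apply: leq_mul => //; apply: leq_mul => //; exact: leq_mul.
Qed.

(** The right side minus the left side is L - 2M(D + 1) + 2D + 4, which is 2D + 4 for the chosen
    L. *)
Lemma leaf_gain : (2 * M).-1 * (Llen + 2 * Dlen + 4) < 2 * M * W1.
Proof.
rewrite /W1 /Llen; move: Dlen => d; case: M M_gt0 => // m _.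
have -> : (2 * m.+1).-1 = (2 * m).+1 by rewrite mulnS.
by rewrite -subn_gt0; lia.
Qed.

(** * Correctness of the instance *)

Section Correct.
Variable R : realType.
Local Open Scope ring_scope.

Let T : R := unit_water%:R.
Let B : R := (K * 2 ^ mid_exp)%:R.
Let e : R := (K * 2 ^ top_exp)%:R.

Lemma profile_init : (fun u => ratr (profile reduction_instance u)) = init fl T B e \o kind.
Proof.
apply/funext => u; rewrite /= ffunE ratr_nat /=.
by case: (kind u) => [[|i]|p k|h t] //=; rewrite natrM.
Qed.

Let K_gt0 : 0 < K%:R :> R. Proof. by []. Qed.
Let W1_gt0 : 0 < W1%:R :> R. Proof. by rewrite ltr0n /W1 addnS. Qed.

Lemma threshold_eq : ratr (threshold reduction_instance) =
  (e + (3 * M)%:R * B + (T * (2 * M)%:R + T / (Dlen + Llen + 3)%:R * (2 * M).-1%:R)) / K%:R :> R.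
Proof.
have -> : e = K%:R * (2 ^ top_exp)%:R by rewrite /e natrM.
have -> : B = K%:R * (2 ^ mid_exp)%:R by rewrite /B natrM.
have -> : T = K%:R * W1%:R by rewrite /T natrM.
rewrite /= ratr_nat (addnC Dlen Llen) -/W1.
have -> : threshold_nat%:R = (2 ^ top_exp)%:R + (3 * M)%:R * (2 ^ mid_exp)%:R
    + ((2 * M)%:R * W1%:R + (2 * M).-1%:R) :> R.
  rewrite -(natrM _ (2 * M)%N W1) -(natrM _ (3 * M)%N) -!natrD.
  by rewrite /threshold_nat /excess.
move: K_gt0 W1_gt0.
move: (2 ^ top_exp)%:R (2 ^ mid_exp)%:R (2 * M).-1%:R (2 * M)%:R (3 * M)%:R K%:R W1%:R.
move=> x y z m n k w k0 w0.
by field; rewrite !gt_eqF.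
Qed.

(** The threshold is exactly the bound of [network_upper]; [leaf_gain] puts the bound of
    [network_lower] strictly above it. *)
Lemma instance_correct : csp M st sg fl ce nx <->
  ratr (threshold reduction_instance) < instance_kappa R reduction_instance.
Proof.
have T0 : 0 <= T by [].
rewrite /instance_kappa /wadj profile_init [edges _]/= graph_adj.
split=> [sat|].
  have gain : ratr (threshold reduction_instance) <
     (e + (3 * M)%:R * B + T * (2 * M)%:R + M%:R * (2 * T / (Llen + 2 * Dlen + 4)%:R)) / K%:R.
    rewrite threshold_eq ltr_pM2r ?invr_gt0 // addrA ltrD2l.
    have W2_gt0 : 0 < (Llen + 2 * Dlen + 4)%:R :> R by rewrite ltr0n addnS.
    have := leaf_gain; rewrite -(ltr_nat R) !(natrM _ (2 * M).-1) (natrM _ (2 * M)) (natrM _ 2 M).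
    rewrite (addnC Dlen Llen) -/W1 /T natrM mulfK ?gt_eqF //.
    move: (2 * M).-1%:R M%:R K%:R W1%:R (Llen + 2 * Dlen + 4)%:R K_gt0 W2_gt0.
    move=> z m k w v k0 v0 zv.
    rewrite !mulrA ltr_pdivlMr // -mulrA.
    have -> : m * 2 * (k * w) = k * (2 * m * w) by ring.
    by rewrite -[k * z * v]mulrA ltr_pM2l.
  have [s ls lt] := network_lower M_gt0 nx_lt nx_inj D_large L_large kind_valid vtxK kind_inj
    T0 (ler0n R _ : 0 <= B) (ler0n R _ : 0 <= e) sat gain.
  by apply: kappa_gt ls lt => u; exact: init_ge0.
move=> lt; apply: contrapT => unsat; move: lt; rewrite ltNge => /negP; apply.
apply: kappa_le => s ls; rewrite threshold_eq.
apply: (network_upper M_gt0 ce_lt nx_lt nx_inj D_large L_large kind_valid vtxK kind_inj T0 _ _ unsat ls).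
- have := mid_large; rewrite -(ler_nat R) -/B => mid.
  rewrite /q card_ord exprVn.
  have y0 : 0 < 2%:R ^+ nv :> R by rewrite exprn_gt0.
  have d0 : 0 < (max_dist M).+1%:R :> R by [].
  move: mid; rewrite (natrM _ (2 * _)) (natrM _ 2) (natrM _ (5 * M)) (natrM _ 5) -/T.
  rewrite (natrM _ (4 * _)) (natrM _ 4) (natrM _ (2 ^ nv)) natrX.
  move: (2%:R ^+ nv) (max_dist M).+1%:R B M%:R y0 d0 => y d b m y0 d0 mid.
  rewrite (_ : b * _ = b / (4%:R * d * (y * y))); last by field; rewrite !gt_eqF.
  by rewrite ler_pdivlMr // !mulr_gt0.
- have := top_large; rewrite -(ler_nat R) -/e => top.
  rewrite /q card_ord exprVn.
  have y0 : 0 < 2%:R ^+ nv :> R by rewrite exprn_gt0.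
  have d0 : 0 < (max_dist M).+1%:R :> R by [].
  move: top; rewrite (natrM _ (_ + _)) natrD (natrM _ (4 * _)) (natrM _ 4) -/B.
  rewrite (natrM _ 2) (natrM _ (5 * M)) (natrM _ 5) -/T.
  rewrite (natrM _ (2 ^ nv)) (natrM _ (max_dist M).+1) natrX.
  move: (2%:R ^+ nv) (max_dist M).+1%:R B M%:R y0 d0 => y d b m y0 d0 top.
  rewrite (_ : e * _ = e / (y * (d * d))); last by field; rewrite !gt_eqF.
  by rewrite ler_pdivlMr // !mulr_gt0.
Qed.

End Correct.

End Instance.

(** * Reading the formula *)

Lemma sum_eq0P m (P : nat -> bool) :
  reflect (forall j, j < m -> ~~ P j) (\sum_(j < m) P j == 0).
Proof.
rewrite sum_nat_eq0; apply: (iffP forallP) => H j; first by move=> jm; have := H (Ordinal jm); rewrite eqb0.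
by apply/implyP => _; rewrite eqb0; apply: H.
Qed.


(** * Cyclic successors in the classes of an equivalence relation *)

Section Cyclic.
Variables (M : nat) (same : nat -> nat -> bool).

Definition wrap_around (x : nat) : nat := if x < M then x else x - M.

(** A least-index search written with bounded sums, the form that stack programs can evaluate. The
    position [p] itself comes last, at index M - 1, so a position alone in its class is its own
    successor. *)
Definition next (p : nat) : nat :=
  wrap_around (p.+1 + \sum_(k < M) (\sum_(j < k.+1) same p (wrap_around (p.+1 + j)) == 0)).

Hypothesis same_refl : forall p, p < M -> same p p.
Hypothesis same_sym : forall p q, p < M -> q < M -> same p q -> same q p.
Hypothesis same_trans : forall p q r, p < M -> q < M -> r < M -> same p q -> same q r -> same p r.

Lemma wrap_around_lt p j : p < M -> j < M -> wrap_around (p.+1 + j) < M.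
Proof. by rewrite /wrap_around; case: ifP => //; lia. Qed.

(* The inner condition says that P fails up to k, so the sum finds the first
   index satisfying P. *)
Lemma sum_first m (P : nat -> bool) k0 : k0 < m -> P k0 -> (forall j, j < k0 -> ~~ P j) ->
  \sum_(k < m) (\sum_(j < k.+1) P j == 0) = k0.
Proof.
move=> k0m Pk0 first_k0.
have E k : (\sum_(j < k.+1) P j == 0) = (k < k0).
  apply/sum_eq0P/idP => [H|kk j jk]; last by apply: first_k0; exact: leq_trans kk.
  by rewrite ltnNge; apply/negP => k0k; have := H k0 k0k; rewrite Pk0.
rewrite (eq_bigr (fun k : 'I_m => nat_of_bool (k < k0))); last by move=> k _; rewrite E.
rewrite -(big_mkord predT (fun k => nat_of_bool (k < k0))) (@big_cat_nat _ _ _ k0) //=; last exact: ltnW.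
rewrite !big_nat (eq_bigr (fun=> 1)) => [|k /andP[_ ->]//].
rewrite [X in _ + X]big1 => [|k /andP[kk _]]; last by rewrite ltnNge kk.
by rewrite addn0 -big_nat sum_nat_const_nat subn0 muln1.
Qed.

Lemma nextP p : p < M -> exists s, [/\ s < M, next p = wrap_around (p.+1 + s),
  same p (wrap_around (p.+1 + s)) & forall j, j < s -> ~~ same p (wrap_around (p.+1 + j))].
Proof.
move=> pM; pose P j := (j < M) && same p (wrap_around (p.+1 + j)).
have exP : exists s, P s.
  exists M.-1; rewrite /P; have -> : wrap_around (p.+1 + M.-1) = p by rewrite /wrap_around; case: ifP; lia.
  by rewrite same_refl // andbT; lia.
have [s /andP[sM ss] smin] := ex_minnP exP; exists s.
have fs j : j < s -> ~~ same p (wrap_around (p.+1 + j)).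
  move=> js; apply/negP => sj; have := smin j; rewrite /P sj (ltn_trans js sM) => /(_ isT).
  by rewrite leqNgt js.
split=> //; rewrite /next; congr (wrap_around (_ + _)).
exact: (@sum_first M (fun j => same p (wrap_around (p.+1 + j)))).
Qed.

Lemma next_lt p : p < M -> next p < M.
Proof. by move=> pM; have [s [sM -> _ _]] := nextP pM; exact: wrap_around_lt. Qed.

Lemma next_same p : p < M -> same p (next p).
Proof. by move=> pM; have [s [_ -> ? _]] := nextP pM. Qed.

(** If two positions of a class had the same successor at different distances, the nearer one would
    have been met first on the way from the other. *)
Lemma next_inj p q : p < M -> q < M -> next p = next q -> p = q.
Proof.
move=> pM qM E.
have spq : same p q.
  apply: (same_trans (q := next p)) => //; try exact: next_lt; first exact: next_same.
  by rewrite E; apply: same_sym => //; [exact: next_lt|exact: next_same].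
have sqp := same_sym pM qM spq.
have [s [sM Es _ fs]] := nextP pM; have [t [tM Et _ ft]] := nextP qM.
rewrite Es Et in E; have [st|st|st] := ltngtP s t.
- have := ft (t - s).-1 _; have -> : wrap_around (q.+1 + (t - s).-1) = p.
    by move: E; rewrite /wrap_around; do ?case: ifP; move: pM qM sM tM st; clear; lia.
  by rewrite sqp => H; suff: false by []; apply: H; lia.
- have := fs (s - t).-1 _; have -> : wrap_around (p.+1 + (s - t).-1) = q.
    by move: E; rewrite /wrap_around; do ?case: ifP; move: pM qM sM tM st; clear; lia.
  by rewrite spq => H; suff: false by []; apply: H; lia.
- by move: E; rewrite st /wrap_around; do ?case: ifP; move: pM qM sM tM; clear; lia.
Qed.

(** A walk along [next] within the class cannot jump over [q], so the cyclic distance to [q]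
    decreases until it is reached. *)
Lemma next_closure (a : nat -> bool) : (forall p, p < M -> a p -> a (next p)) ->
  forall p q, p < M -> q < M -> same p q -> a p -> a q.
Proof.
move=> cl p q pM qM; pose d p := if p <= q then q - p else q + M - p.
have [k] := ubnP (d p); elim: k p pM => // k IH p pM dk spq ap.
have [<-//|/eqP pq] := eqVneq p q.
have [s [sM Es ss fs]] := nextP pM.
have d0 : 0 < d p by rewrite /d; case: ifP; move: pM qM pq; clear; lia.
have Eq : wrap_around (p.+1 + (d p).-1) = q.
  by rewrite /wrap_around /d; do ?case: ifP; move: pM qM pq; clear; lia.
have sd : s <= (d p).-1.
  by rewrite leqNgt; apply/negP => /fs; rewrite Eq spq.
apply: (IH (next p)); rewrite ?next_lt ?cl //.
- rewrite Es; move: dk sd d0; rewrite /wrap_around /d; do ?case: ifP;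
    move: pM qM sM pq; clear; lia.
- apply: (same_trans (q := p)) => //; first exact: next_lt.
  by apply: same_sym => //; [exact: next_lt|exact: next_same].
Qed.

End Cyclic.

(** * Literals and clauses in the encoded word *)

Section Strings.
Variable w : word.
Local Notation M := (size w).

Definition is_bit (i : nat) : bool := symbol_at w i (Bit true) || symbol_at w i (Bit false).
(** A literal begins with its sign, which opens the word or follows a separator; every later bit of
    the literal follows a bit. *)
Definition starts (p : nat) : bool := is_bit p && ((p == 0) || ~~ is_bit p.-1).
Definition sign (p : nat) : bool := symbol_at w p (Bit true).
(** Bounded quantifiers are sums required to vanish, so that [computable_sum] applies. *)
Definition absent (a : symbol) (p t : nat) : bool := \sum_(j < t) symbol_at w (p + j) a == 0.
Definition clause_end (p : nat) : nat := p + \sum_(k < M) absent Semicolon p k.+1.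
Definition agree (i j : nat) : bool :=
  [|| symbol_at w i (Bit true) && symbol_at w j (Bit true),
      symbol_at w i (Bit false) && symbol_at w j (Bit false) |
      symbol_at w i Comma && symbol_at w j Comma].
(** Compares up to and including the first comma, which decides equality because [encode_nat] is
    prefix-free. *)
Definition same_name (p q : nat) : bool :=
  \sum_(t < M) (absent Comma p.+1 t && ~~ agree (p.+1 + t) (q.+1 + t)) == 0.
(** A position where no literal starts is related only to itself; its truth value is an
    unconstrained dummy. *)
Definition same_var (p q : nat) : bool :=
  (p == q) || [&& starts p, starts q & same_name p q].
Definition next_occ : nat -> nat := next M same_var.
(** The last semicolon of the word closes the formula, not a clause. *)
Definition clause_stop (e : nat) : bool := symbol_at w e Semicolon && (e.+1 < M).

Definition names (p v : nat) : Prop := exists r, drop p.+1 w = encode_nat v ++ r.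

Lemma nat_bits_inj : injective nat_bits.
Proof.
move=> m; have [k] := ubnP m; elim: k m => // k IH m mk n.
have [->|m0] := posnP m; have [->//|n0] := posnP n; rewrite ?nat_bits0 ?(nat_bits_half m0) ?(nat_bits_half n0) //.
move=> [om] /IH hm; rewrite -(odd_double_half m) -(odd_double_half n) om hm //.
by rewrite -ltnS; apply: leq_trans mk; rewrite ltnS; move: m0; clear; lia.
Qed.

Lemma encode_nat_prefix v v' r r' : encode_nat v ++ r = encode_nat v' ++ r' -> v = v'.
Proof.
rewrite /encode_nat !cat_rcons => E; apply: nat_bits_inj.
elim: (nat_bits v) (nat_bits v') E => [|b s IH] [|b' s'] //= [].
by move=> -> /IH->.
Qed.

Lemma names_inj p v v' : names p v -> names p v' -> v = v'.
Proof. by move=> [r E] [r']; rewrite E; exact: encode_nat_prefix. Qed.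

Lemma symbol_atE i a : i < M -> symbol_at w i a = (nth Comma w i == a).
Proof. by rewrite /symbol_at => ->. Qed.

Lemma absentP a p t : reflect (forall j, j < t -> ~~ symbol_at w (p + j) a) (absent a p t).
Proof. exact: (@sum_eq0P t (fun j => symbol_at w (p + j) a)). Qed.

Lemma names_nth p v r t : drop p.+1 w = encode_nat v ++ r -> t < size (encode_nat v) ->
  p.+1 + t < M /\ nth Comma w (p.+1 + t) = nth Comma (encode_nat v) t.
Proof.
move=> E tE; have : size (drop p.+1 w) = size (encode_nat v) + size r by rewrite E size_cat.
rewrite size_drop => sz; split; first by move: sz tE; clear; lia.
by rewrite -nth_drop E nth_cat tE.
Qed.

Lemma size_encode_nat v : size (encode_nat v) = (size (nat_bits v)).+1.
Proof. by rewrite /encode_nat size_rcons size_map. Qed.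

Lemma nth_encode_nat v t : t < size (encode_nat v) ->
  (nth Comma (encode_nat v) t == Comma) = (t == size (nat_bits v)).
Proof.
rewrite size_encode_nat ltnS leq_eqVlt => /orP[/eqP->|tb].
  by rewrite /encode_nat nth_rcons size_map ltnn !eqxx.
rewrite /encode_nat nth_rcons size_map tb (nth_map false) //.
by rewrite ltn_eqF.
Qed.

Lemma nth_encode_nat_bit v t : t < size (nat_bits v) ->
  exists b, nth Comma (encode_nat v) t = Bit b.
Proof.
move=> tb; exists (nth false (nat_bits v) t).
by rewrite /encode_nat nth_rcons size_map tb (nth_map false).
Qed.

Lemma agree_nth i j : i < M -> agree i j -> j < M /\ nth Comma w i = nth Comma w j.
Proof.
move=> iM; rewrite /agree /symbol_at iM /= => /or3P[]/and3P[/eqP-> -> /eqP->] //.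
Qed.

Lemma nth_agree i j : i < M -> j < M -> nth Comma w i = nth Comma w j ->
  nth Comma w i != Semicolon -> agree i j.
Proof.
move=> iM jM E; rewrite /agree !symbol_atE // -E.
by case: (nth _ _ _) => // -[]; rewrite ?eqxx ?orbT.
Qed.

Lemma same_nameP p q v v' : names p v -> names q v' -> same_name p q = (v == v').
Proof.
move=> [r E] [r' E']; apply/(@sum_eq0P M (fun t => absent Comma p.+1 t && ~~ agree (p.+1 + t) (q.+1 + t)))/eqP.
  move=> H; have ag t : t < size (encode_nat v) -> agree (p.+1 + t) (q.+1 + t).
    move=> tE; have [tM _] := names_nth E tE.
    have ab : absent Comma p.+1 t.
      apply/absentP => j jt; have jE := ltn_trans jt tE; have [jM jn] := names_nth E jE.
      rewrite symbol_atE // jn nth_encode_nat // ltn_eqF //.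
      by move: tE jt; rewrite size_encode_nat; clear; lia.
    have tM' : t < M by move: tM; clear; lia.
    by have := H t tM'; rewrite ab /= negbK.
  have E2 : take (size (encode_nat v)) (drop q.+1 w) = encode_nat v.
    apply: (@eq_from_nth _ Comma).
      rewrite size_take size_drop; case: ltnP => // le.
      have l1 : (size (encode_nat v)).-1 < size (encode_nat v) by rewrite size_encode_nat.
      have [tM _] := names_nth E l1.
      have [jM _] := agree_nth tM (ag _ l1).
      by move: le jM; rewrite size_encode_nat; clear; lia.
    move=> t; rewrite size_take size_drop => tlt.
    have tE : t < size (encode_nat v) by move: tlt; case: ifP; clear; lia.
    rewrite nth_take // nth_drop; have [tM tn] := names_nth E tE.
    by have [_ <-] := agree_nth tM (ag t tE).
  apply: (@names_inj q); last by exists r'.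
  by exists (drop (size (encode_nat v)) (drop q.+1 w)); rewrite -{1}E2 cat_take_drop.
move=> vv t tM; rewrite -vv in E'.
have [tE|tE] := ltnP t (size (encode_nat v)).
  have [iM ni] := names_nth E tE; have [jM nj] := names_nth E' tE.
  rewrite negb_and negbK nth_agree ?orbT ?ni ?nj //.
  have [/nth_encode_nat_bit[b ->]//|le] := ltnP t (size (nat_bits v)).
  have := nth_encode_nat tE; rewrite eqn_leq le andbT.
  by rewrite -ltnS -size_encode_nat tE => /eqP->.
rewrite negb_and; apply/orP; left; apply/absentP => H.
have l1 : (size (nat_bits v)) < size (encode_nat v) by rewrite size_encode_nat.
have [iM ni] := names_nth E l1; have := H (size (nat_bits v)).
by rewrite symbol_atE // ni nth_encode_nat // eqxx => /(_ (leq_trans l1 tE)).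
Qed.

Lemma clause_endE p e : p <= e -> e < M -> symbol_at w e Semicolon ->
  (forall i, p <= i < e -> ~~ symbol_at w i Semicolon) -> clause_end p = e.
Proof.
move=> pe eM se H; rewrite /clause_end /absent.
rewrite (@sum_first M (fun j => symbol_at w (p + j) Semicolon) (e - p)) ?subnKC //.
  by move: eM; clear; lia.
by move=> j jp; apply: H; move: jp pe; clear; lia.
Qed.

End Strings.

Lemma flatten_split (T U : Type) (f : T -> seq U) s p : p < size (flatten (map f s)) ->
  exists s1 x s2 r, [/\ s = s1 ++ x :: s2, p = size (flatten (map f s1)) + r & r < size (f x)].
Proof.
elim: s p => [|x s IH] p //=; rewrite size_cat => ps.
have [px|px] := ltnP p (size (f x)); first by exists [::], x, s, p.
have [|s1 [y [s2 [r [-> E r_lt]]]]] := IH (p - size (f x)); first by move: ps px; clear; lia.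
exists (x :: s1), y, s2, r; split=> //=; rewrite size_cat -addnA -E subnKC //.
Qed.

(** * Satisfiability as a constraint problem on positions *)

Section Formula.
Variable F : cnf.
Let w := encode_cnf F.
Local Notation M := (size w).

Definition clause_body (c : clause) : word := flatten [seq encode_literal l | l <- c].
Definition clause_words (s : cnf) : word := flatten [seq encode_list encode_literal c | c <- s].

Lemma encode_cnfE : w = clause_words F ++ [:: Semicolon].
Proof. by rewrite /w /encode_cnf /encode_list cats1. Qed.

Lemma size_pos : 0 < M.
Proof. by rewrite encode_cnfE size_cat addn1. Qed.

Lemma encode_clauseE c : encode_list encode_literal c = clause_body c ++ [:: Semicolon].
Proof. by rewrite /encode_list cats1. Qed.

Lemma clause_split F1 c F2 : F = F1 ++ c :: F2 ->
  w = clause_words F1 ++ clause_body c ++ Semicolon :: clause_words F2 ++ [:: Semicolon].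
Proof.
move=> FE; rewrite encode_cnfE FE /clause_words map_cat flatten_cat /= encode_clauseE.
by rewrite -!catA.
Qed.

Lemma literal_split F1 c1 l c2 F2 : F = F1 ++ (c1 ++ l :: c2) :: F2 ->
  exists r, w = (clause_words F1 ++ clause_body c1) ++ encode_literal l ++ r.
Proof.
move=> /clause_split->.
exists (clause_body c2 ++ Semicolon :: clause_words F2 ++ [:: Semicolon]).
have -> : clause_body (c1 ++ l :: c2) = clause_body c1 ++ encode_literal l ++ clause_body c2.
  by rewrite /clause_body map_cat flatten_cat.
by rewrite -!catA.
Qed.

Definition bit_symbol (a : symbol) : bool := (a == Bit true) || (a == Bit false).

Lemma is_bitE i : i < M -> is_bit w i = bit_symbol (nth Comma w i).
Proof. by move=> iM; rewrite /is_bit !symbol_atE. Qed.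

Lemma last_body x c : ~~ bit_symbol x -> ~~ bit_symbol (last x (clause_body c)).
Proof.
elim: c x => // l c IH x nb; rewrite /clause_body /= -/(clause_body c) last_cat; apply: IH.
by rewrite /= /encode_nat last_rcons.
Qed.

Lemma last_clauses x s : ~~ bit_symbol x -> ~~ bit_symbol (last x (clause_words s)).
Proof.
elim: s x => // c s IH x nb; rewrite /clause_words /= -/(clause_words s) last_cat; apply: IH.
by rewrite /encode_list last_rcons.
Qed.

Lemma body_no_semicolon c : Semicolon \notin clause_body c.
Proof.
apply/negP => /flatten_mapP[l _]; rewrite in_cons /= mem_rcons in_cons /=.
by move=> /mapP[].
Qed.

Lemma size_encode_literal l : size (encode_literal l) = (size (nat_bits l.2)).+2.
Proof. by rewrite /= size_encode_nat. Qed.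

Lemma nth_literal_bit l r : r < size (encode_literal l) ->
  bit_symbol (nth Comma (encode_literal l) r) = (r <= size (nat_bits l.2)).
Proof.
case: r => [|r]; first by case: l => [[] v].
rewrite size_encode_literal !ltnS => rl /=.
move: rl; rewrite leq_eqVlt => /orP[/eqP->|rb].
  have := @nth_encode_nat l.2 (size (nat_bits l.2)); rewrite size_encode_nat eqxx ltnn.
  by move=> /(_ (ltnSn _)) /eqP->.
by have [b ->] := nth_encode_nat_bit rb; rewrite rb; case: b.
Qed.

Lemma clause_end_lt F1 c F2 : F = F1 ++ c :: F2 ->
  let e := size (clause_words F1) + size (clause_body c) in
  [/\ clause_stop w e & forall p, size (clause_words F1) <= p <= e -> clause_end w p = e].
Proof.
move=> FE e; have wE := clause_split FE.
have eM : e.+1 < M.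
  by rewrite wE !size_cat /= size_cat /= /e; clear; lia.
have se : symbol_at w e Semicolon.
  rewrite symbol_atE ?(ltnW eM) // wE /e nth_cat ltnNge leq_addr /= addKn nth_cat ltnn subnn /=.
  exact: eqxx.
split=> [|p /andP[p1 pe]]; first by rewrite /clause_stop se.
apply: clause_endE => //; first exact: ltnW.
move=> i /andP[pi ie]; rewrite symbol_atE; last by apply: ltn_trans (ltnW eM).
have i1 : size (clause_words F1) <= i by exact: leq_trans pi.
have ib : i - size (clause_words F1) < size (clause_body c) by move: ie i1; rewrite /e; clear; lia.
rewrite wE nth_cat ltnNge i1 /= nth_cat ib.
by apply: contraNneq (body_no_semicolon c) => <-; apply: mem_nth.
Qed.

Lemma literal_position F1 c1 l c2 F2 : F = F1 ++ (c1 ++ l :: c2) :: F2 ->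
  let p := size (clause_words F1) + size (clause_body c1) in
  [/\ p < M, starts w p, sign w p = l.1, names w p l.2 &
      clause_end w p = size (clause_words F1) + size (clause_body (c1 ++ l :: c2))].
Proof.
move=> FE p; have [r wE] := literal_split FE.
have pE : p = size (clause_words F1 ++ clause_body c1) by rewrite size_cat.
have pM : p < M by rewrite wE !size_cat -size_cat -pE size_encode_literal; clear; lia.
have np : nth Comma w p = Bit l.1 by rewrite wE pE nth_cat ltnn subnn.
split=> //.
- rewrite /starts is_bitE // np; apply/andP; split; first by case: (l.1).
  have [//|p0] := posnP p; apply/orP; right; rewrite is_bitE; last by move: pM; clear; lia.
  have -> : nth Comma w p.-1 = last Comma (clause_words F1 ++ clause_body c1).
    by rewrite -nth_last -pE wE nth_cat -pE prednK // leqnn.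
  by rewrite last_cat; apply/last_body/last_clauses.
- by rewrite /sign symbol_atE // np; case: (l.1).
- exists r; rewrite wE pE -addn1 addnC -drop_drop drop_size_cat //=.
  by rewrite drop0.
- have [_ H] := clause_end_lt FE; apply: H.
  by rewrite leq_addr leq_add2l /clause_body map_cat flatten_cat size_cat leq_addr.
Qed.

Lemma stop_split e : clause_stop w e -> exists F1 c F2,
  F = F1 ++ c :: F2 /\ e = size (clause_words F1) + size (clause_body c).
Proof.
case/andP => se eM.
have el : e < size (clause_words F) by move: eM; rewrite encode_cnfE size_cat addn1 ltnS.
have [F1 [c [F2 [r [FE eE r_lt]]]]] := flatten_split el.
exists F1, c, F2; split=> //; rewrite eE; congr addn.
move: r_lt; rewrite encode_clauseE size_cat addn1 ltnS leq_eqVlt => /orP[/eqP//|rb].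
move: se; rewrite symbol_atE ?(ltnW eM) // (clause_split FE) eE nth_cat ltnNge leq_addr /= addKn nth_cat rb.
by move=> /eqP sr; case/negP: (body_no_semicolon c); rewrite -sr mem_nth.
Qed.

Lemma start_split p : p < M -> starts w p -> exists F1 c1 l c2 F2,
  F = F1 ++ (c1 ++ l :: c2) :: F2 /\ p = size (clause_words F1) + size (clause_body c1).
Proof.
move=> pM /andP[bp nbp]; rewrite is_bitE // in bp.
have pl : p < size (clause_words F).
  move: pM; rewrite {1}encode_cnfE size_cat addn1 ltnS leq_eqVlt => /orP[/eqP pE|//].
  have nS : nth Comma w (size (clause_words F)) = Semicolon by rewrite {1}encode_cnfE nth_cat ltnn subnn.
  by move: bp; rewrite pE nS.
have [F1 [c [F2 [r [FE pE r_lt]]]]] := flatten_split pl; rewrite -/(clause_words F1) in pE.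
have rb : r < size (clause_body c).
  move: r_lt; rewrite encode_clauseE size_cat addn1 ltnS leq_eqVlt => /orP[/eqP rE|//].
  by move: bp; rewrite (clause_split FE) pE nth_cat ltnNge leq_addr /= addKn rE nth_cat ltnn subnn.
have [c1 [l [c2 [k [cE rE k_lt]]]]] := flatten_split rb; rewrite -/(clause_body c1) in rE.
exists F1, c1, l, c2, F2; rewrite -cE; split=> //.
(* The offset in the literal is 0: otherwise the letter before [p] would belong to the same literal
   and be a bit. *)
suff k0 : k = 0 by rewrite pE rE k0 addn0.
have [//|k_pos] := posnP k.
rewrite cE in FE; have [q wE] := literal_split FE.
have nthE j : j < size (encode_literal l) ->
    nth Comma w (size (clause_words F1) + size (clause_body c1) + j) = nth Comma (encode_literal l) j.
  by move=> jl; rewrite wE -size_cat nth_cat ltnNge leq_addr [~~ true]/= addKn nth_cat jl.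
have pk : p = size (clause_words F1) + size (clause_body c1) + k by rewrite pE rE addnA.
rewrite pk nthE // nth_literal_bit // in bp.
have pk1 : p.-1 = size (clause_words F1) + size (clause_body c1) + k.-1.
  by rewrite pk; move: k_pos; clear; lia.
have p0 : (p == 0) = false by apply/eqP; move: pk k_pos; clear; lia.
have k1 : k.-1 < size (encode_literal l) by move: k_lt; clear; lia.
move: nbp; rewrite p0 is_bitE /=; last by move: pM; clear; lia.
by rewrite pk1 nthE // nth_literal_bit // (leq_trans (leq_pred k) bp).
Qed.

(** Every clause contributes at least its semicolon, so clauses with different numbers of
    predecessors end at different positions. *)
Lemma clause_unique F1 c F2 F1' c' F2' : F = F1 ++ c :: F2 -> F = F1' ++ c' :: F2' ->
  size (clause_words F1) + size (clause_body c) = size (clause_words F1') + size (clause_body c') ->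
  c = c'.
Proof.
move=> ->; elim: F1 F1' => [|x F1 IH] [|y F1'] /= [].
- by [].
- move=> -> _; rewrite /clause_words /= size_cat encode_clauseE size_cat /=; clear; lia.
- move=> -> _; rewrite /clause_words /= size_cat encode_clauseE size_cat /=; clear; lia.
- move=> -> /IH H; rewrite /clause_words /= !size_cat -!addnA => /addnI; exact: H.
Qed.

Lemma starts_names p : p < M -> starts w p -> exists v, names w p v.
Proof.
move=> pM sp; have [F1 [c1 [l [c2 [F2 [FE ->]]]]]] := start_split pM sp.
by have [_ _ _ nv _] := literal_position FE; exists l.2.
Qed.

Lemma starts_clause_end p : p < M -> starts w p -> clause_end w p < M.
Proof.
move=> pM sp; have [F1 [c1 [l [c2 [F2 [FE E]]]]]] := start_split pM sp.
have [_ _ _ _ ce] := literal_position FE; rewrite {1}E ce.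
by have [/andP[_ /ltnW]] := clause_end_lt FE.
Qed.

Lemma same_varP p q v : p < M -> q < M -> starts w p -> starts w q -> names w p v ->
  same_var w p q <-> names w q v.
Proof.
move=> pM qM sp sq pv; have [v' qv] := starts_names qM sq.
rewrite /same_var sp sq /= (same_nameP pv qv); split.
  by case/orP => /eqP E; [rewrite -E|rewrite E].
by move=> /(names_inj qv)->; rewrite eqxx orbT.
Qed.

Lemma same_var_refl p : p < M -> same_var w p p.
Proof. by rewrite /same_var eqxx. Qed.

Lemma same_var_sym p q : p < M -> q < M -> same_var w p q -> same_var w q p.
Proof.
move=> pM qM spq; move: (spq); rewrite {1}/same_var => /orP[/eqP->|/and3P[sp sq _]].
  exact: same_var_refl.
have [v pv] := starts_names pM sp; have qv : names w q v by apply/(same_varP (p := p)).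
by apply/(same_varP qM pM sq sp qv).
Qed.

Lemma same_var_trans p q r : p < M -> q < M -> r < M ->
  same_var w p q -> same_var w q r -> same_var w p r.
Proof.
move=> pM qM rM spq sqr; move: (spq) (sqr); rewrite {1 2}/same_var.
move=> /orP[/eqP->//|/and3P[sp sq _]] /orP[/eqP<-//|/and3P[_ sr _]].
have [v pv] := starts_names pM sp.
have qv : names w q v by apply/(same_varP pM qM sp sq pv).
by apply/(same_varP pM rM sp sr pv); apply/(same_varP qM rM sq sr qv).
Qed.

Lemma next_occ_lt p : p < M -> next_occ w p < M.
Proof. exact: next_lt same_var_refl _. Qed.

Lemma next_occ_inj p q : p < M -> q < M -> next_occ w p = next_occ w q -> p = q.
Proof. exact: next_inj same_var_refl same_var_sym same_var_trans _ _. Qed.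

Theorem satisfiable_csp :
  satisfiable F <-> csp M (starts w) (sign w) (clause_stop w) (clause_end w) (next_occ w).
Proof.
split=> [[al sat]|[a [a_nx a_stop]]].
  exists (fun p => starts w p && `[< exists v, names w p v /\ al v >]); split.
    move=> p pM /andP[sp /asboolP[v [pv av]]].
    have nM := next_occ_lt pM; have sn := next_same same_var_refl pM.
    have st : starts w (next_occ w p).
      by move: sn; rewrite {1}/same_var -/(next_occ w p) => /orP[/eqP<-|/and3P[]].
    rewrite st; apply/asboolP; exists v; split=> //.
    exact/(same_varP pM nM sp st pv).
  move=> e eM /stop_split[F1 [c [F2 [FE eE]]]].
  have /allP/(_ c) := sat; rewrite FE mem_cat mem_head orbT => /(_ isT)/hasP[l lc].
  rewrite /literal_true => /eqP al_l.
  have [c1 [c2 cE]] : exists c1 c2, c = c1 ++ l :: c2.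
    by case/path.splitPr: lc => c1 c2; exists c1, c2.
  have FE' := FE; rewrite cE in FE'.
  have [pM sp gp pv ce] := literal_position FE'.
  exists (size (clause_words F1) + size (clause_body c1)); split=> //.
    by rewrite ce -cE eE.
  rewrite sp gp /= -al_l; apply/idP/idP => [/asboolP[v [pv' av]]|av]; last (apply/asboolP).
    by rewrite (names_inj pv pv').
  by exists l.2.
(* A variable is true if some occurrence is; by [next_closure] all its occurrences agree. *)
exists (fun v => `[< exists p, [/\ p < M, starts w p, names w p v & a p] >]).
apply/allP => c cF.
have [F1 [F2 FE]] : exists F1 F2, F = F1 ++ c :: F2.
  by case/path.splitPr: cF => F1 F2; exists F1, F2.
have [stop _] := clause_end_lt FE.
have eM : size (clause_words F1) + size (clause_body c) < M by case/andP: stop => _ /ltnW.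
have [p [pM sp ce ap]] := a_stop _ eM stop.
have [F1' [c1 [l [c2 [F2' [FE' pE]]]]]] := start_split pM sp.
have := literal_position FE'; rewrite -pE => -[_ _ gp pv ce'].
have cc : c = c1 ++ l :: c2 by apply: (clause_unique FE FE'); rewrite -ce' -ce.
apply/hasP; exists l; first by rewrite cc mem_cat mem_head orbT.
rewrite /literal_true -gp -ap; apply/eqP; apply/idP/idP => [/asboolP[q [qM sq qv aq]]|apt]; last by apply/asboolP; exists p.
apply: (next_closure same_var_refl same_var_sym same_var_trans a_nx qM pM _ aq).
exact/(same_varP qM pM sq sp qv).
Qed.

End Formula.

(** * Computability of the reduction *)

Lemma computable_succ f : computable f -> computable (fun w env => (f w env).+1).
Proof.
move=> cf; apply: computable_ext (computable_add (computable_const 1) cf) => w env.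
by rewrite add1n.
Qed.

Lemma computable_mul f g : computable f -> computable g ->
  computable (fun w env => f w env * g w env).
Proof.
move=> cf cg; have := @computable_sum f (fun w env _ => g w env) cf (computable_weak cg).
by apply: computable_ext => w env; rewrite sum_nat_const card_ord.
Qed.

Lemma computable_leq f g : computable f -> computable g ->
  computable (fun w env => f w env <= g w env).
Proof.
move=> cf cg; have := computable_sub (computable_const 1) (computable_sub cf cg).
by apply: computable_ext => w env; rewrite -subn_eq0; case: (_ - _) => // n; rewrite subn0.
Qed.

Lemma computable_neg (c : word -> seq nat -> bool) : computable c ->
  computable (fun w env => ~~ c w env).
Proof.
move=> cc; have := computable_sub (computable_const 1) cc.
by apply: computable_ext => w env; case: (c w env).
Qed.

Lemma computable_and (c d : word -> seq nat -> bool) : computable c -> computable d ->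
  computable (fun w env => c w env && d w env).
Proof.
move=> cc cd; apply: computable_ext (computable_mul cc cd) => w env.
by case: (c w env); case: (d w env).
Qed.

Lemma computable_or (c d : word -> seq nat -> bool) : computable c -> computable d ->
  computable (fun w env => c w env || d w env).
Proof.
move=> cc cd; have := computable_neg (computable_and (computable_neg cc) (computable_neg cd)).
by apply: computable_ext => w env; rewrite -negb_or negbK.
Qed.

Lemma computable_eq f g : computable f -> computable g ->
  computable (fun w env => f w env == g w env).
Proof.
move=> cf cg; have := computable_and (computable_leq cf cg) (computable_leq cg cf).
by apply: computable_ext => w env; rewrite eqn_leq.
Qed.

Lemma computable_eqb (c d : word -> seq nat -> bool) : computable c -> computable d ->
  computable (fun w env => c w env == d w env).
Proof.
move=> cc cd; apply: computable_ext (computable_eq cc cd) => w env.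
by case: (c w env); case: (d w env).
Qed.

Lemma computable_cond (c : word -> seq nat -> bool) f g : computable c ->
  computable f -> computable g -> computable (fun w env => if c w env then f w env else g w env).
Proof.
move=> cc cf cg.
have := computable_add (computable_mul cc cf) (computable_mul (computable_neg cc) cg).
by apply: computable_ext => w env; case: (c w env); rewrite ?mul1n ?mul0n ?addn0.
Qed.

(** The quotient counts the positive multiples of [d] up to the value. *)
Lemma computable_div d f : 0 < d -> computable f -> computable (fun w env => f w env %/ d).
Proof.
move=> d0 cf.
have := @computable_sum f (fun w env i => d * i.+1 <= f w env) cf
  (computable_leq (computable_mul (computable_const d) (computable_succ (computable_var 0)))
    (computable_weak cf)).
apply: computable_ext => w env; move: (f w env) => n.
have H k : \sum_(i < k) (d * i.+1 <= n) = minn k (n %/ d).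
  elim: k => [|k IH]; first by rewrite big_ord0 min0n.
  rewrite big_ord_recr /= IH mulnC -leq_divRL //; case: leqP; lia.
by rewrite H; have := leq_div n d; lia.
Qed.

Lemma computable_mod d f : 0 < d -> computable f -> computable (fun w env => f w env %% d).
Proof.
move=> d0 cf.
have := computable_sub cf (computable_mul (computable_div d0 cf) (computable_const d)).
by apply: computable_ext => w env; rewrite {2}(divn_eq (f w env) d) addKn.
Qed.

Lemma computable_half f : computable f -> computable (fun w env => (f w env)./2).
Proof. by move=> cf; apply: computable_ext (@computable_div 2 _ isT cf) => w env; rewrite divn2. Qed.

Lemma computable_odd f : computable f -> computable (fun w env => odd (f w env)).
Proof. by move=> cf; apply: computable_ext (@computable_mod 2 _ isT cf) => w env; rewrite modn2. Qed.

Lemma computable_pred f : computable f -> computable (fun w env => (f w env).-1).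
Proof.
by move=> cf; apply: computable_ext (computable_sub cf (computable_const 1)) => w env; rewrite subn1.
Qed.

Lemma computable_double f : computable f -> computable (fun w env => (f w env).*2).
Proof.
by move=> cf; apply: computable_ext (computable_add cf cf) => w env; rewrite addnn.
Qed.

(** Proof search by the head symbol of the function, with [user] as a hook for further symbols;
    conditionals are tried last. *)
Ltac computes_with user :=
  repeat (cbv beta; first [assumption
   | match goal with H : computable _ |- _ =>
      first [exact (computable_weak H) | exact (computable_weak (computable_weak H))] end
   | user tt
   | lazymatch goal with
  | |- computable (fun w env => S (@?f w env)) => apply (@computable_succ f)
  | |- computable (fun w env => predn (@?f w env)) => apply (@computable_pred f)
  | |- computable (fun w env => double (@?f w env)) => apply (@computable_double f)
  | |- computable (fun w env => half (@?f w env)) => apply (@computable_half f)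
  | |- computable (fun w env => addn (@?f w env) (@?g w env)) => apply (@computable_add f g)
  | |- computable (fun w env => subn (@?f w env) (@?g w env)) => apply (@computable_sub f g)
  | |- computable (fun w env => muln (@?f w env) (@?g w env)) => apply (@computable_mul f g)
  | |- computable (fun w env => divn (@?f w env) 7) => apply (@computable_div 7 f isT)
  | |- computable (fun w env => modn (@?f w env) 7) => apply (@computable_mod 7 f isT)
  | |- computable (fun w env => nat_of_bool (leq (@?f w env) (@?g w env))) =>
      apply (@computable_leq f g)
  | |- computable (fun w env => nat_of_bool (@eq_op _ (@?f w env) (@?g w env))) =>
      first [apply (@computable_eq f g) | apply (@computable_eqb f g)]
  | |- computable (fun w env => nat_of_bool (andb (@?f w env) (@?g w env))) =>
      apply (@computable_and f g)
  | |- computable (fun w env => nat_of_bool (orb (@?f w env) (@?g w env))) =>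
      apply (@computable_or f g)
  | |- computable (fun w env => nat_of_bool (negb (@?f w env))) => apply (@computable_neg f)
  | |- computable (fun w env => nat_of_bool (odd (@?f w env))) => apply (@computable_odd f)
  | |- computable (fun w env => nat_of_bool (symbol_at w (@?f w env) ?a)) =>
      apply (@computable_at f a)
  | |- computable (fun w env => nth 0 env ?j) => exact (@computable_var j)
  | |- computable (fun w env => size w) => exact computable_size
  | |- computable (fun w env => ?c) => exact (@computable_const c)
  end
   | lazymatch goal with
     | |- computable (fun w env => nat_of_bool _) => fail
     | |- _ => apply computable_cond
     end]).
Ltac computes := computes_with ltac:(fun _ => fail).

Lemma computable_is_bit x : computable x -> computable (fun w env => is_bit w (x w env)).
Proof. by move=> cx; rewrite /is_bit; computes. Qed.

Lemma computable_starts x : computable x -> computable (fun w env => starts w (x w env)).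
Proof.
move=> cx; rewrite /starts.
by computes_with ltac:(fun _ => match goal with
  |- computable (fun w env => nat_of_bool (is_bit w (@?f w env))) => apply (@computable_is_bit f) end).
Qed.

Lemma computable_absent a x y : computable x -> computable y ->
  computable (fun w env => absent w a (x w env) (y w env)).
Proof.
move=> cx cy; rewrite /absent; apply: computable_eq (computable_const 0).
by apply: (@computable_sum y (fun w env j => symbol_at w (x w env + j) a)); computes.
Qed.

Lemma computable_clause_end x : computable x -> computable (fun w env => clause_end w (x w env)).
Proof.
move=> cx; rewrite /clause_end; apply: computable_add => //.
apply: (@computable_sum (fun w _ => size w) (fun w env k => absent w Semicolon (x w env) k.+1)).
  exact: computable_size.
by apply: computable_absent; computes.
Qed.

Lemma computable_same_name x y : computable x -> computable y ->
  computable (fun w env => same_name w (x w env) (y w env)).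
Proof.
move=> cx cy; rewrite /same_name; apply: computable_eq (computable_const 0).
apply: (@computable_sum (fun w _ => size w) (fun w env t =>
  absent w Comma (x w env).+1 t && ~~ agree w ((x w env).+1 + t) ((y w env).+1 + t))).
  exact: computable_size.
rewrite /agree; apply: computable_and; first by apply: computable_absent; computes.
by computes.
Qed.

Lemma computable_same_var x y : computable x -> computable y ->
  computable (fun w env => same_var w (x w env) (y w env)).
Proof.
move=> cx cy; rewrite /same_var.
by computes_with ltac:(fun _ => match goal with
  | |- computable (fun w env => nat_of_bool (starts w (@?f w env))) => apply (@computable_starts f)
  | |- computable (fun w env => nat_of_bool (same_name w (@?f w env) (@?g w env))) =>
      apply (@computable_same_name f g)
  end).
Qed.

Lemma computable_next_occ x : computable x -> computable (fun w env => next_occ w (x w env)).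
Proof.
have wrapP f : computable f -> computable (fun w env => wrap_around (size w) (f w env)).
  by move=> cf; rewrite /wrap_around; computes.
move=> cx; rewrite /next_occ /next; apply: wrapP; apply: computable_add; first by computes.
apply: (@computable_sum (fun w _ => size w) (fun w env k =>
  \sum_(j < k.+1) same_var w (x w env) (wrap_around (size w) ((x w env).+1 + j)) == 0)).
  exact: computable_size.
apply: computable_eq (computable_const 0).
apply: (@computable_sum (fun _ env => (nth 0 env 0).+1) (fun w env j =>
  same_var w (x w (behead env)) (wrap_around (size w) ((x w (behead env)).+1 + j)))).
  by computes.
by apply: computable_same_var; computes; apply: wrapP; computes.
Qed.

Lemma nat_bits_shift j n : 0 < n -> nat_bits (n * 2 ^ j) = nseq j false ++ nat_bits n.
Proof.
move=> n0; elim: j => [|j IH]; first by rewrite muln1.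
have -> : n * 2 ^ j.+1 = (n * 2 ^ j).*2 by rewrite expnS; lia.
by rewrite nat_bits_half ?double_gt0 ?muln_gt0 ?n0 ?expn_gt0 // odd_double doubleK IH.
Qed.

(** With the least significant digit first, adding [b] shifted beyond the digits of [a] appends its
    digits. *)
Lemma nat_bits_cat a j b : 0 < b ->
  nat_bits (b * 2 ^ (size (nat_bits a) + j) + a) = nat_bits a ++ nseq j false ++ nat_bits b.
Proof.
move=> b0; have [k] := ubnP a; elim: k a => // k IH a ak.
have [->|a0] := posnP a; first by rewrite addn0 nat_bits_shift.
rewrite (nat_bits_half a0) /= -IH; last first.
  by rewrite -ltnS; apply: leq_trans ak; rewrite ltnS; move: a0; clear; lia.
rewrite addSn expnS; set y := 2 ^ _.
have -> : b * (2 * y) + a = odd a + (b * y + a./2).*2.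
  by rewrite -{1}(odd_double_half a); move: (odd a) a./2 => o h; lia.
have by0 : 0 < b * y by rewrite muln_gt0 b0 expn_gt0.
rewrite nat_bits_half; last by move: by0; clear; lia.
rewrite oddD odd_double addbF oddb; congr cons; congr nat_bits.
by rewrite halfD odd_double andbF add0n doubleK; case: (odd a).
Qed.

Lemma encode_rat_nat m : encode_rat m%:R%R = Bit false :: encode_nat m ++ [:: Bit true; Comma].
Proof.
by rewrite /encode_rat pmulrn numq_int denq_int /= -[(_ < 0)%R]negbK -leNgt ler0z.
Qed.

Lemma flatten_map_flatten (T U : Type) (f : T -> seq U) ss :
  flatten (map f (flatten ss)) = flatten [seq flatten (map f s) | s <- ss].
Proof. by elim: ss => //= s ss IH; rewrite map_cat flatten_cat IH. Qed.

Lemma prints_nat f : computable f -> prints (fun w env => encode_nat (f w env)).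
Proof.
move=> cf; apply: prints_ext (prints_cat (prints_bits Bit cf) (prints_emit Comma)) => w env.
by rewrite /encode_nat cats1.
Qed.

Lemma prints_zeros f : computable f -> prints (fun w env => nseq (f w env) (Bit false)).
Proof.
move=> cf.
have := @prints_for f (fun _ _ _ => [:: Bit false]) cf (prints_emit (Bit false)).
apply: prints_ext => w env; move: (f w env) => n.
by elim: n 0 => //= n IH i; rewrite -IH.
Qed.

(** * The encoded instance as a word *)

Section Encoding.
Variables (M : nat) (st sg fl : nat -> bool) (ce nx : nat -> nat).
Hypothesis M_gt0 : 0 < M.
Hypothesis nx_lt : forall p, p < M -> nx p < M.
Hypothesis nx_inj : forall p q, p < M -> q < M -> nx p = nx q -> p = q.

Definition pair_word (ab : vkind * vkind) : word :=
  encode_nat (code M ab.1) ++ encode_nat (code M ab.2).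

Definition cell_word (p k : nat) : word := flatten (map pair_word (cell_edges M st ce p k)).

Definition line_word (h t : nat) : word := pair_word (line_edge M h t).

Definition hub_word (h : nat) : word :=
  flatten [seq line_word h t | t <- iota 0 (2 * Dlen M + Llen M)] ++
  pair_word (leaf1 h, Ln h 0) ++ pair_word (leaf2 sg nx h, Ln h (2 * Dlen M)) ++
  pair_word (center nx h, Ln h (2 * Dlen M + Llen M)).

Lemma edge_list_word : flatten (map pair_word (edge_list M st sg ce nx)) =
  flatten [seq flatten [seq cell_word p k | k <- iota 0 7] | p <- iota 0 M] ++
  flatten [seq hub_word h | h <- iota 0 (2 * M)].
Proof.
rewrite /edge_list map_cat flatten_cat !flatten_map_flatten -!map_comp; congr cat; congr flatten.
  by apply: eq_map => p; rewrite [LHS]flatten_map_flatten -map_comp.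
apply: eq_map => h /=; rewrite /hub_edges map_cat flatten_cat flatten_map_flatten -map_comp.
rewrite /hub_word /= cats0; congr cat; congr flatten; apply: eq_map => t /=.
by rewrite cats0.
Qed.

(** The levels of the spine are exponential and cannot be computed in unary; their digits are
    described directly, the exponents being lengths of runs. *)
Definition level_bits (x : nat) : seq bool :=
  if x == 0 then nseq (top_exp M) false ++ nat_bits (K M)
  else if x <= 3 * M then nseq (mid_exp M) false ++ nat_bits (K M)
  else let y := x - (3 * M).+1 in
    nat_bits (if y < 7 * M then
      unit_water M * (if y %% 7 < 2 then 0 else if y %% 7 < 6 then 1 else ~~ fl (y %/ 7))
    else 0).

Lemma level_bitsE x : nat_bits (level M fl (decode M x)) = level_bits x.
Proof.
rewrite /level_bits /decode; case: eqP => [->|/eqP x0]; first exact: (nat_bits_shift (top_exp M) (ltn0Sn (3 * M).*2)).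
case: (leqP x (3 * M)) => _; first by case: x x0 => // x _; exact: (nat_bits_shift (mid_exp M) (ltn0Sn (3 * M).*2)).
by rewrite /=; case: (ltnP _ (7 * M)) => //= _; rewrite muln0.
Qed.

Definition level_word (x : nat) : word :=
  Bit false :: [seq Bit b | b <- level_bits x] ++ [:: Comma; Bit true; Comma].

Definition threshold_bits : seq bool :=
  nat_bits (excess M) ++ nseq (4 * (order_pred M).+1) false ++
  nat_bits (3 * M) ++ nseq (10 * (order_pred M).+1) false ++ [:: true].

Lemma threshold_bitsE : nat_bits (threshold_nat M) = threshold_bits.
Proof.
rewrite /threshold_bits; have := @nat_bits_cat (3 * M) (10 * (order_pred M).+1) 1 isT.
rewrite mul1n => <-; rewrite -nat_bits_cat; last by rewrite addn_gt0 expn_gt0.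
congr nat_bits; rewrite /threshold_nat /top_exp -/(mid_exp M) mulnDl -expnD.
by rewrite [_ + mid_exp M]addnC.
Qed.

Lemma encode_instance :
  encode_water_instance (reduction_instance st sg fl ce M_gt0 nx_lt nx_inj) =
  encode_nat (order_pred M).+1 ++
  (flatten [seq flatten [seq cell_word p k | k <- iota 0 7] | p <- iota 0 M] ++
   flatten [seq hub_word h | h <- iota 0 (2 * M)] ++ [:: Semicolon]) ++
  (flatten [seq level_word x | x <- iota 0 (order_pred M).+1] ++ [:: Semicolon]) ++
  encode_nat (3 * M) ++
  (Bit false :: [seq Bit b | b <- threshold_bits] ++ [:: Comma; Bit true; Comma]).
Proof.
rewrite /encode_water_instance /encode_list -!cats1.
rewrite [in RHS](catA (flatten [seq flatten [seq cell_word p k | k <- iota 0 7] | p <- iota 0 M])).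
rewrite -edge_list_word.
congr cat; congr cat; first congr cat; last (congr cat; first congr cat).
- rewrite /= /graph_edges -map_comp; congr flatten; apply/eq_in_map => -[a b].
  move=> /(mem_edge_list _ _ _ M_gt0 nx_lt) [va vb _].
  by rewrite /= /encode_edge /pair_word /vtx !inordK ?code_lt.
- rewrite -val_enum_ord -!map_comp; congr flatten; apply: eq_map => u /=.
  by rewrite ffunE encode_rat_nat /kind /level_word -level_bitsE /encode_nat -cats1 -catA.
- rewrite /= encode_rat_nat -threshold_bitsE /vtx inordK ?code_lt //=.
  by rewrite /encode_nat -!cats1 -!catA.
Qed.
End Encoding.

Ltac computes_string := computes_with ltac:(fun _ => match goal with
  | |- computable (fun w env => nat_of_bool (starts w (@?f w env))) => apply (@computable_starts f)
  | |- computable (fun w env => nat_of_bool (sign w (@?f w env))) => apply (@computable_at f (Bit true))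
  | |- computable (fun w env => nat_of_bool (clause_stop w (@?f w env))) => rewrite /clause_stop
  | |- computable (fun w env => clause_end w (@?f w env)) => apply (@computable_clause_end f)
  | |- computable (fun w env => next_occ w (@?f w env)) => apply (@computable_next_occ f)
  end).

Lemma prints_pair f g : computable f -> computable g ->
  prints (fun w env => encode_nat (f w env) ++ encode_nat (g w env)).
Proof. by move=> cf cg; apply: prints_cat; apply: prints_nat. Qed.

Lemma computable_layer p k : computable p -> computable k ->
  computable (fun w env => layer (size w) (starts w) (clause_end w) (p w env) (k w env)).
Proof. by move=> cp ck; rewrite /layer; computes_string. Qed.

Lemma prints_cell p k : computable p -> computable k ->
  prints (fun w env => cell_word (size w) (starts w) (clause_end w) (p w env) (k w env)).
Proof.
move=> cp ck; have cl := computable_layer cp ck.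
apply: (@prints_ext _ (fun w env =>
  if layer (size w) (starts w) (clause_end w) (p w env) (k w env) < 3 * size w then
  (encode_nat ((3 * size w).+1 + (7 * p w env + k w env)) ++
   encode_nat (layer (size w) (starts w) (clause_end w) (p w env) (k w env))) ++
  (encode_nat ((3 * size w).+1 + (7 * p w env + k w env)) ++
   encode_nat (layer (size w) (starts w) (clause_end w) (p w env) (k w env)).+1)
  else [::])).
  by move=> w env; rewrite /cell_word /cell_edges; case: ifP => //= _; rewrite cats0.
apply: prints_if; [by computes| |exact: prints_nil].
by apply: prints_cat; apply: prints_pair; computes.
Qed.

Lemma prints_hub h : computable h ->
  prints (fun w env => hub_word (size w) (sign w) (next_occ w) (h w env)).
Proof.
move=> ch; rewrite /hub_word; apply: prints_cat.
  apply: (@prints_for (fun w _ => 2 * Dlen (size w) + Llen (size w))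
    (fun w env t => line_word (size w) (h w env) t)).
    by rewrite /Llen /Dlen; computes.
  rewrite /line_word /pair_word /line_edge /= /Zlen /spider_size /Llen /Dlen.
  by apply: prints_pair; computes.
have cv : computable (fun w env => hub_var (next_occ w) (h w env)).
  by rewrite /hub_var; computes_string.
rewrite /pair_word /= /Zlen /spider_size /Llen /Dlen.
by repeat apply: prints_cat; apply: prints_nat; computes_string.
Qed.

Lemma prints_level x : computable x ->
  prints (fun w env => level_word (size w) (clause_stop w) (x w env)).
Proof.
move=> cx.
have cn : computable (fun w _ => (order_pred (size w)).+1).
  by rewrite /order_pred /Zlen /spider_size /Llen /Dlen; computes.
have ce : computable (fun w _ => excess (size w)).
  by rewrite /excess /W1 /Llen /Dlen; computes.
have cK : computable (fun w _ => K (size w)) by rewrite /K; computes.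
have const_map (s : seq bool) : [seq Bit false | b <- s] = nseq (size s) (Bit false).
  by elim: s => //= _ s ->.
have prints_mid : prints (fun w _ => [seq Bit b | b <- nseq (mid_exp (size w)) false]).
  apply: (@prints_ext _ (fun w _ => [seq Bit false | b <- nat_bits (excess (size w))] ++
    nseq (4 * (order_pred (size w)).+1) (Bit false))).
    by move=> w _; rewrite map_nseq const_map /mid_exp nseqD.
  by apply: prints_cat; [exact: (prints_bits (fun=> Bit false))|apply: prints_zeros; computes].
have prints_top : prints (fun w _ => [seq Bit b | b <- nseq (top_exp (size w)) false]).
  apply: (@prints_ext _ (fun w _ => [seq Bit b | b <- nseq (mid_exp (size w)) false] ++
    [seq Bit false | b <- nat_bits (3 * size w)] ++
    nseq (10 * (order_pred (size w)).+1) (Bit false))).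
    by move=> w _; rewrite !map_nseq const_map /top_exp !nseqD.
  apply: prints_cat => //; apply: prints_cat; last by apply: prints_zeros; computes.
  by apply: (prints_bits (fun=> Bit false)); computes.
apply: (prints_cat (prints_emit (Bit false))).
apply: prints_cat; last first.
  exact: (prints_cat (prints_emit Comma) (prints_cat (prints_emit (Bit true)) (prints_emit Comma))).
rewrite /level_bits.
apply: (@prints_ext _ (fun w env =>
  if x w env == 0 then [seq Bit b | b <- nseq (top_exp (size w)) false] ++ [seq Bit b | b <- nat_bits (K (size w))]
  else if x w env <= 3 * size w then
    [seq Bit b | b <- nseq (mid_exp (size w)) false] ++ [seq Bit b | b <- nat_bits (K (size w))]
  else [seq Bit b | b <- nat_bits (if x w env - (3 * size w).+1 < 7 * size w then
      unit_water (size w) * (if (x w env - (3 * size w).+1) %% 7 < 2 then 0 else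
        if (x w env - (3 * size w).+1) %% 7 < 6 then 1
        else ~~ clause_stop w ((x w env - (3 * size w).+1) %/ 7)) else 0)])).
  by move=> w env; do 2?[case: ifP => _]; rewrite ?map_cat.
apply: prints_if; first by computes.
  by apply: prints_cat => //; exact: prints_bits.
apply: prints_if; first by computes.
  by apply: prints_cat => //; exact: prints_bits.
by apply: prints_bits; rewrite /unit_water /W1 /Llen /Dlen /K; computes_string.
Qed.

Definition cnf_instance (F : cnf) : water_instance :=
  let w := encode_cnf F in
  reduction_instance (starts w) (sign w) (clause_stop w) (clause_end w)
    (size_pos F) (@next_occ_lt F) (@next_occ_inj F).

(** By [encode_instance], the output is a function of the input word alone, so the printing program
    never has to decode the formula. *)
Definition instance_word (w : word) : word :=
  encode_nat (order_pred (size w)).+1 ++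
  (flatten [seq flatten [seq cell_word (size w) (starts w) (clause_end w) p k | k <- iota 0 7]
           | p <- iota 0 (size w)] ++
   flatten [seq hub_word (size w) (sign w) (next_occ w) h | h <- iota 0 (2 * size w)] ++
   [:: Semicolon]) ++
  (flatten [seq level_word (size w) (clause_stop w) x | x <- iota 0 (order_pred (size w)).+1] ++
   [:: Semicolon]) ++
  encode_nat (3 * size w) ++
  (Bit false :: [seq Bit b | b <- threshold_bits (size w)] ++ [:: Comma; Bit true; Comma]).

Lemma prints_instance : prints (fun w _ => instance_word w).
Proof.
have cn : computable (fun w _ => (order_pred (size w)).+1).
  by rewrite /order_pred /Zlen /spider_size /Llen /Dlen; computes.
apply: prints_cat; first exact: prints_nat.
apply: prints_cat.
  apply: prints_cat; last apply: (fun H => prints_cat H (prints_emit Semicolon)).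
    apply: (@prints_for (fun w _ => size w) (fun w env p =>
      flatten [seq cell_word (size w) (starts w) (clause_end w) p k | k <- iota 0 7])).
      exact: computable_size.
    apply: (@prints_for (fun _ _ => 7) (fun w env k =>
      cell_word (size w) (starts w) (clause_end w) (nth 0 env 0) k)).
      exact: computable_const.
    exact: prints_cell (computable_weak (computable_var 0)) (computable_var 0).
  apply: (@prints_for (fun w _ => 2 * size w) (fun w env h =>
    hub_word (size w) (sign w) (next_occ w) h)); first by computes.
  by apply: prints_hub; computes.
apply: prints_cat.
  apply: (fun H => prints_cat H (prints_emit Semicolon)).
  apply: (@prints_for (fun w _ => (order_pred (size w)).+1) (fun w env x =>
    level_word (size w) (clause_stop w) x)) => //.
  by apply: prints_level; computes.
apply: prints_cat; first by apply: prints_nat; computes.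
apply: (prints_cat (prints_emit (Bit false))).
apply: prints_cat; last first.
  exact: (prints_cat (prints_emit Comma) (prints_cat (prints_emit (Bit true)) (prints_emit Comma))).
apply: (@prints_ext _ (fun w _ => [seq Bit b | b <- nat_bits (excess (size w))] ++
  nseq (4 * (order_pred (size w)).+1) (Bit false) ++ [seq Bit b | b <- nat_bits (3 * size w)] ++
  nseq (10 * (order_pred (size w)).+1) (Bit false) ++ [:: Bit true])).
  by move=> w _; rewrite /threshold_bits !map_cat !map_nseq.
apply: prints_cat; first by apply: prints_bits; rewrite /excess /W1 /Llen /Dlen; computes.
apply: prints_cat; first by apply: prints_zeros; computes.
apply: prints_cat; first by apply: prints_bits; computes.
apply: prints_cat; first by apply: prints_zeros; computes.
exact: prints_emit.
Qed.

Lemma cnf_instance_poly_time : poly_time_computable encode_cnf3 encode_water_instance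
  (fun F => cnf_instance (sval F)).
Proof.
apply: prints_poly_time prints_instance _ => F; exact: encode_instance.
Qed.

Local Open Scope ring_scope.
Theorem theorem4p1 (R : realType) :
  exists f : cnf3 -> water_instance,
    poly_time_computable encode_cnf3 encode_water_instance f /\
    forall F : cnf3,
      satisfiable (sval F) <-> ratr (threshold (f F)) < instance_kappa R (f F).
Proof.
exists (fun F => cnf_instance (sval F)); split; first exact: cnf_instance_poly_time.
move=> F; apply: iff_trans (satisfiable_csp (sval F)) _.
apply: instance_correct => p sp pM; exact: starts_clause_end.
Qed.
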